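(* Let $k\ge 2$ be an integer. For $n \ge 0$ and $t \geq 0$ set $s_n(t) := \tau[(W_t^k)^n]$ (so $s_0(t)=1$), where $W_t^k = G_t^k (G_t^k)^{\star}$ and $G_t^k = U_t^1+\dots+U_t^k$. Then for any $n \geq 1$ and $t>0$, $$\partial_t s_n(t) = -n s_n(t) + nk\, s_{n-1}(t) + nk\sum_{j=0}^{n-2} s_{n-j-1}(t)s_j(t) - \frac{n}{k}\sum_{j=0}^{n-2} s_{n-j-1}(t)s_{j+1}(t),$$ where an empty sum is zero.
   Context: $(\mathscr{A},\tau)$ is a tracial non commutative probability space (a von Neumann algebra with faithful normal tracial state $\tau$). A free unitary Brownian motion is the solution of the free stochastic differential equation $dU_t = iU_t\,dX_t - \frac{1}{2}U_t\,dt$, $U_0 = {\bf 1}$, where $(X_t)_{t \ge 0}$ is a free additive Brownian motion. $(U_t^j)_{t\ge0}$, $1\le j\le k$, are $k$ $\star$-free copies of the free unitary Brownian motion in $(\mathscr{A},\tau)$, driven by $k$ free additive Brownian motions $(X_t^j)_{t\ge 0}$ which are free from one another. *)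

(* Defs.v *)
From HB Require Import structures.
From mathcomp Require Import all_boot all_order all_algebra.
From mathcomp Require Import complex.
From mathcomp Require Import all_classical all_reals all_analysis.
Import Order.TTheory GRing.Theory Num.Theory.
Import numFieldNormedType.Exports.
Set Implicit Arguments.
Unset Strict Implicit.
Unset Printing Implicit Defensive.
Local Open Scope classical_set_scope.
Local Open Scope ring_scope.
Local Open Scope complex_scope.

Section Operators.
Variables (R : realType) (H : completeNormedModType R[i]).

Definition bounded_op (T : H -> H) : Prop := linear T /\ continuous T.

Definition commutant (S : set (H -> H)) : set (H -> H) :=
  [set T | bounded_op T /\ forall a, S a -> T \o a = a \o T].

End Operators.

(* A von Neumann algebra acting on a Hilbert space.  The algebra is presented
   as an abstract R[i]-algebra A with involution star, identified through the
   faithful unital *-representation pi with a *-algebra of bounded operators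
   equal to its own double commutant.  The norm of H is the one of the inner
   product ip (antilinear in the second variable). *)
Record von_neumann_algebra (R : realType) (A : algType R[i]) (star : A -> A)
    (H : completeNormedModType R[i]) (ip : {dot H for Num.conj})
    (pi : A -> H -> H) : Prop := {
  vna_hilbert : forall x, `|x| ^+ 2 = ip x x ;
  vna_bounded : forall a, bounded_op (pi a) ;
  vna_linear : forall c a b x, pi (c *: a + b) x = c *: pi a x + pi b x ;
  vna_one : pi 1 = id ;
  vna_mul : forall a b, pi (a * b) = pi a \o pi b ;
  vna_inj : injective pi ;
  vna_star : forall a x y, ip (pi a x) y = ip x (pi (star a) y) ;
  vna_bicommutant : range pi = commutant (commutant (range pi)) }.

Section Trace.
Variables (R : realType) (A : algType R[i]) (star : A -> A).
Variables (H : completeNormedModType R[i]) (ip : {dot H for Num.conj}).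
Variables (pi : A -> H -> H) (tau : {scalar A}).

Definition op_le (a b : A) : Prop := forall x, 0 <= ip (pi (b - a) x) x.

Definition is_op_lub (D : set A) (b : A) : Prop :=
  (forall a, D a -> op_le a b) /\
  (forall c, (forall a, D a -> op_le a c) -> op_le b c).

Definition op_directed (D : set A) : Prop :=
  forall a b, D a -> D b -> exists c, [/\ D c, op_le a c & op_le b c].

(* Preservation of suprema of increasing nets of self-adjoint elements;
   the other inequality, tau a <= tau b for a in D, is positivity. *)
Definition normal_functional : Prop :=
  forall (D : set A) (b : A), D !=set0 -> (forall a, D a -> star a = a) ->
    op_directed D -> is_op_lub D b ->
    forall c : R[i], (forall a, D a -> tau a <= c) -> tau b <= c.

Record faithful_normal_tracial_state : Prop := {
  tr_positive : forall a, 0 <= tau (star a * a) ;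
  tr_unit : tau 1 = 1 ;
  tr_faithful : forall a, tau (star a * a) = 0 -> a = 0 ;
  tr_tracial : forall a b, tau (a * b) = tau (b * a) ;
  tr_normal : normal_functional }.

End Trace.

Section Freeness.
Variables (R : realType) (A : algType R[i]) (star : A -> A) (tau : {scalar A}).

Record star_subalgebra (B : set A) : Prop := {
  ssa_one : B 1 ;
  ssa_lin : forall (c : R[i]) a b, B a -> B b -> B (c *: a + b) ;
  ssa_mul : forall a b, B a -> B b -> B (a * b) ;
  ssa_star : forall a, B a -> B (star a) }.

Definition star_alg (S : set A) : set A := smallest star_subalgebra S.

(* *-freeness of the family (S i)_i: products of centred elements taken
   alternately from the generated unital *-algebras are centred.
   The word a 0 * ... * a m is non-empty. *)
Definition star_free (I : Type) (S : I -> set A) : Prop :=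
  forall (m : nat) (i : nat -> I) (a : nat -> A),
    (forall l, (l <= m)%N -> star_alg (S (i l)) (a l) /\ tau (a l) = 0) ->
    (forall l, (l < m)%N -> i l <> i l.+1) ->
    tau (\prod_(l < m.+1) a l) = 0.

(* Centred semicircular element of variance v: the odd moments vanish, and
   the moment of order 2m is v^m times the m-th Catalan number. *)
Definition semicircular (v : R) (x : A) : Prop :=
  [/\ star x = x,
      forall m, tau (x ^+ m.*2) = 'C(m.*2, m)%:R / m.+1%:R * v%:C ^+ m &
      forall m, tau (x ^+ m.*2.+1) = 0].

Definition l2sq (a : A) : R := complex.Re (tau (star a * a)).

End Freeness.

Section Processes.
Variables (R : realType) (A : algType R[i]) (star : A -> A).
Variables (H : completeNormedModType R[i]) (pi : A -> H -> H).
Variable (tau : {scalar A}).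

(* Von Neumann subalgebra generated by S, by the double commutant theorem. *)
Definition vn_generated (S : set A) : set A :=
  [set a | commutant (commutant (pi @` (S `|` star @` S))) (pi a)].

Definition filtration (X : R -> A) (t : R) : set A :=
  vn_generated [set X r | r in `[0, t]].

Record free_brownian_motion (X : R -> A) : Prop := {
  fbm_0 : X 0 = 0 ;
  fbm_increment : forall s t : R, 0 <= s -> s < t ->
    semicircular star tau (t - s) (X t - X s) ;
  fbm_free : forall s t : R, 0 <= s -> s < t ->
    star_free star tau
      (fun b : bool => if b then [set X t - X s] else filtration X s) }.

(* V is a simple process on [0, T[, adapted to F, constant on the intervals
   [p i, p (i+1)[ of the subdivision 0 = p 0 < ... < p N = T. *)
Record simple_process (F : R -> set A) (T : R) (N : nat) (p : nat -> R)
    (V : R -> A) : Prop := {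
  sp_first : p 0%N = 0 ;
  sp_last : p N = T ;
  sp_incr : forall i, (i < N)%N -> p i < p i.+1 ;
  sp_adapted : forall i, (i < N)%N -> F (p i) (V (p i)) ;
  sp_cst : forall i s, (i < N)%N -> p i <= s < p i.+1 -> V s = V (p i) }.

Definition simple_integral (Z : R -> A) (N : nat) (p : nat -> R)
    (V : R -> A) : A :=
  \sum_(i < N) V (p i) * (Z (p i.+1) - Z (p i)).

(* J = \int_0^T V_s dZ_s, as the L^2(tau)-limit of integrals of adapted simple
   processes converging to V in L^2([0, T]; L^2(tau)).  For Z a free Brownian
   motion with filtration F, this is the free Ito integral (well defined by
   the isometry); for Z_s = s 1, it is the Bochner integral of V. *)
Definition is_integral (F : R -> set A) (Z V : R -> A) (T : R) (J : A)
    : Prop :=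
  exists (N : nat -> nat) (p : nat -> nat -> R) (Vn : nat -> R -> A),
    [/\ forall n, simple_process F T (N n) (p n) (Vn n),
        (fun n => \int[lebesgue_measure]_(s in `[0%R, T])
                    (l2sq star tau (Vn n s - V s))%:E)%E @ \oo --> 0%E &
        (fun n => l2sq star tau (simple_integral Z (N n) (p n) (Vn n) - J))
           @ \oo --> (0 : R)].

(* Continuity on [0, +oo[ for the operator norm. *)
Definition op_norm_continuous (U : R -> A) : Prop :=
  forall (t e : R), 0 <= t -> 0 < e -> exists2 d : R, 0 < d &
    forall s : R, 0 <= s -> `|s - t| < d ->
      forall x : H, `|pi (U s - U t) x| <= e%:C * `|x|.

(* Norm-continuous adapted solution, driven by the free Brownian motion X, of
   dU_t = i U_t dX_t - (1/2) U_t dt,  U_0 = 1. *)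
Record free_unitary_brownian_motion (X U : R -> A) : Prop := {
  fubm_driver : free_brownian_motion X ;
  fubm_adapted : forall t : R, 0 <= t -> filtration X t (U t) ;
  fubm_continuous : op_norm_continuous U ;
  fubm_0 : U 0 = 1 ;
  fubm_sde : forall t : R, 0 <= t -> exists J K : A,
    [/\ is_integral (filtration X) X U t J,
        is_integral (filtration X) (fun s => s%:C%:A) U t K &
        U t = 1 + 'i *: J - 2^-1 *: K] }.

Definition G_sum (k : nat) (U : 'I_k -> R -> A) (t : R) : A :=
  \sum_(j < k) U j t.

Definition W_prod (k : nat) (U : 'I_k -> R -> A) (t : R) : A :=
  G_sum U t * star (G_sum U t).

Definition s_moment (k : nat) (U : 'I_k -> R -> A) (n : nat) (t : R) : R[i] :=
  tau (W_prod U t ^+ n).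

End Processes.

(* The function f of a real variable is differentiable at t, with derivative l;
   R[i]^o is R[i] with its usual topology. *)
Definition has_derivative (R : realType) (f : R -> R[i]) (t : R) (l : R[i])
    : Prop :=
  (h%:C^-1 * (f (t + h) - f t)) @[h --> (0 : R)^'] --> (l : R[i]^o).

(* Main.v *)
(* The moments of W are sums of mixed moments of the free family (U j), and a
   mixed moment of a free family is a polynomial in the moments of the
   individual processes; so it suffices to differentiate the latter and to
   transport the result through freeness.

   One process.  For s < s' close to t, U s' - U s = 'i U s x - (s' - s) U s / 2
   + r with x = X s' - X s semicircular and free from the past.  In a word in U
   and its adjoint, the terms of order at least 3 in U s' - U s are o(s' - s)
   because U is norm continuous and |U s' - U s|_2 ^ 2 = O(s' - s); freeness of
   x gives tau (a x b x) = (s' - s) tau a tau b.  Bounding |c a|_2 by the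
   operator norm of c requires a square root of 1 - c^* c in the algebra.  The
   resulting differential equations show that U is unitary and that all the
   U j have the same moments.

   Free family.  The second order coefficient of a word is the sum over pairs
   of letters with the same index of +/- tau (inner) tau (outer).  In a product
   of centred elements taken alternately from the algebras of the U j, a pair
   of letters from different factors contributes 0 by freeness, which is
   exactly the relation that determines the derivative of a mixed moment by
   induction on the length of the word.

   For W ^ n, exchangeability gives tau (U j G^* W ^ p) = s (p + 1) / k, and the
   pairs of letters sum up to the stated right-hand side. *)
Require Import Defs.
From HB Require Import structures.
From mathcomp Require Import all_boot all_order all_algebra.
From mathcomp Require Import perm complex.
From mathcomp Require Import all_classical all_reals all_analysis.
From mathcomp Require Import ring lra zify.
Import Order.TTheory GRing.Theory Num.Theory.
Import numFieldNormedType.Exports.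
Set Implicit Arguments.
Unset Strict Implicit.
Unset Printing Implicit Defensive.
Local Open Scope classical_set_scope.
Local Open Scope ring_scope.
Local Open Scope complex_scope.

(** Each [U j] is adapted to the filtration of its own driver, so stochastic calculus is done for
    one process at a time and the joint statement is pure algebra. There the point is that the
    freeness relation for products of centred blocks survives formal differentiation. Jets make this
    a computation: they carry the candidate second order term through an associative product, so
    that a word can be cut into letters, blocks or sums at will. [is_integral] gives some
    approximating simple processes, unrelated for different end points. Every integral is therefore
    first pinned down by Riemann sums of [U] itself; its increments are then compared with a single
    step. Expansions are anchored at the left end s of a pair s < s', because the increment is free
    from the past at s. Uniformity in such pairs near t, together with continuity of the
    coefficients, gives two-sided derivatives at t. Unitarity comes from two moments: with V = U
    star U, the derivatives of tau V and tau (V V) vanish by cancellation of signs alone, so both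
    equal 1, and tau ((V - 1) (V - 1)) = 0 gives V = 1 by faithfulness. *)

Local Notation cabs := Normc.normc.

(** * Complex numbers *)

Section ComplexModulus.
Variable R : realType.
Implicit Types z w : R[i].

Lemma cabsE z : `|z| = (cabs z)%:C. Proof. by []. Qed.

Lemma cabsD z w : cabs (z + w) <= cabs z + cabs w.
Proof. exact: le_normcD. Qed.

Lemma cabsN z : cabs (- z) = cabs z.
Proof. exact: normcN. Qed.

Lemma cabsM z w : cabs (z * w) = cabs z * cabs w.
Proof. exact: Normc.normcM. Qed.

Lemma cabs_real (x : R) : cabs x%:C = `|x|.
Proof. by rewrite /= expr0n addr0 sqrtr_sqr. Qed.

Lemma cabs_ge0 z : 0 <= cabs z.
Proof. by case: z => a b /=; exact: sqrtr_ge0. Qed.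

Lemma cabs_sqr z : cabs z ^+ 2 = complex.Re z ^+ 2 + complex.Im z ^+ 2.
Proof. by case: z => a b /=; rewrite sqr_sqrtr// addr_ge0// sqr_ge0. Qed.

Lemma cabs_ge_Re z : `|complex.Re z| <= cabs z.
Proof. by rewrite -lecR -cabsE; exact: normc_ge_Re. Qed.

Lemma cabs_conj z : cabs (conjc z) = cabs z.
Proof. by case: z => a b /=; rewrite sqrrN. Qed.

Lemma cabs_eq0 z : cabs z = 0 -> z = 0.
Proof. exact: Normc.eq0_normc. Qed.

Lemma cabs0 : cabs (0 : R[i]) = 0.
Proof. exact: Normc.normc0. Qed.

Lemma cabs1 : cabs (1 : R[i]) = 1.
Proof. exact: Normc.normc1. Qed.

Lemma cabs_i : cabs ('i : R[i]) = 1.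
Proof. by rewrite /= expr0n expr1n add0r sqrtr1. Qed.

Lemma conjcM z w : conjc (z * w) = conjc z * conjc w.
Proof. exact: (rmorphM conjc). Qed.

Lemma conjcD z w : conjc (z + w) = conjc z + conjc w.
Proof. exact: (rmorphD conjc). Qed.

Lemma conjcN z : conjc (- z) = - conjc z.
Proof. exact: (rmorphN conjc). Qed.

Lemma conjc_invol z : conjc (conjc z) = z.
Proof. exact: conjcK. Qed.

(** Stated for an abstract definite sesquilinear form because it serves twice: for [ip] on [H] (norm
    of an adjoint) and for the form tau (star v * u) on [A]. The vector [c *: y + x] with c = - B x
    y / B y y is the shortest one of its line. *)
Lemma cauchy_schwarz (V : lmodType R[i]) (B : V -> V -> R[i]) :
  (forall c (x y z : V), B (c *: x + y) z = c * B x z + B y z) ->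
  (forall x y, B y x = conjc (B x y)) ->
  (forall x, 0 <= B x x) -> (forall x, B x x = 0 -> x = 0) ->
  forall x y, cabs (B x y) ^+ 2 <= complex.Re (B x x) * complex.Re (B y y).
Proof.
move=> Bl BC B0 Bd x y.
have Br c (u v w : V) : B w (c *: u + v) = conjc c * B w u + B w v.
  by rewrite BC Bl rmorphD rmorphM /= -!BC.
have BR u : B u u = (complex.Re (B u u))%:C.
  by rewrite RRe_real// ger0_real.
have [y0|y0] := eqVneq (B y y) 0.
  have B00 (u : V) : B u 0 = 0.
    have := Br 1 0 0 u; rewrite scaler0 addr0 rmorph1 mul1r => h.
    by apply: (addrI (B u 0)); rewrite addr0 -h.
  by rewrite (Bd _ y0) !B00 cabs0 expr0n /= mulr0.
set b := B x y; pose c := - (b / B y y).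
have := B0 (c *: y + x).
rewrite Bl !Br (BC x y) -/b.
have -> : c * (conjc c * B y y + conjc b) + (conjc c * b + B x x) = B x x - (b * conjc b) / B y y.
  have -> : conjc c = - (conjc b / B y y).
    by rewrite {1}[B y y]BC /c [LHS](rmorphN conjc) (rmorphM conjc) (fmorphV conjc).
  rewrite /c.
  by field.
rewrite -sqr_normc cabsE (BR x) (BR y) -rmorphXn -fmorphV -rmorphM -rmorphB lecR /=.
have y1 : 0 < complex.Re (B y y).
  by rewrite -ltcR -BR lt_def y0 B0.
by rewrite subr_ge0 ler_pdivrMr.
Qed.

End ComplexModulus.

(** * The *-algebra and operator norms *)

Section VNA.
Variables (R : realType) (A : algType R[i]) (star : A -> A)
  (H : completeNormedModType R[i]) (ip : {dot H for Num.conj}) (pi : A -> H -> H).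
Hypothesis hA : von_neumann_algebra star ip pi.
Implicit Types (a b : A) (c : R[i]) (x y : H) (C D : R).

(** The record [von_neumann_algebra] says about [star] only that [pi (star a)] is the adjoint of
    [pi a]. The laws of the involution below are all read off from matrix coefficients through this
    criterion. *)
Lemma vna_eqP a b : (forall x y, ip (pi a x) y = ip (pi b x) y) -> a = b.
Proof.
move=> h; apply: (vna_inj hA); apply/funext => x; apply/eqP.
rewrite -subr_eq0 -(dnorm_eq0 ip) linearBl /= !linearBr /= !h.
by rewrite subrr.
Qed.

Lemma ipC x y : ip y x = conjc (ip x y).
Proof. by rewrite hermC /= expr0 mul1r. Qed.

Lemma vna_star' a x y : ip (pi (star a) x) y = ip x (pi a y).
Proof. by rewrite ipC -(vna_star hA) -ipC. Qed.

Lemma starK : involutive star.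
Proof. by move=> a; apply: vna_eqP => x y; rewrite !vna_star' (vna_star hA). Qed.

Lemma pi_lin c a b x : pi (c *: a + b) x = c *: pi a x + pi b x.
Proof. exact: (vna_linear hA). Qed.

Lemma piD a b x : pi (a + b) x = pi a x + pi b x.
Proof. by rewrite -[a]scale1r pi_lin !scale1r. Qed.

Lemma pi0 x : pi 0 x = 0.
Proof. by apply: (addrI (pi 0 x)); rewrite -piD !addr0. Qed.

Lemma piZ c a x : pi (c *: a) x = c *: pi a x.
Proof. by rewrite -[c *: a]addr0 pi_lin pi0 addr0. Qed.

Lemma piN a x : pi (- a) x = - pi a x.
Proof. by rewrite -scaleN1r piZ scaleN1r. Qed.

Lemma pi1 x : pi 1 x = x.
Proof. by rewrite (vna_one hA). Qed.

Lemma piM a b x : pi (a * b) x = pi a (pi b x).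
Proof. by rewrite (vna_mul hA). Qed.

Lemma star_lin c a b : star (c *: a + b) = conjc c *: star a + star b.
Proof.
apply: vna_eqP => x y; rewrite vna_star' !pi_lin linearPl linearPr /=.
by rewrite !vna_star'.
Qed.

Lemma starD a b : star (a + b) = star a + star b.
Proof. by rewrite -[a]scale1r star_lin [conjc 1]rmorph1 !scale1r. Qed.

Lemma star0 : star 0 = 0.
Proof. by apply: (addrI (star 0)); rewrite -starD !addr0. Qed.

Lemma starZ c a : star (c *: a) = conjc c *: star a.
Proof. by rewrite -[c *: a]addr0 star_lin star0 addr0. Qed.

Lemma starN a : star (- a) = - star a.
Proof. by apply/eqP; rewrite -addr_eq0 -starD addNr star0. Qed.

Lemma starM a b : star (a * b) = star b * star a.
Proof. by apply: vna_eqP => x y; rewrite !(vna_star', piM). Qed.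

Lemma star1 : star 1 = 1.
Proof. by apply: vna_eqP => x y; rewrite vna_star' !pi1. Qed.

Lemma star_sum (I : Type) (r : seq I) (f : I -> A) :
  star (\sum_(i <- r) f i) = \sum_(i <- r) star (f i).
Proof. by elim: r => [|i r IH]; rewrite ?big_nil ?star0 // !big_cons starD IH. Qed.

(** A bound instead of a norm: no supremum has to be formed, and estimates compose through
    inequalities between the constants. *)
Definition op_bound C a := forall x, `|pi a x| <= C%:C * `|x|.

Lemma op_boundM C D a b : 0 <= C -> op_bound C a -> op_bound D b -> op_bound (C * D) (a * b).
Proof.
move=> C0 ha hb x; rewrite piM (le_trans (ha _))// rmorphM -mulrA ler_wpM2l ?ler0c//.
Qed.

Lemma op_boundD C D a b : op_bound C a -> op_bound D b -> op_bound (C + D) (a + b).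
Proof. by move=> ha hb x; rewrite piD rmorphD mulrDl (le_trans (ler_normD _ _))// lerD. Qed.

Lemma op_boundZ C c a : op_bound C a -> op_bound (cabs c * C) (c *: a).
Proof. move=> ha x; rewrite piZ normrZ rmorphM -mulrA.
by apply: ler_wpM2l => //; exact: normr_ge0. Qed.

Lemma op_boundN C a : op_bound C a -> op_bound C (- a).
Proof. by move=> ha x; rewrite piN normrN. Qed.

Lemma op_bound_le C D a : C <= D -> op_bound C a -> op_bound D a.
Proof. by move=> CD ha x; rewrite (le_trans (ha x))// ler_wpM2r// lecR. Qed.

(** For z = star a x, Cauchy-Schwarz gives |z|^2 = ip x (a z) <= |x| C |z|, and |z| cancels. *)
Lemma op_bound_star C a : 0 <= C -> op_bound C a -> op_bound C (star a).
Proof.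
move=> C0 ha x.
have [->|n0] := eqVneq (pi (star a) x) 0; first by rewrite normr0 mulr_ge0// ler0c.
have n1 : 0 < `|pi (star a) x| by rewrite normr_gt0.
rewrite -(ler_pM2l n1) -expr2 (vna_hilbert hA) vna_star'.
have cs := @cauchy_schwarz R H ip (fun c x y z => _) (fun x y => ipC x y) (fun x => dnorm_ge0 ip x) _ x (pi a (pi (star a) x)).
have {}cs : cabs (ip x (pi a (pi (star a) x))) ^+ 2 <= complex.Re (ip x x) * complex.Re (ip (pi a (pi (star a) x)) (pi a (pi (star a) x))).
  apply: cs => [c u v w|u /eqP]; first by rewrite linearPl.
  by rewrite dnorm_eq0 => /eqP.
rewrite -!(vna_hilbert hA) in cs.
have p0 : 0 <= ip x (pi a (pi (star a) x)) by rewrite -vna_star' dnorm_ge0.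
rewrite -(ger0_norm p0) cabsE.
have : (cabs (ip x (pi a (pi (star a) x))))%:C ^+ 2 <= (`|x| * `|pi a (pi (star a) x)|) ^+ 2.
  rewrite -rmorphXn (le_trans _ (_ : ((complex.Re (`|x| ^+ 2) * complex.Re (`|pi a (pi (star a) x)| ^+ 2))%:C <= _)))//.
    by rewrite lecR.
  by rewrite rmorphM /= !RRe_real ?exprMn// ger0_real// exprn_ge0.
rewrite ler_pXn2r ?nnegrE ?mulr_ge0// ?ler0c ?cabs_ge0//.
move=> h; apply: (le_trans h); rewrite mulrC mulrA [_ * C%:C]mulrC ler_wpM2r//.
Qed.

Lemma bounded_op_bound (T : H -> H) : bounded_op T ->
  exists2 C, 0 < C & forall x, `|T x| <= C%:C * `|x|.
Proof.
case=> lin cont.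
pose fl := GRing.isLinear.Build R[i] H H *:%R T lin.
pose f : {linear H -> H} := HB.pack T fl.
have /linear_boundedP : bounded_near f (nbhs 0).
  by apply: continuous_linear_bounded; exact: (cont 0).
case=> M [Mr hM].
have M1 : 0 < `|M| + 1 by rewrite ltr_wpDl.
exists (complex.Re (`|M| + 1)).
  by rewrite -ltcR RRe_real// ger0_real// ltW.
move=> x; rewrite RRe_real; last by rewrite ger0_real// ltW.
by apply: (hM (`|M| + 1)); rewrite (le_lt_trans (real_ler_norm Mr))// ltrDl.
Qed.

Lemma op_bound_ex a : exists2 C, 0 < C & op_bound C a.
Proof. exact: bounded_op_bound (vna_bounded hA a). Qed.

End VNA.

(** * Completeness of the algebra for operator bounds *)

Section Completeness.
Variables (R : realType) (A : algType R[i]) (star : A -> A)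
  (H : completeNormedModType R[i]) (ip : {dot H for Num.conj}) (pi : A -> H -> H).
Hypothesis hA : von_neumann_algebra star ip pi.
Implicit Types (a b : A) (c : R[i]) (x y : H) (C D : R).
Local Notation opb := (op_bound pi).

Lemma bounded_opI (T : H -> H) C : linear T ->
  (forall x, `|T x| <= C%:C * `|x|) -> bounded_op T.
Proof.
move=> lin hC; split=> //.
pose fl := GRing.isLinear.Build R[i] H H *:%R T lin.
pose f : {linear H -> H} := HB.pack T fl.
apply: (@bounded_linear_continuous _ _ _ f); apply/linear_boundedP.
exists C%:C; split; first exact: (ger0_real (lexx _)) || by apply/complex_realP; exists C.
by move=> M CM x; rewrite (le_trans (hC x))// ler_wpM2r// ltW.
Qed.

Let rn x : R := complex.Re `|x|.
Let rnE x : `|x| = (rn x)%:C.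
Proof. by rewrite /rn RRe_real// ger0_real. Qed.

Lemma half_pow_gt (e K : R) : 0 < e -> exists n : nat, 2^-1 ^+ n * K < e.
Proof.
move=> e0; have : (fun n : nat => 2^-1 ^+ n * K) @ \oo --> (0 * K : R).
  by apply: cvgM; [apply: cvg_expr; rewrite ger0_norm; lra|exact: cvg_cst].
rewrite mul0r => /cvgrPdist_lt /(_ _ e0) [n _ /(_ n (leqnn n))] /=.
rewrite sub0r normrN => h; exists n; exact: (le_lt_trans (ler_norm _) h).
Qed.

Lemma norm_small0 x (K : R) : (forall n, `|x| <= (2^-1 ^+ n * K)%:C) -> x = 0.
Proof.
move=> h; apply/eqP; rewrite -normr_le0 rnE lecR leNgt; apply/negP => p.
have [n] := half_pow_gt K p.
by move: (h n); rewrite rnE lecR => /le_lt_trans h1 /h1; rewrite ltxx.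
Qed.

Lemma op_small0 a (K : R) : (forall n, opb (2^-1 ^+ n * K) a) -> a = 0.
Proof.
move=> h; apply: (vna_inj hA); apply/funext => x; rewrite (pi0 hA).
apply: (@norm_small0 _ (K * rn x)) => n.
by have := h n x; rewrite [`|x|]rnE -rmorphM /= !mulrA.
Qed.

(** The pointwise limit [T] is bounded, and it commutes with the commutant of [range pi] because
    each [pi (u n)] does; the bicommutant property then puts it in the algebra. This is what makes
    the square root of [sqrt_one_minus] exist. *)
Lemma op_complete (u : nat -> A) : (forall n, opb (2^-1 ^+ n) (u n.+1 - u n)) ->
  exists a, forall n, opb (2^-1 ^+ n * 2) (a - u n).
Proof.
move=> hu.
have rn0 x : 0 <= rn x by rewrite -lecR -rnE; exact: normr_ge0.
(* The induction on [k] preserves the exact partial geometric sum, not its upper bound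
   [2^-1 ^+ n * 2]. *)
have cau n k x : rn (pi (u (n + k)%N) x - pi (u n) x) <=
    (2^-1 ^+ n * 2 - 2^-1 ^+ (n + k) * 2) * rn x.
  elim: k => [|k IH].
    by rewrite addn0 !subrr mul0r /rn normr0.
  have -> : pi (u (n + k.+1)%N) x - pi (u n) x = pi (u (n + k).+1 - u (n + k)%N) x + (pi (u (n + k)%N) x - pi (u n) x).
    by rewrite (piD hA) (piN hA) addnS addrA subrK.
  have h1 := hu (n + k)%N x; rewrite !rnE -rmorphM lecR in h1.
  have h2 : rn (pi (u (n + k).+1 - u (n + k)%N) x + (pi (u (n + k)%N) x - pi (u n) x)) <= rn (pi (u (n + k).+1 - u (n + k)%N) x) + rn (pi (u (n + k)%N) x - pi (u n) x).
    by rewrite -lecR rmorphD /= -!rnE ler_normD.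
  apply: (le_trans h2); apply: (le_trans (lerD h1 IH)).
  rewrite addnS exprS -mulrDl; apply: ler_wpM2r; [exact: rn0|].
  move: (2^-1 ^+ (n + k)) (2^-1 ^+ n) => p q; lra.
have cau' n k x : rn (pi (u (n + k)%N) x - pi (u n) x) <= 2^-1 ^+ n * (2 * rn x).
  apply: (le_trans (cau n k x)); rewrite mulrA; apply: ler_wpM2r => //.
  by rewrite gerBl mulr_ge0// exprn_ge0//; lra.
have cvgu x : cvgn (fun n => pi (u n) x).
  apply: cauchy_cvg; apply: cauchy_exP => e e0.
  have eE : e = (complex.Re e)%:C by rewrite RRe_real// ger0_real// ltW.
  rewrite eE ltcR in e0 *.
  have [n hn] := half_pow_gt (2 * rn x) e0.
  exists (pi (u n) x); exists n => //= m /= nm.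
  rewrite -ball_normE /= -normrN opprB rnE ltcR -(subnKC nm).
  exact: (le_lt_trans (cau' n (m - n)%N x)).
pose T x := limn (fun n => pi (u n) x).
have hT n x : rn (T x - pi (u n) x) <= 2^-1 ^+ n * (2 * rn x).
  apply/ler_addgt0Pl => e e0.
  have := cvgu x => /cvgrPdist_lt /(_ e%:C); rewrite ltcR => /(_ e0) [N _ /(_ (n + N)%N)].
  rewrite /= leq_addl => /(_ isT); rewrite rnE ltcR => /ltW h.
  apply: le_trans (lerD h (cau' n N x)).
  rewrite -lecR rmorphD /= -!rnE; apply: le_trans (ler_normD _ _).
  by rewrite addrA subrK.
(* Uniqueness of the limit with a free constant [K]: linearity of [T] and its commutation with [S]
   both follow by exhibiting approximations of geometric quality. *)
have Teq x y : (exists K, forall n, rn (y - pi (u n) x) <= 2^-1 ^+ n * K) -> y = T x.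
  case=> K hK; apply/eqP; rewrite -subr_eq0; apply/eqP; apply: (@norm_small0 _ (K + 2 * rn x)) => n.
  have -> : y - T x = (y - pi (u n) x) - (T x - pi (u n) x) by rewrite opprB addrA subrK.
  rewrite (le_trans (ler_normB _ _))// mulrDr rmorphD /= !rnE lerD// lecR//.
have linT : linear T.
  move=> c x y; apply/esym/Teq; exists (cabs c * (2 * rn x) + 2 * rn y) => n.
  have [lin _] := vna_bounded hA (u n).
  have -> : c *: T x + T y - pi (u n) (c *: x + y) = c *: (T x - pi (u n) x) + (T y - pi (u n) y).
    by rewrite lin scalerBr opprD addrACA.
  rewrite -lecR -rnE (le_trans (ler_normD _ _))// normrZ mulrDr rmorphD /= !rnE.
  apply: lerD; last by rewrite lecR.
  by rewrite cabsE -rmorphM lecR mulrCA ler_wpM2l// cabs_ge0.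
have [C C0 hC] := op_bound_ex hA (u 0%N).
have bT : bounded_op T.
  apply: (@bounded_opI _ (2 + C)) => // x.
  have -> : T x = (T x - pi (u 0%N) x) + pi (u 0%N) x by rewrite subrK.
  rewrite (le_trans (ler_normD _ _))// rmorphD mulrDl lerD//.
  by rewrite !rnE -rmorphM lecR; have := hT 0%N x; rewrite expr0 mul1r.
have : range pi T.
  rewrite (vna_bicommutant hA); split=> // S [bS cS].
  apply/funext => x /=; have [K K0 hK] := bounded_op_bound bS.
  apply/esym/Teq; exists (K * (2 * rn x)) => n.
  have -> : pi (u n) (S x) = S (pi (u n) x).
    have := cS (pi (u n)); rewrite (_ : range pi (pi (u n)) = True); last by apply/propext; split => // _; exists (u n).
    by move=> /(_ I) /(congr1 (fun f => f x)).
  have -> : S (T x) - S (pi (u n) x) = S (T x - pi (u n) x).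
    have [lS _] := bS; have := lS (-1) (pi (u n) x) (T x).
    by rewrite !scaleN1r [X in S X]addrC => ->; rewrite addrC.
  rewrite -lecR -rnE (le_trans (hK _))// rnE -rmorphM lecR mulrCA.
  by apply: ler_wpM2l => //; exact: ltW.
case=> a _ piaT; exists a => n x.
by rewrite (piD hA) (piN hA) piaT !rnE -rmorphM lecR -mulrA.
Qed.

End Completeness.

(** * The trace and its 2-norm *)

Section Trace.
Variables (R : realType) (A : algType R[i]) (star : A -> A)
  (H : completeNormedModType R[i]) (ip : {dot H for Num.conj}) (pi : A -> H -> H)
  (tau : {scalar A}).
Hypothesis hA : von_neumann_algebra star ip pi.
Hypothesis htau : faithful_normal_tracial_state star ip pi tau.
Implicit Types (a b : A) (c : R[i]) (C D : R).
Local Notation opb := (op_bound pi).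

Lemma tauD a b : tau (a + b) = tau a + tau b. Proof. exact: raddfD. Qed.
Lemma tauB a b : tau (a - b) = tau a - tau b. Proof. exact: raddfB. Qed.
Lemma tauN a : tau (- a) = - tau a. Proof. exact: raddfN. Qed.
Lemma tauZ c a : tau (c *: a) = c * tau a. Proof. exact: linearZ. Qed.
Lemma tau0 : tau 0 = 0. Proof. exact: raddf0. Qed.
Lemma tauC a b : tau (a * b) = tau (b * a). Proof. exact: (tr_tracial htau). Qed.
Lemma tau1 : tau 1 = 1. Proof. exact: (tr_unit htau). Qed.

(** Positivity is given on the elements [star b * b]. Expanding it for b = 1 + c a shows that conj c
    tau (star a) + c tau a is real for c = 1 and for c = 'i, and these two facts determine tau (star
    a). *)
Lemma tau_star a : tau (star a) = conjc (tau a).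
Proof.
have pos b : 0 <= tau (star b * b) by exact: (tr_positive htau).
have real b : conjc (tau (star b * b)) = tau (star b * b).
  by have := pos b; move: (tau _) => [u v]; rewrite lecE /= => /andP[/eqP -> _]; rewrite oppr0.
have key c : conjc c * tau (star a) + c * tau a
   = conjc (conjc c * tau (star a) + c * tau a).
  have e : conjc c * tau (star a) + c * tau a
      = tau (star (1 + c *: a) * (1 + c *: a)) - tau (star 1 * 1)
        - c * conjc c * tau (star a * a).
    rewrite (starD hA) (starZ hA) !(mulrDl, mulrDr) (star1 hA) !mul1r mulr1.
    by rewrite -!(@scalerAl _ A) -!(@scalerAr _ A) !tauD !tauZ; ring.
  by rewrite e !(conjcD, conjcN, conjcM) conjc_invol !real [conjc c * c]mulrC.
have := congr1 (@complex.Im R) (key 1); have := congr1 (@complex.Im R) (key 'i).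
move: (tau (star a)) (tau a) => [u v] [w z] /= h1 h2.
by apply/eqP; rewrite eq_complex /=; apply/andP; split; apply/eqP; lra.
Qed.

Definition n2 a : R := Num.sqrt (l2sq star tau a).

Lemma tau_sqE a : tau (star a * a) = (l2sq star tau a)%:C.
Proof. by rewrite /l2sq RRe_real// ger0_real// (tr_positive htau). Qed.

Lemma l2sq_ge0 a : 0 <= l2sq star tau a.
Proof. by rewrite -ler0c -tau_sqE (tr_positive htau). Qed.

Lemma n2_sqr a : n2 a ^+ 2 = l2sq star tau a.
Proof. by rewrite sqr_sqrtr// l2sq_ge0. Qed.

Lemma n2_ge0 a : 0 <= n2 a. Proof. exact: sqrtr_ge0. Qed.

Lemma l2sq_star a : l2sq star tau (star a) = l2sq star tau a.
Proof. by rewrite /l2sq (starK hA) tauC. Qed.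

Lemma n2_star a : n2 (star a) = n2 a.
Proof. by rewrite /n2 l2sq_star. Qed.

Lemma tau_cs a b : cabs (tau (a * b)) <= n2 a * n2 b.
Proof.
rewrite -(n2_star a) -(@ler_pXn2r _ 2) ?nnegrE ?cabs_ge0 ?mulr_ge0 ?n2_ge0//.
rewrite exprMn !n2_sqr [leRHS]mulrC.
have -> : tau (a * b) = tau (star (star a) * b) by rewrite (starK hA).
rewrite /l2sq; apply: (@cauchy_schwarz R A (fun u v => tau (star v * u)) _ _ _ _ b (star a)) => [c u v w|u v|u|u].
- by rewrite mulrDr -scalerAr tauD tauZ.
- by rewrite -tau_star (starM hA) (starK hA).
- exact: (tr_positive htau).
- exact: (tr_faithful htau).
Qed.

Lemma l2sqD a b : l2sq star tau (a + b) =
  l2sq star tau a + l2sq star tau b + 2 * complex.Re (tau (star a * b)).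
Proof.
rewrite /l2sq (starD hA) !(mulrDl, mulrDr) !tauD.
have -> : tau (star b * a) = conjc (tau (star a * b)).
  by rewrite -tau_star (starM hA) (starK hA).
by move: (tau _) (tau _) (tau _) => [u v] [u' v'] [u2 v2] /=; ring.
Qed.

Lemma n2D a b : n2 (a + b) <= n2 a + n2 b.
Proof.
rewrite -(@ler_pXn2r _ 2) ?nnegrE ?addr_ge0 ?n2_ge0// n2_sqr sqrrD !n2_sqr l2sqD.
have h : complex.Re (tau (star a * b)) <= n2 a * n2 b.
  rewrite -(n2_star a); apply: le_trans (tau_cs _ _).
  exact: le_trans (ler_norm _) (cabs_ge_Re _).
by rewrite -[n2 a * n2 b]mulr1 mulrAC; lra.
Qed.

Lemma l2sqZ c a : l2sq star tau (c *: a) = cabs c ^+ 2 * l2sq star tau a.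
Proof.
apply: complexI; rewrite -tau_sqE (starZ hA) -scalerAl -scalerAr scalerA tauZ.
by rewrite tau_sqE rmorphM /= rmorphXn /= -cabsE sqr_normc mulrC [c * _]mulrC mulrC.
Qed.

Lemma n2Z c a : n2 (c *: a) = cabs c * n2 a.
Proof. by rewrite /n2 l2sqZ sqrtrM ?sqr_ge0// sqrtr_sqr ger0_norm// cabs_ge0. Qed.

Lemma n2N a : n2 (- a) = n2 a.
Proof. by rewrite -scaleN1r n2Z cabsN cabs1 mul1r. Qed.

Lemma n2B a b : n2 (a - b) <= n2 a + n2 b.
Proof. by rewrite (le_trans (n2D _ _))// n2N. Qed.

Lemma n20 : n2 0 = 0.
Proof. by rewrite -(scale0r 0) n2Z cabs0 mul0r. Qed.

Lemma n21 : n2 1 = 1.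
Proof. by rewrite /n2 /l2sq (star1 hA) mulr1 tau1 /= sqrtr1. Qed.

Lemma cabs_tau_le a : cabs (tau a) <= n2 a.
Proof. by rewrite -{1}[a]mulr1 (le_trans (tau_cs _ _))// n21 mulr1. Qed.

(* Fixed point of [y = (a + y ^+ 2) / 2], i.e. [(1 - y) ^+ 2 = 1 - a]. *)
Lemma sqrt_one_minus a : star a = a -> opb (3 / 4) a ->
  exists2 y, star y = y & (1 - y) * (1 - y) = 1 - a.
Proof.
move=> sa ba.
pose u := fix u n := if n is n'.+1 then (2^-1)%:C *: (a + u n' * u n') else 0.
have c2 : cabs ((2^-1)%:C : R[i]) = 2^-1 by rewrite cabs_real ger0_norm; lra.
have cj2 : conjc ((2^-1)%:C : R[i]) = (2^-1)%:C by rewrite /= oppr0.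
(* The ball of radius 1/2 is stable since (3/4 + 1/4) / 2 = 1/2, and on it the iterated map
   contracts by (1/2 + 1/2) / 2 = 1/2, the ratio that [op_complete] expects. *)
have bu n : opb (2^-1) (u n).
  elim: n => [|n IH] /=; first by move=> x; rewrite (pi0 hA) normr0 mulr_ge0// ler0c; lra.
  apply: (@op_bound_le _ _ _ _ (cabs (2^-1)%:C * (3/4 + 2^-1 * 2^-1))); first by rewrite c2; lra.
  apply: (op_boundZ hA); apply: (op_boundD hA) => //.
  by apply: (op_boundM hA) => //; lra.
have dist y z D : opb (2^-1) y -> opb (2^-1) z -> 0 <= D -> opb D (y - z) ->
    opb (D / 2) ((2^-1)%:C *: (a + y * y) - (2^-1)%:C *: (a + z * z)).
  move=> by_ bz D0 hD.
  have -> : (2^-1)%:C *: (a + y * y) - (2^-1)%:C *: (a + z * z)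
     = (2^-1)%:C *: (y * (y - z) + (y - z) * z).
    rewrite -scalerBr; congr (_ *: _).
    by rewrite mulrBr mulrBl opprD addrACA subrr add0r addrA subrK.
  apply: (@op_bound_le _ _ _ _ (cabs (2^-1)%:C * (2^-1 * D + D * 2^-1))); first by rewrite c2; lra.
  apply: (op_boundZ hA); apply: (op_boundD hA); first by apply: (op_boundM hA) => //; lra.
  exact: (op_boundM hA).
have du n : opb (2^-1 ^+ n) (u n.+1 - u n).
  elim: n => [|n IH].
    rewrite expr0 [u 0%N]/= subr0; apply: (op_bound_le _ (bu 1%N)); lra.
  have := dist _ _ _ (bu n.+1) (bu n) _ IH; rewrite exprS mulrC.
  by apply; rewrite exprn_ge0//; lra.
have [y hy] := op_complete hA du.
have pow0 n : 0 <= 2^-1 ^+ n * 2 :> R by rewrite mulr_ge0// exprn_ge0//; lra.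
have yb : opb (2^-1) y.
  move=> x; apply/ler_addgt0Pr => e e0.
  have eE : e = (complex.Re e)%:C by rewrite RRe_real// ger0_real// ltW.
  rewrite eE ltcR in e0 *.
  have [n hn] := half_pow_gt (2 * complex.Re `|x|) e0.
  have -> : y = u n + (y - u n) by rewrite addrC subrK.
  rewrite (piD hA) (le_trans (ler_normD _ _))//; apply: lerD; first exact: (bu n).
  apply: (le_trans (hy n x)).
  have -> : `|x| = (complex.Re `|x|)%:C by rewrite RRe_real// ger0_real.
  by rewrite -rmorphM lecR -mulrA ltW.
exists y.
  apply/eqP; rewrite -subr_eq0; apply/eqP; apply: (op_small0 hA (K := 4)) => n.
  have su : star (u n) = u n.
    elim: n => [|n IH] /=; first by rewrite (star0 hA).
    by rewrite (starZ hA) cj2 (starD hA) (starM hA) sa IH.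
  have -> : star y - y = star (y - u n) - (y - u n).
    by rewrite (starD hA) (starN hA) su opprB addrA subrK.
  apply: (@op_bound_le _ _ _ _ (2^-1 ^+ n * 2 + 2^-1 ^+ n * 2)); first by move: (_ ^+ _) => p; lra.
  apply: (op_boundD hA); last exact: (op_boundN hA).
  exact: (op_bound_star hA).
have ye : y - (2^-1)%:C *: (a + y * y) = 0.
  apply: (op_small0 hA (K := 2)) => n.
  have -> : y - (2^-1)%:C *: (a + y * y) =
    (y - u n.+1) + ((2^-1)%:C *: (a + u n * u n) - (2^-1)%:C *: (a + y * y)).
    by rewrite addrA subrK.
  apply: (@op_bound_le _ _ _ _ (2^-1 ^+ n.+1 * 2 + 2^-1 ^+ n * 2 / 2)).
    by rewrite exprS; move: (_ ^+ _) => p; lra.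
  apply: (op_boundD hA) => //; apply: dist => //.
  by rewrite -opprB; apply: (op_boundN hA).
have {}ye : y + y = a + y * y.
  move/eqP: ye; rewrite subr_eq0 => /eqP {1 2}->.
  rewrite -scalerDl -rmorphD /= (_ : 2^-1 + 2^-1 = 1) ?scale1r//; lra.
have -> : a = y + y - y * y by rewrite ye addrK.
rewrite mulrBr mulr1 mulrBl mul1r !opprB opprD !addrA; congr (_ - y).
by rewrite addrAC.
Qed.

(** To use positivity of [tau], 1 - x with x = 3/4 C^-2 (star c * c) is written as a square of a
    self-adjoint element. This yields the factor sqrt (4/3) C, rounded up to 2 C; the 3/4 is the
    room that the square root iteration needs. *)
Lemma n2_opl C (c a : A) : 0 < C -> opb C c -> n2 (c * a) <= 2 * C * n2 a.
Proof.
move=> C0 hc.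
have k0 : 0 < 3 / 4 / C ^+ 2 by rewrite divr_gt0// ?exprn_gt0//; lra.
pose x := (3 / 4 / C ^+ 2)%:C *: (star c * c).
have cjr (r : R) : conjc r%:C = r%:C by rewrite /= oppr0.
have [] := @sqrt_one_minus x.
- by rewrite (starZ hA) cjr (starM hA) (starK hA).
- apply: (@op_bound_le _ _ _ _ (cabs (3 / 4 / C ^+ 2)%:C * (C * C))).
    by rewrite cabs_real gtr0_norm// -expr2 divfK// ?lt0r_neq0 ?exprn_gt0.
  apply: (op_boundZ hA); apply: (op_boundM hA) => //; first exact: ltW.
  by apply: (op_bound_star hA) => //; exact: ltW.
move=> y sy hy.
have : 0 <= tau (star ((1 - y) * a) * ((1 - y) * a)) by exact: (tr_positive htau).
rewrite (starM hA) (starD hA) (starN hA) (star1 hA) sy mulrA -[star a * _ * _]mulrA hy.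
rewrite /x mulrBr mulr1 mulrBl tauB -(@scalerAr _ A) -(@scalerAl _ A) tauZ.
have -> : star a * (star c * c) * a = star (c * a) * (c * a) by rewrite (starM hA) !mulrA.
rewrite !tau_sqE -rmorphM -rmorphB ler0c subr_ge0 => h.
rewrite -(@ler_pXn2r _ 2) ?nnegrE ?mulr_ge0 ?n2_ge0 ?(ltW C0)//.
rewrite exprMn !n2_sqr.
have C2 : 0 < C ^+ 2 by rewrite exprn_gt0.
have {}h : l2sq star tau (c * a) <= 4 / 3 * C ^+ 2 * l2sq star tau a.
  rewrite -(ler_pM2l k0); apply: (le_trans h).
  rewrite mulrA [X in X * _](_ : _ = 1) ?mul1r//.
  by field; rewrite lt0r_neq0.
apply: (le_trans h); rewrite ler_wpM2r ?l2sq_ge0//.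
by rewrite exprMn ler_wpM2r ?ltW//; lra.
Qed.

Lemma n2_opr C (c a : A) : 0 < C -> opb C c -> n2 (a * c) <= 2 * C * n2 a.
Proof.
move=> C0 hc; rewrite -n2_star (starM hA) -[n2 a]n2_star.
by apply: n2_opl => //; apply: (op_bound_star hA) => //; exact: ltW.
Qed.

End Trace.

(** * Partitions and lower sums *)

Section Partitions.
Variable R : realType.
Implicit Types (p q r : nat -> R).

(** Lets a simple integral along [p] be subtracted from a Riemann sum along [q]: both become sums
    over the cells of [r], where [al] and [be] name the cells of [p] and [q] around a given cell of
    [r]. The sums agree for any integrator [Z] by telescoping. The induction on N + M peels off the
    last cell of [r], between the larger of the two last interior points and the common end. *)
Lemma common_refinement N M p q : p 0%N = q 0%N -> p N = q M ->
  (forall i, (i < N)%N -> p i < p i.+1) -> (forall i, (i < M)%N -> q i < q i.+1) ->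
  exists L r (al be : nat -> nat),
  [/\ r 0%N = p 0%N, r L = p N, forall j, (j < L)%N -> r j < r j.+1 &
  [/\
      forall j, (j < L)%N -> [/\ (al j < N)%N, p (al j) <= r j & r j.+1 <= p (al j).+1],
      forall j, (j < L)%N -> [/\ (be j < M)%N, q (be j) <= r j & r j.+1 <= q (be j).+1],
      forall (A : pzRingType) (a : nat -> A) (Z : R -> A),
        \sum_(i < N) a i * (Z (p i.+1) - Z (p i)) =
        \sum_(j < L) a (al j) * (Z (r j.+1) - Z (r j)) &
      forall (A : pzRingType) (a : nat -> A) (Z : R -> A),
        \sum_(i < M) a i * (Z (q i.+1) - Z (q i)) =
        \sum_(j < L) a (be j) * (Z (r j.+1) - Z (r j))]].
Proof.
have mono (n : nat) (s : nat -> R) : (forall i, (i < n)%N -> s i < s i.+1) ->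
    (0 < n)%N -> s 0%N < s n.
  move=> h; elim: n h => // n IH h _; case: n IH h => [|n] IH h; first exact: h.
  by apply: lt_trans (h n.+1 _) => //; apply: IH => // i hi; apply: h; rewrite ltnW.
move: {2}(N + M)%N (leqnn (N + M)) => n.
elim: n N M p q => [|n IH] N M p q NM pq0 pqN hp hq.
  have /andP[/eqP N0 /eqP M0] : (N == 0)%N && (M == 0)%N by lia.
  exists 0%N, p, id, id; subst; split => //; split => // A a Z; rewrite !big_ord0 //.
case: N NM pqN hp => [|N] NM pqN hp.
  have M0 : M = 0%N.
    case: M {NM} pqN hq => // M pqN hq; have := mono _ _ hq isT.
    by rewrite -pq0 pqN ltxx.
  by exists 0%N, p, id, id; subst; split => //; split => // A a Z; rewrite !big_ord0.
case: M NM pqN hq => [|M] NM pqN hq.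
  by have := mono _ _ hp isT; rewrite pq0 -pqN ltxx.
(* both partitions lose their last point; the earlier of the two remaining last points is split *)
have ext (N' M' : nat) (p' q' : nat -> R) (a b : nat) :
  [/\ p' 0%N = q' 0%N, p' N' = q' M', p' 0%N = p 0%N & p' N' < p N.+1] ->
  [/\ (a <= N)%N, p a <= p' N' & p N.+1 <= p a.+1] -> [/\ (b <= M)%N, q b <= p' N' & p N.+1 <= q b.+1] ->
  (N' + M' <= n)%N ->
  (forall i, (i < N')%N -> p' i < p' i.+1) -> (forall i, (i < M')%N -> q' i < q' i.+1) ->
  (forall j, (j < N')%N -> [/\ (j < N.+1)%N, p j = p' j & p' j.+1 <= p j.+1]) ->
  (forall j, (j < M')%N -> [/\ (j < M.+1)%N, q j = q' j & q' j.+1 <= q j.+1]) ->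
  (forall (A : pzRingType) (f : nat -> A) (Z : R -> A),
     \sum_(i < N.+1) f i * (Z (p i.+1) - Z (p i)) = \sum_(i < N') f i * (Z (p' i.+1) - Z (p' i)) + f a * (Z (p N.+1) - Z (p' N'))) ->
  (forall (A : pzRingType) (f : nat -> A) (Z : R -> A),
     \sum_(i < M.+1) f i * (Z (q i.+1) - Z (q i)) = \sum_(i < M') f i * (Z (q' i.+1) - Z (q' i)) + f b * (Z (p N.+1) - Z (p' N'))) ->
  exists L r (al be : nat -> nat),
  [/\ r 0%N = p 0%N, r L = p N.+1, forall j, (j < L)%N -> r j < r j.+1 &
  [/\
      forall j, (j < L)%N -> [/\ (al j < N.+1)%N, p (al j) <= r j & r j.+1 <= p (al j).+1],
      forall j, (j < L)%N -> [/\ (be j < M.+1)%N, q (be j) <= r j & r j.+1 <= q (be j).+1],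
      forall (A : pzRingType) (a : nat -> A) (Z : R -> A),
        \sum_(i < N.+1) a i * (Z (p i.+1) - Z (p i)) =
        \sum_(j < L) a (al j) * (Z (r j.+1) - Z (r j)) &
      forall (A : pzRingType) (a : nat -> A) (Z : R -> A),
        \sum_(i < M.+1) a i * (Z (q i.+1) - Z (q i)) =
        \sum_(j < L) a (be j) * (Z (r j.+1) - Z (r j))]].
- move=> [e0 eN e0' lt] [aN pa pa'] [bM qb qb'] le hp' hq' cp cq sp sq.
  have [L [r [al [be [r0 rL hr [hal hbe sal sbe]]]]]] := IH _ _ _ _ le e0 eN hp' hq'.
  exists L.+1, (fun j => if (j <= L)%N then r j else p N.+1),
    (fun j => if (j < L)%N then al j else a), (fun j => if (j < L)%N then be j else b).
  have cases j : (j < L.+1)%N -> {(j < L)%N} + {j = L}.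
    by rewrite ltnS leq_eqVlt; case: (j < L)%N; [left|rewrite orbF => /eqP; right].
  split.
  + by rewrite leq0n r0 e0'.
  + by rewrite ltnn.
  + by move=> j /cases[jL|->]; [rewrite (ltnW jL) jL; exact: hr|rewrite leqnn ltnn rL].
  split.
  + move=> j /cases[jL|->]; last by rewrite leqnn !ltnn rL; split.
    rewrite (ltnW jL) jL; have [h1 h2 h3] := hal _ jL.
    have [h4 h5 h6] := cp _ h1; split => //; first by rewrite h5.
    exact: le_trans h6.
  + move=> j /cases[jL|->]; last by rewrite leqnn !ltnn rL; split.
    rewrite (ltnW jL) jL; have [h1 h2 h3] := hbe _ jL.
    have [h4 h5 h6] := cq _ h1; split => //; first by rewrite h5.
    exact: le_trans h6.
  + move=> A f Z; rewrite sp sal big_ord_recr /= leqnn ltnn rL; congr (_ + _).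
    by apply: eq_bigr => i _; rewrite ltn_ord (ltnW (ltn_ord i)).
  + move=> A f Z; rewrite sq sbe big_ord_recr /= leqnn ltnn rL; congr (_ + _).
    by apply: eq_bigr => i _; rewrite ltn_ord (ltnW (ltn_ord i)).
have hpN := hp N (ltnSn N); have hqM := hq M (ltnSn M).
have hp1 i : (i < N)%N -> p i < p i.+1 by move=> h; apply: hp; rewrite ltnS ltnW.
have hq1 i : (i < M)%N -> q i < q i.+1 by move=> h; apply: hq; rewrite ltnS ltnW.
have [lt|lt|eq] := ltgtP (p N) (q M).
- pose p' i := if (i <= N)%N then p i else q M.
  have p'N i : (i <= N)%N -> p' i = p i by move=> h; rewrite /p' h.
  have p'S : p' N.+1 = q M by rewrite /p' ltnn.
  apply: (ext N.+1 M p' q N M) => //.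
  + by split => //; rewrite ?p'S ?p'N // pqN.
  + by split => //; rewrite p'S ltW.
  + by split => //; rewrite ?p'S // pqN.
  + by lia.
  + move=> i; rewrite ltnS leq_eqVlt => /orP[/eqP ->|h]; first by rewrite p'S p'N.
    by rewrite !p'N //; [exact: hp1|exact: ltnW].
  + move=> i; rewrite ltnS leq_eqVlt => /orP[/eqP ->|h].
      by split; [rewrite eqxx|rewrite p'N|rewrite p'S pqN ltW].
    by split => //; [rewrite h orbT|rewrite p'N ?(ltnW h)|rewrite p'N].
  + by move=> j h; split => //; exact: ltnW.
  + move=> A f Z; rewrite !big_ord_recr /= p'S p'N// -addrA -mulrDr; congr (_ + _).
      by apply: eq_bigr => i _; rewrite !p'N // (ltnW (ltn_ord i)).
    by congr (_ * _); rewrite [RHS]addrC addrA subrK.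
  + by move=> A f Z; rewrite big_ord_recr /= p'S pqN.
- pose q' i := if (i <= M)%N then q i else p N.
  have q'N i : (i <= M)%N -> q' i = q i by move=> h; rewrite /q' h.
  have q'S : q' M.+1 = p N by rewrite /q' ltnn.
  apply: (ext N M.+1 p q' N M) => //.
  + by split; [|exact: ltW|rewrite pqN].
  + move=> i; rewrite ltnS leq_eqVlt => /orP[/eqP ->|h]; first by rewrite q'S q'N.
    by rewrite !q'N //; [exact: hq1|exact: ltnW].
  + by move=> j h; split => //; exact: ltnW.
  + move=> i; rewrite ltnS leq_eqVlt => /orP[/eqP ->|h].
      by split; [rewrite eqxx|rewrite q'N|rewrite q'S -pqN ltW].
    by split => //; [rewrite h orbT|rewrite q'N ?(ltnW h)|rewrite q'N].
  + by move=> A f Z; rewrite big_ord_recr.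
  + move=> A f Z; rewrite !big_ord_recr /= q'S q'N// -addrA -mulrDr; congr (_ + _).
      by apply: eq_bigr => i _; rewrite !q'N // (ltnW (ltn_ord i)).
    by rewrite pqN; congr (_ * _); rewrite [RHS]addrC addrA subrK.
- apply: (ext N M p q N M) => //.
  + by split; [|rewrite -eq|rewrite pqN].
  + by lia.
  + by move=> j h; split => //; exact: ltnW.
  + by move=> j h; split => //; exact: ltnW.
  + by move=> A f Z; rewrite big_ord_recr.
  + by move=> A f Z; rewrite big_ord_recr /= eq pqN.
Qed.

(** The integrand in [is_integral] comes without measurability. The integral of a nonnegative
    function is a supremum over the simple functions below it, so it is monotone all the same. *)
Lemma ge0_le_integral_nonmeas (D : set R) (f g : R -> \bar R) :
  (forall x, D x -> (0 <= f x)%E) -> (forall x, D x -> (f x <= g x)%E) ->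
  (\int[lebesgue_measure]_(x in D) f x <= \int[lebesgue_measure]_(x in D) g x)%E.
Proof.
move=> f0 fg; have g0 x : D x -> (0 <= g x)%E by move=> Dx; exact: le_trans (f0 _ Dx) (fg _ Dx).
rewrite !ge0_integralE//; apply: le_ereal_sup => _ [h hf <-]; exists h => // x.
apply: (le_trans (hf x)); rewrite /patch; case: ifPn => // /set_mem; exact: fg.
Qed.

(** Converts the integral condition of [is_integral] into information on finitely many cells, by
    integrating exactly the step function with heights [c j]. *)
Lemma lower_sum_le_integral L r (c : nat -> R) (f : R -> R) :
  (forall j, (j < L)%N -> r j < r j.+1) -> (forall j, (j < L)%N -> 0 <= c j) ->
  (forall s, 0 <= f s) ->
  (forall j s, (j < L)%N -> r j <= s < r j.+1 -> c j <= f s) ->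
  ((\sum_(j < L) c j * (r j.+1 - r j))%:E <=
   \int[lebesgue_measure]_(s in `[r 0%N, r L]) (f s)%:E)%E.
Proof.
move=> hr c0 f0 hc.
have mono i j : (i <= j)%N -> (j <= L)%N -> r i <= r j.
  elim: j => [|j IH]; first by rewrite leqn0 => /eqP ->.
  rewrite leq_eqVlt => /orP[/eqP -> //|ij] jL.
  by apply: le_trans (IH ij (ltnW jL)) (ltW (hr _ jL)).
pose g x := (\sum_(j < L) (c j * \1_(`[r j, r j.+1[%classic) x)%:E)%E.
have g0 x : (0 <= g x)%E.
  by apply: sume_ge0 => j _; rewrite lee_fin mulr_ge0 ?c0.
apply: (@le_trans _ _ (\int[lebesgue_measure]_(s in `[r 0%N, r L]) g s)%E); last first.
  apply: ge0_le_integral_nonmeas => // x _.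
  rewrite /g; have [[j xj]|no] := pselect (exists j : 'I_L, `[r j, r j.+1[%classic x).
    rewrite (bigD1 j)//= big1 ?adde0; last first.
      move=> i ij; rewrite indicE memNset ?mulr0// => xi; move: xi xj.
      rewrite /= !in_itv /= => /andP[i1 i2] /andP[j1 j2].
      have [h|h|h] := ltngtP i j; last by move/eqP: ij; apply; exact: val_inj.
        by have := lt_le_trans i2 (le_trans (mono _ _ h (ltnW (ltn_ord j))) j1); rewrite ltxx.
      by have := lt_le_trans j2 (le_trans (mono _ _ h (ltnW (ltn_ord i))) i1); rewrite ltxx.
    rewrite indicE mem_set// mulr1 lee_fin; apply: hc => //.
  rewrite big1 ?lee_fin// => i _; rewrite indicE memNset ?mulr0// => xi.
  by apply: no; exists i.
rewrite ge0_integral_sum//=; last 2 first.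
- move=> j; apply/measurable_realfun.measurable_EFinP.
  apply: measurable_realfun.measurable_funM => //; exact: measurable_realfun.measurable_indic.
- by move=> j x _; rewrite lee_fin mulr_ge0 ?c0.
rewrite -sumEFin; apply: lee_sum => j _.
under eq_integral do rewrite EFinM.
rewrite ge0_integralZl//; last 2 first.
- apply/measurable_realfun.measurable_EFinP; exact: measurable_realfun.measurable_indic.
- by rewrite lee_fin c0.
rewrite integral_indic// setIidl; last first.
  move=> x; rewrite /= !in_itv /= => /andP[x1 x2].
  rewrite (le_trans (mono _ _ (leq0n j) (ltnW (ltn_ord j))) x1)/=.
  exact: le_trans (ltW x2) (mono _ _ (ltn_ord j) (leqnn L)).
by rewrite [X in (_ * X)%E]lebesgue_measure_itv /= lte_fin hr// -EFinB -EFinM.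
Qed.

End Partitions.

(** * Freeness of the increments *)

Section StarAlg.
Variables (R : realType) (A : algType R[i]) (star : A -> A) (S : set A).
Local Notation SA := (star_alg star S).

Lemma star_alg_subalgebra : star_subalgebra star SA.
Proof.
split.
- by move=> B [BS _]; exact: (ssa_one BS).
- by move=> c a b ha hb B [BS SB]; apply: (ssa_lin BS); [exact: ha|exact: hb].
- by move=> a b ha hb B [BS SB]; apply: (ssa_mul BS); [exact: ha|exact: hb].
- by move=> a ha B [BS SB]; apply: (ssa_star BS); exact: ha.
Qed.

Lemma sa_sub : S `<=` SA.
Proof. by move=> a Sa B [_ SB]; exact: SB. Qed.

Lemma sa_1 : SA 1. Proof. exact: (ssa_one star_alg_subalgebra). Qed.
Lemma sa_M a b : SA a -> SA b -> SA (a * b).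
Proof. exact: (ssa_mul star_alg_subalgebra). Qed.
Lemma sa_star a : SA a -> SA (star a).
Proof. exact: (ssa_star star_alg_subalgebra). Qed.
Lemma sa_D a b : SA a -> SA b -> SA (a + b).
Proof. by move=> ha hb; rewrite -[a]scale1r; apply: (ssa_lin star_alg_subalgebra). Qed.
Lemma sa_0 : SA 0.
Proof.
by rewrite -(addNr 1) -scaleN1r; apply: (ssa_lin star_alg_subalgebra); exact: sa_1.
Qed.
Lemma sa_Z c a : SA a -> SA (c *: a).
Proof. by move=> ha; rewrite -[_ *: _]addr0; apply: (ssa_lin star_alg_subalgebra) => //; exact: sa_0. Qed.
Lemma sa_N a : SA a -> SA (- a).
Proof. by move=> ha; rewrite -scaleN1r; exact: sa_Z. Qed.
Lemma sa_B a b : SA a -> SA b -> SA (a - b).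
Proof. by move=> ha hb; apply: sa_D => //; exact: sa_N. Qed.
Lemma sa_sum (I : Type) (r : seq I) (f : I -> A) : (forall i, SA (f i)) ->
  SA (\sum_(i <- r) f i).
Proof.
move=> h; elim: r => [|i r IH]; first by rewrite big_nil; exact: sa_0.
by rewrite big_cons; apply: sa_D.
Qed.
End StarAlg.

Lemma star_alg_sub (R : realType) (A : algType R[i]) (star : A -> A) (S T : set A) :
  S `<=` T -> star_alg star S `<=` star_alg star T.
Proof.
move=> ST a ha; apply: ha; split; first exact: star_alg_subalgebra.
by move=> x Sx; apply: sa_sub; exact: ST.
Qed.

Section FreeWords.
Variables (R : realType) (A : algType R[i]) (star : A -> A) (tau : {scalar A}).
Variables (I : eqType) (S : I -> set A).

(** List form of the hypotheses of [star_free], suited to concatenation and induction. *)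
Fixpoint alternating_centred (L : seq (I * A)) : Prop :=
  if L is p :: L' then
    [/\ star_alg star (S p.1) p.2, tau p.2 = 0,
        (if L' is p' :: _ then p.1 <> p'.1 else True) & alternating_centred L']
  else True.

Definition vprod (L : seq (I * A)) : A := foldr (fun p a => p.2 * a) 1 L.

Lemma vprod_cat L L' : vprod (L ++ L') = vprod L * vprod L'.
Proof. by elim: L => [|p L IH] /=; rewrite ?mul1r // IH mulrA. Qed.

Lemma star_free_words : star_free star tau S ->
  forall L, L <> [::] -> alternating_centred L -> tau (vprod L) = 0.
Proof.
move=> free [|p0 L0] // _ acL; set L := p0 :: L0 in acL *.
have nthP l : (l < size L)%N -> star_alg star (S (nth p0 L l).1) (nth p0 L l).2 /\ tau (nth p0 L l).2 = 0.
  by elim: L l acL => [|p L IH] [|l] //= [h1 h2 _ h4] hl; [|exact: IH].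
have nthA l : (l.+1 < size L)%N -> (nth p0 L l).1 <> (nth p0 L l.+1).1.
  elim: L l acL {nthP} => [|p L IH] l //= [h1 h2 h3 h4] hl.
  case: l hl => [|l] hl; last exact: IH.
  by case: L h3 hl {IH h4}.
have -> : vprod L = \prod_(l < (size L0).+1) (nth p0 L l).2.
  rewrite /vprod -[LHS](_ : \prod_(p <- L) p.2 = _); last first.
    by rewrite unlock; elim: L {acL nthP nthA} => //= p L ->.
  by rewrite (big_nth p0) big_mkord.
by apply: (free (size L0) (fun l => (nth p0 L l).1) (fun l => (nth p0 L l).2)).
Qed.

End FreeWords.

Section Brownian.
Variables (R : realType) (A : algType R[i]) (star : A -> A)
  (H : completeNormedModType R[i]) (ip : {dot H for Num.conj}) (pi : A -> H -> H)
  (tau : {scalar A}).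
Hypothesis hA : von_neumann_algebra star ip pi.
Hypothesis htau : faithful_normal_tracial_state star ip pi tau.
Variable X : R -> A.
Hypothesis hX : free_brownian_motion star pi tau X.
Local Notation F := (filtration star pi X).
Local Notation FA s := (star_alg star (F s)).
Local Notation l2 := (l2sq star tau).

Lemma filtration_sub s t : s <= t -> F s `<=` F t.
Proof.
move=> st a [ba ha]; split => // T [bT cT]; apply: ha.
split => // b [x xs <-]; apply: cT; exists x => //.
case: xs => [[r hr <-]|[y [r hr <-] <-]]; [left|right].
  by exists r => //; move: hr; rewrite /= !in_itv /= => /andP[-> /le_trans]; apply.
by exists (X r) => //; exists r => //; move: hr; rewrite /= !in_itv /= => /andP[-> /le_trans]; apply.
Qed.

Lemma filtration_algS s t : s <= t -> FA s `<=` FA t.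
Proof. by move=> st; apply: star_alg_sub; exact: filtration_sub. Qed.

Lemma filtration_proc s t : 0 <= s -> s <= t -> F t (X s).
Proof.
move=> s0 st; split; first exact: (vna_bounded hA).
move=> S [bS cS]; apply/esym/cS; exists (X s) => //.
by left; exists s => //=; rewrite in_itv /= s0.
Qed.

Section Increment.
Variables s t : R.
Hypotheses (s0 : 0 <= s) (st : s < t).
Let x := X t - X s.
Let h : R[i] := (t - s)%:C.

Lemma incr_star : star x = x.
Proof. by have [] := fbm_increment hX s0 st. Qed.

Lemma incr_mean : tau x = 0.
Proof. by have [_ _ /(_ 0%N)] := fbm_increment hX s0 st; rewrite expr1. Qed.

Lemma incr_sq : tau (x * x) = h.
Proof.
have [_ /(_ 1%N) + _] := fbm_increment hX s0 st.
by rewrite -[(1.*2)%N]/2%N expr2 expr1 => ->; rewrite bin1 divff ?mul1r // pnatr_eq0.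
Qed.

Let free L := star_free_words (fbm_free hX s0 st) (L := L).
Let cent (a : A) : A := a - (tau a)%:A.
Let centE a : tau (cent a) = 0.
Proof. by rewrite (tauB tau) (tauZ tau) (tau1 htau) mulr1 subrr. Qed.
Let cent_in a : FA s a -> FA s (cent a).
Proof. by move=> ha; apply: sa_B => //; apply: sa_Z; exact: sa_1. Qed.
Let x_in : star_alg star [set x] x. Proof. exact: sa_sub. Qed.

Lemma incr_free1 a : FA s a -> tau (a * x) = 0.
Proof.
move=> ha; have e0 : tau (cent a * (x * 1)) = 0.
  apply: (@free [:: (false, cent a); (true, x)]) => //.
  split; [exact: cent_in|exact: centE|by []|]; split => //; exact: incr_mean.
move: e0; rewrite mulr1 mulrBl (tauB tau) -(@scalerAl _ A) (tauZ tau) mul1r.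
by rewrite incr_mean mulr0 subr0.
Qed.

Lemma incr_free2 a : FA s a -> tau (a * (x * x)) = h * tau a.
Proof.
move=> ha; pose y := x * x - h%:A.
have ty : tau y = 0 by rewrite (tauB tau) (tauZ tau) (tau1 htau) incr_sq mulr1 subrr.
have e0 : tau (cent a * (y * 1)) = 0.
  apply: (@free [:: (false, cent a); (true, y)]) => //.
  split; [exact: cent_in|exact: centE|by []|]; split => //.
  by apply: sa_B; [exact: sa_M|apply: sa_Z; exact: sa_1].
move: e0; rewrite mulr1 mulrBl (tauB tau) -(@scalerAl _ A) (tauZ tau) mul1r ty mulr0 subr0.
rewrite mulrBr (tauB tau) -(@scalerAr _ A) (tauZ tau) mulr1 => /eqP.
by rewrite subr_eq0 => /eqP.
Qed.

(** Freeness annihilates the word a0 x b0 x, where a0 and b0 are [a] and [b] centred. After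
    expansion every other term has at most one adapted factor and is evaluated by [incr_free2] or
    [incr_sq]. *)
Lemma incr_free3 a b : FA s a -> FA s b -> tau (a * x * b * x) = h * tau a * tau b.
Proof.
move=> ha hb.
have e0 : tau (cent a * (x * (cent b * (x * 1)))) = 0.
  apply: (@free [:: (false, cent a); (true, x); (false, cent b); (true, x)]) => //.
  have xm := incr_mean.
  by split; [exact: cent_in|exact: centE|by []|split; [| |by []|split; [exact: cent_in|exact: centE|by []|split]]].
have e1 : tau (x * (b * x)) = h * tau b by rewrite (tauC htau) -mulrA incr_free2.
have e2 : tau (a * (x * x)) = h * tau a by exact: incr_free2.
have alg (z p q : A) c d : tau ((p - c%:A) * (z * ((q - d%:A) * z))) =
    tau (p * z * q * z) - d * tau (p * (z * z)) - c * (tau (z * (q * z)) - d * tau (z * z)).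
  rewrite mulrBl (tauB tau) -!(@scalerAl _ A) (tauZ tau) mul1r mulrBl -(@scalerAl _ A) mul1r.
  by rewrite !mulrBr !(tauB tau) -!(@scalerAr _ A) !(tauZ tau) !mulrA; ring.
move: e0; rewrite mulr1 alg e1 e2 incr_sq => e0.
by apply/eqP; rewrite -subr_eq0 -e0; apply/eqP; ring.
Qed.

Lemma incr_l2 a : FA s a -> l2 (a * x) = l2 a * (t - s).
Proof.
move=> ha; apply: complexI; rewrite -(tau_sqE htau) (starM hA) incr_star.
rewrite -mulrA (tauC htau) -!mulrA mulrA incr_free2; last by apply: sa_M => //; exact: sa_star.
by rewrite (tau_sqE htau) rmorphM mulrC.
Qed.

End Increment.

(** The cross term between the past sum and the last summand is tau (y * x) with [y] in the algebra
    of the past, so [incr_free1] kills it; the membership statement is carried along for this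
    purpose. *)
Lemma brownian_isometry (L : nat) (r : nat -> R) (D : nat -> A) : 0 <= r 0%N ->
  (forall j, (j < L)%N -> r j < r j.+1) -> (forall j, (j < L)%N -> FA (r j) (D j)) ->
  FA (r L) (\sum_(j < L) D j * (X (r j.+1) - X (r j))) /\
  l2 (\sum_(j < L) D j * (X (r j.+1) - X (r j))) = \sum_(j < L) l2 (D j) * (r j.+1 - r j).
Proof.
move=> r0; elim: L => [|L IH] hr hD.
  rewrite !big_ord0; split; first exact: sa_0.
  by rewrite /l2sq mulr0 (tau0 tau).
have r0L : 0 <= r L.
  have : forall k, (k <= L)%N -> 0 <= r k.
    by elim=> // k IHk kL; apply: le_trans (IHk (ltnW kL)) (ltW (hr _ _)); rewrite ltnS ltnW.
  exact.
have lt := hr _ (ltnSn L).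
have [i1 i2] : _ /\ _ := IH (fun j jL => hr j (ltnW jL)) (fun j jL => hD j (ltnW jL)).
have D_in := hD _ (ltnSn L).
rewrite !big_ord_recr /=; split.
  apply: sa_D; first exact: filtration_algS (ltW lt) _ i1.
  apply: sa_M; first exact: filtration_algS (ltW lt) _ D_in.
  apply: sa_B; apply: sa_sub; apply: filtration_proc => //; last exact: ltW.
  exact: le_trans (ltW lt).
rewrite (l2sqD hA htau) i2 incr_l2// mulrA (incr_free1 r0L lt) ?mulr0 ?addr0//.
by apply: sa_M => //; exact: sa_star.
Qed.

End Brownian.

(** * Riemann sums for the integrals *)

Section Integral.
Variables (R : realType) (A : algType R[i]) (star : A -> A)
  (H : completeNormedModType R[i]) (ip : {dot H for Num.conj}) (pi : A -> H -> H)
  (tau : {scalar A}).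
Hypothesis hA : von_neumann_algebra star ip pi.
Hypothesis htau : faithful_normal_tracial_state star ip pi tau.
Variable X : R -> A.
Local Notation F := (filtration star pi X).
Local Notation FA s := (star_alg star (F s)).
Local Notation l2 := (l2sq star tau).

Lemma l2D_le (a b : A) : l2 (a + b) <= 2 * l2 a + 2 * l2 b.
Proof.
have h : l2 (a + b) + l2 (a - b) = 2 * l2 a + 2 * l2 b.
  rewrite !(l2sqD hA htau) mulrN (tauN tau) /= [l2 (- b)](_ : _ = l2 b).
    by move: (tau _) => [u v] /=; ring.
  by rewrite -scaleN1r (l2sqZ hA htau) cabsN cabs1 expr1n mul1r.
by rewrite -h lerDl (l2sq_ge0 htau).
Qed.

Lemma l2B_le (a b : A) : l2 (a - b) <= 2 * l2 a + 2 * l2 b.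
Proof. by rewrite (le_trans (l2D_le _ _))// -!(n2_sqr htau) (n2N hA htau). Qed.

(* The estimate behind the construction of the integral against [Z]: an
   isometry for a free Brownian motion, Cauchy-Schwarz for [Z s = s]. *)
Definition integral_bound (Z : R -> A) (C : R) (a b : R) :=
  forall (L : nat) (r : nat -> R) (D : nat -> A), r 0%N = a -> r L = b ->
  (forall j, (j < L)%N -> r j < r j.+1) -> (forall j, (j < L)%N -> FA (r j) (D j)) ->
  l2 (\sum_(j < L) D j * (Z (r j.+1) - Z (r j))) <= C * \sum_(j < L) l2 (D j) * (r j.+1 - r j).

Lemma integral_bound_time a b : integral_bound (fun s => s%:C%:A) (b - a) a b.
Proof.
move=> L r D ra rb hr _.
have -> : \sum_(j < L) D j * ((r j.+1)%:C%:A - (r j)%:C%:A) = \sum_(j < L) (r j.+1 - r j)%:C *: D j.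
  apply: eq_bigr => j _; rewrite mulrBr -!(@scalerAr _ A) mulr1 -scalerBl.
  by rewrite -rmorphB.
rewrite -ra -rb {ra rb}.
have tot : r L - r 0%N = \sum_(j < L) (r j.+1 - r j).
  elim: L {hr} => [|L IH]; first by rewrite big_ord0 subrr.
  by rewrite big_ord_recr /= -IH addrC addrA subrK.
have : n2 star tau (\sum_(j < L) (r j.+1 - r j)%:C *: D j) <= \sum_(j < L) n2 star tau (D j) * (r j.+1 - r j).
  have : forall K, (K <= L)%N -> n2 star tau (\sum_(j < K) (r j.+1 - r j)%:C *: D j) <= \sum_(j < K) n2 star tau (D j) * (r j.+1 - r j).
    elim=> [|K IH] KL; first by rewrite !big_ord0 (n20 hA htau).
    rewrite !big_ord_recr /= (le_trans (n2D hA htau _ _))// lerD ?IH//; first exact: ltnW.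
    by rewrite (n2Z hA htau) cabs_real ger0_norm ?subr_ge0 1?mulrC// ltW// hr.
  exact.
move=> h; rewrite -(n2_sqr htau).
apply: (@le_trans _ _ ((\sum_(j < L) n2 star tau (D j) * (r j.+1 - r j)) ^+ 2)).
  rewrite ler_pXn2r// ?nnegrE ?(n2_ge0)//.
  by apply: sumr_ge0 => j _; rewrite mulr_ge0 ?n2_ge0// subr_ge0 ltW// hr.
rewrite {}tot {h}.
elim: L hr => [|L IH] hr; first by rewrite !big_ord0 expr0n mulr0.
have {IH} := IH (fun j jL => hr j (ltnW jL)).
have d0 : 0 < r L.+1 - r L by rewrite subr_gt0 hr.
have S0 : 0 <= \sum_(j < L) (r j.+1 - r j).
  by apply: sumr_ge0 => j _; rewrite subr_ge0 ltW// hr// ltnW// ltnS.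
have P0 : 0 <= \sum_(j < L) n2 star tau (D j) * (r j.+1 - r j).
  by apply: sumr_ge0 => j _; rewrite mulr_ge0 ?n2_ge0// subr_ge0 ltW// hr// ltnW// ltnS.
have Q0 : 0 <= \sum_(j < L) l2 (D j) * (r j.+1 - r j).
  by apply: sumr_ge0 => j _; rewrite mulr_ge0 ?(l2sq_ge0 htau)// subr_ge0 ltW// hr// ltnW// ltnS.
rewrite !big_ord_recr /= -(n2_sqr htau (D L)).
move: (n2_ge0 star tau (D L)) S0 P0 Q0 d0.
move: (\sum_(j < L) _) (\sum_(j < L) _) (\sum_(j < L) _) (n2 star tau (D L)) (r L.+1 - r L) => Q P S x d.
move=> x0 S0 P0 Q0 d0 PSQ.
have SxQ : 0 <= S * x ^+ 2 + Q by rewrite addr_ge0// mulr_ge0// sqr_ge0.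
(* The induction hypothesis P^2 <= S Q gives 4 P^2 x^2 <= 4 S x^2 Q <= (S x^2 + Q)^2. *)
have h : 2 * P * x <= S * x ^+ 2 + Q.
  rewrite -(@ler_pXn2r _ 2) ?nnegrE//; last by rewrite !mulr_ge0.
  have := ler_wpM2r (sqr_ge0 x) PSQ; have := sqr_ge0 (S * x ^+ 2 - Q).
  by rewrite !expr2; lra.
by have := ler_wpM2l (ltW d0) h; move: PSQ; rewrite !expr2; lra.
Qed.

(** On a common refinement the difference between an approximating simple process and the step
    process [U (q i)] is adapted, and [integral_bound] transfers smallness from integrands to
    integrals. The constant is 2 eta for I - J plus 2 C times the bound 2 eta (1 + T) of [sumD]. *)
Lemma riemann_close (Z U : R -> A) (C T : R) (J : A) (M : nat) (q : nat -> R) (eta : R) :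
  0 <= C -> 0 < T -> integral_bound Z C 0 T -> is_integral star tau F Z U T J ->
  (forall s, 0 <= s -> F s (U s)) -> q 0%N = 0 -> q M = T ->
  (forall i, (i < M)%N -> q i < q i.+1) -> 0 < eta ->
  (forall i s, (i < M)%N -> q i <= s < q i.+1 -> l2 (U s - U (q i)) <= eta) ->
  l2 (J - \sum_(i < M) U (q i) * (Z (q i.+1) - Z (q i))) <= eta * (2 + 4 * C * (1 + T)).
Proof.
move=> C0 T0 hZ [N [p [V [sp cvI cvJ]]]] ad q0 qM hq eta0 hU.
have [n [hI hJ]] : exists n,
    (\int[lebesgue_measure]_(s in `[0%R, T]) (l2 (V n s - U s))%:E < eta%:E)%E /\
    l2 (simple_integral Z (N n) (p n) (V n) - J) < eta.
  have [n1 _ h1] := cvI _ (@nbhs_open_ereal_lt _ 0 (fun _ => eta) eta0).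
  have [n2 _ h2] := (iffLR (cvgrPdist_lt _ _)) cvJ _ eta0.
  exists (n1 + n2)%N; split; first by apply: h1; rewrite /= leq_addr.
  have := h2 (n1 + n2)%N; rewrite /= leq_addl sub0r normrN => /(_ isT).
  exact: le_lt_trans (ler_norm _).
have [p0 pN hp pad pc] := sp n.
set I := simple_integral _ _ _ _ in hJ *.
have [L [r [al [be [r0 rL hr [hal hbe sal sbe]]]]]] :=
  common_refinement (etrans p0 (esym q0)) (etrans pN (esym qM)) hp hq.
rewrite p0 in r0; rewrite pN in rL.
pose D j := V n (r j) - U (q (be j)).
have rpos j : (j <= L)%N -> 0 <= r j.
  elim: j => [|j IH] jL; first by rewrite r0.
  by apply: le_trans (IH (ltnW jL)) (ltW (hr _ jL)).
have qpos j : (j <= M)%N -> 0 <= q j.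
  elim: j => [|j IH] jL; first by rewrite q0.
  by apply: le_trans (IH (ltnW jL)) (ltW (hq _ jL)).
have Vr j s : (j < L)%N -> r j <= s < r j.+1 -> V n s = V n (p n (al j)).
  move=> jL /andP[s1 s2]; have [a1 a2 a3] := hal _ jL.
  by apply: pc => //; rewrite (le_trans a2 s1) (lt_le_trans s2 a3).
have Vrr j : (j < L)%N -> V n (r j) = V n (p n (al j)).
  by move=> jL; apply: (Vr _ _ jL); rewrite lexx hr.
have eI : I - \sum_(i < M) U (q i) * (Z (q i.+1) - Z (q i))
   = \sum_(j < L) D j * (Z (r j.+1) - Z (r j)).
  rewrite /I /simple_integral (sal A (fun i => V n (p n i))) (sbe A (fun i => U (q i))).
  rewrite -sumrB; apply: eq_bigr => j _; rewrite -mulrBl /D Vrr//.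
have Dad j : (j < L)%N -> FA (r j) (D j).
  move=> jL; have [a1 a2 _] := hal _ jL; have [b1 b2 _] := hbe _ jL.
  rewrite /D Vrr//; apply: sa_B.
    by apply: (filtration_algS (s := p n (al j))) => //; apply: sa_sub; exact: pad.
  apply: (filtration_algS (s := q (be j))) => //; apply: sa_sub; apply: ad.
  by apply: qpos; exact: ltnW.
have sumD : \sum_(j < L) l2 (D j) * (r j.+1 - r j) <= 2 * eta * (1 + T).
  (* On a cell l2 (D j) <= 2 l2 (V n s - U s) + 2 eta for every s, so l2 (D j) / 2 - eta is a lower
     value of the integrand; the maximum with 0 supplies the nonnegative heights required by
     [lower_sum_le_integral]. *)
  pose c j := Num.max 0 (l2 (D j) / 2 - eta).
  have : ((\sum_(j < L) c j * (r j.+1 - r j))%:E <=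
    \int[lebesgue_measure]_(s in `[r 0%N, r L]) (l2 (V n s - U s))%:E)%E.
    apply: lower_sum_le_integral => // [j jL|s|j s jL hs].
    - by rewrite /c le_max lexx.
    - exact: (l2sq_ge0 htau).
    rewrite /c ge_max (l2sq_ge0 htau)/=.
    have [b1 b2 b3] := hbe _ jL.
    have hs' : q (be j) <= s < q (be j).+1.
      by case/andP: hs => s1 s2; rewrite (le_trans b2 s1) (lt_le_trans s2 b3).
    have -> : D j = (V n s - U s) + (U s - U (q (be j))).
      by rewrite /D Vrr// -(Vr _ _ jL hs) addrA subrK.
    by have := l2D_le (V n s - U s) (U s - U (q (be j))); have := hU _ _ b1 hs'; lra.
  rewrite r0 rL => /le_lt_trans/(_ hI); rewrite lte_fin => hc.
  have tot : \sum_(j < L) (r j.+1 - r j) = T.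
    have tel K : \sum_(j < K) (r j.+1 - r j) = r K - r 0%N.
      elim: K => [|K IH]; first by rewrite big_ord0 subrr.
      by rewrite big_ord_recr /= IH addrC addrA subrK.
    by rewrite tel r0 rL subr0.
  apply: (@le_trans _ _ (\sum_(j < L) (2 * (c j * (r j.+1 - r j)) + 2 * eta * (r j.+1 - r j)))).
    apply: ler_sum => j _; rewrite mulrA -mulrDl ler_wpM2r//; first by rewrite subr_ge0 ltW// hr.
    have : l2 (D j) / 2 - eta <= c j by rewrite /c le_max lexx orbT.
    lra.
  by rewrite big_split /= -!mulr_sumr tot; lra.
have l2I := hZ L r D r0 rL hr Dad.
have -> : J - \sum_(i < M) U (q i) * (Z (q i.+1) - Z (q i)) =
    (I - \sum_(i < M) U (q i) * (Z (q i.+1) - Z (q i))) - (I - J).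
  by rewrite opprB [RHS]addrC addrA subrK.
apply: (le_trans (l2B_le _ _)); rewrite eI.
have : C * \sum_(j < L) l2 (D j) * (r j.+1 - r j) <= C * (2 * eta * (1 + T)) by exact: ler_wpM2l.
by move: hJ l2I; lra.
Qed.

End Integral.

(** * Riemann sums for the increments of the integrals *)

Section IntegrandEstimates.
Variables (R : realType) (A : algType R[i]) (star : A -> A)
  (H : completeNormedModType R[i]) (ip : {dot H for Num.conj}) (pi : A -> H -> H)
  (tau : {scalar A}).
Hypothesis hA : von_neumann_algebra star ip pi.
Hypothesis htau : faithful_normal_tracial_state star ip pi tau.
Variables X U : R -> A.
Hypothesis hU : free_unitary_brownian_motion star pi tau X U.
Local Notation F := (filtration star pi X).
Local Notation l2 := (l2sq star tau).
Local Notation n2 := (n2 star tau).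

Lemma n2_op_le (C : R) (a : A) : 0 < C -> op_bound pi C a -> n2 a <= 2 * C.
Proof.
by move=> C0 ha; have := n2_opl hA htau 1 C0 ha; rewrite (n21 hA htau) !mulr1; apply.
Qed.

Lemma op_cont_at (t e : R) : 0 <= t -> 0 < e -> exists2 d : R, 0 < d &
  forall s s' : R, 0 <= s -> 0 <= s' -> `|s - t| < d -> `|s' - t| < d -> op_bound pi e (U s - U s').
Proof.
move=> t0 e0; have e2 : 0 < e / 2 by lra.
have [d d0 hd] := fubm_continuous hU t0 e2; exists d => // s s' s0 s0' sd sd'.
have -> : U s - U s' = (U s - U t) - (U s' - U t) by rewrite opprB addrA subrK.
apply: (@op_bound_le _ _ _ _ (e / 2 + e / 2)); first by lra.
by apply: (op_boundD hA); [|apply: (op_boundN hA)] => x; apply: hd.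
Qed.

Lemma l2_cont_at (t e : R) : 0 <= t -> 0 < e -> exists2 d : R, 0 < d &
  forall s s' : R, 0 <= s -> 0 <= s' -> `|s - t| < d -> `|s' - t| < d -> l2 (U s - U s') <= e.
Proof.
(* With c <= 1 and 4 c <= e, the bound n2 <= 2 c gives l2 <= 4 c^2 <= 4 c <= e. *)
move=> t0 e0; pose c := Num.min 1 (e / 4).
have c0 : 0 < c by rewrite /c lt_min ltr01; lra.
have [d d0 hd] := op_cont_at t0 c0; exists d => // s s' s0 s0' sd sd'.
have := n2_op_le c0 (hd _ _ s0 s0' sd sd'); have := n2_ge0 star tau (U s - U s').
rewrite -(n2_sqr htau).
have c1 : c <= 1 by rewrite /c ge_min lexx.
have c4 : c <= e / 4 by rewrite /c ge_min lexx orbT.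
move: (n2 _) => z z0 zc; rewrite expr2.
have : z * z <= (2 * c) * (2 * c) by apply: ler_pM.
have : c * c <= c * 1 by apply: ler_wpM2l => //; exact: ltW.
lra.
Qed.

Definition fine_partition (eta a b : R) (N : nat) (q : nat -> R) :=
  [/\ q 0%N = a, q N = b, forall i, (i < N)%N -> q i < q i.+1 &
   forall i s, (i < N)%N -> q i <= s < q i.+1 -> l2 (U s - U (q i)) <= eta].

(** Continuity is given pointwise. Uniformity on [a, b] comes from the supremum of the end points
    that a fine partition can reach: unless it is b, one more cell reaches beyond it. *)
Lemma fine_partition_ex (eta a b : R) : 0 < eta -> 0 <= a -> a < b ->
  exists N q, fine_partition eta a b N q.
Proof.
move=> eta0 a0 ab.
pose S := [set x : R | a <= x <= b /\ exists N q, fine_partition eta a x N q].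
have Sa : S a.
  split; first by rewrite lexx ltW.
  by exists 0%N, (fun _ => a).
have hS : has_sup S by split; [exists a|exists b => x [/andP[]]].
pose c := sup S.
have ac : a <= c by apply: sup_upper_bound.
have cb : c <= b by apply: sup_le_ub; [exists a|move=> x [/andP[]]].
have c0 : 0 <= c by exact: le_trans ac.
have [d d0 hd] := l2_cont_at c0 eta0.
have [x Sx cx] := sup_adherent d0 hS.
have xc : x <= c by apply: sup_upper_bound.
have [/andP[ax xb] [N [q [q0 qN hq oq]]]] := Sx.
have step (y : R) : x < y -> y <= b -> y < c + d -> S y.
  move=> xy yb yc; split; first by rewrite yb (le_trans ax (ltW xy)).
  exists N.+1, (fun i => if (i <= N)%N then q i else y); split.
  - by rewrite leq0n.
  - by rewrite ltnn.
  - move=> i; rewrite ltnS leq_eqVlt => /orP[/eqP->|iN]; first by rewrite eqxx ltnn qN.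
    by rewrite iN orbT hq.
  - move=> i s; rewrite ltnS leq_eqVlt => /orP[/eqP->|iN].
      rewrite eqxx ltnn qN /= => /andP[xs sy]; apply: hd.
      + by rewrite (le_trans a0)// (le_trans ax).
      + exact: le_trans ax.
      + by rewrite ltr_distl; apply/andP; split; move: cx; rewrite -/c; lra.
      + by rewrite ltr_distl; apply/andP; split; move: cx; rewrite -/c; lra.
    by rewrite iN orbT; exact: oq.
have [bx|bx] := leP b x.
  have <- : x = b by apply/le_anti; rewrite xb bx.
  by exists N, q.
have [cb'|cb'] := leP b c.
  by have [|_] := step b bx (lexx _) _; first by lra.
pose y := Num.min b (c + d / 2).
have yc : c < y by rewrite /y lt_min cb'; lra.
have : S y.
  apply: step; first exact: le_lt_trans yc.
    by rewrite /y ge_min lexx.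
  by rewrite /y gt_min; apply/orP; right; lra.
by move=> /(sup_upper_bound hS); rewrite -/c => /(lt_le_trans yc); rewrite ltxx.
Qed.

Section Increments.
Variables s s' : R.
Hypotheses (s0 : 0 < s) (ss' : s < s').

(** [J] and [J'] come with unrelated approximations. They are compared with Riemann sums along a
    partition of [0, s] and an extension of it to [0, s'], so that subtraction leaves the part over
    [s, s']. With eta = e / (4 K) each comparison costs e / 4, and [l2B_le] doubles their sum. *)
Lemma incr_approx (Z : R -> A) (C : R) (J J' : A) (e : R) : 0 <= C ->
  integral_bound star pi tau X Z C 0 s -> integral_bound star pi tau X Z C 0 s' ->
  is_integral star tau F Z U s J -> is_integral star tau F Z U s' J' -> 0 < e ->
  exists N q, [/\ q 0%N = s, q N = s', forall i, (i < N)%N -> q i < q i.+1 &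
    l2 (J' - J - \sum_(i < N) U (q i) * (Z (q i.+1) - Z (q i))) <= e].
Proof.
move=> C0 bs bs' iJ iJ' e0.
pose K := 2 + 4 * C * (1 + s').
have s10 : 0 <= 1 + s' by rewrite addr_ge0// ltW// (lt_trans s0).
have K0 : 0 < K by rewrite /K; apply: ltr_pwDl => //; rewrite !mulr_ge0.
pose eta := e / (4 * K); have eta0 : 0 < eta by rewrite divr_gt0// mulr_gt0.
have [N [q [q0 qN hq oq]]] := fine_partition_ex eta0 (lexx 0) s0.
have [N' [q' [q0' qN' hq' oq']]] := fine_partition_ex eta0 (ltW s0) ss'.
exists N', q'; split=> //.
pose Q i := if (i <= N)%N then q i else q' (i - N)%N.
have Ql i : (i <= N)%N -> Q i = q i by rewrite /Q => ->.
have Qr i : Q (N + i)%N = q' i.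
  rewrite /Q; case: i => [|i]; first by rewrite addn0 leqnn qN q0'.
  by rewrite leqNgt addnS ltnS leq_addr /= -addnS addKn.
have ad r : 0 <= r -> F r (U r) by exact: (fubm_adapted hU).
have c1 := riemann_close hA htau C0 s0 bs iJ ad q0 qN hq eta0 oq.
have c2 : l2 (J' - \sum_(i < N + N') U (Q i) * (Z (Q i.+1) - Z (Q i))) <= eta * (2 + 4 * C * (1 + s')).
  have cases i : (i < N + N')%N -> (i < N)%N \/ exists2 j, (j < N')%N & i = (N + j)%N.
    move=> h; have [iN|iN] := ltnP i N; [by left|right].
    by exists (i - N)%N; [lia|rewrite subnKC].
  apply: (riemann_close hA htau C0 (lt_trans s0 ss') bs' iJ' ad _ _ _ eta0).
  - by rewrite Ql.
  - by rewrite Qr.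
  - move=> i /cases[iN|[j jN ->]]; first by rewrite !Ql ?hq// ltnW.
    by rewrite -addnS !Qr hq'.
  - move=> i r /cases[iN|[j jN ->]]; first by rewrite !Ql ?(ltnW iN)//; exact: oq.
    by rewrite -addnS !Qr; exact: oq'.
rewrite big_split_ord /= in c2.
have e1 : \sum_(i < N) U (Q i) * (Z (Q i.+1) - Z (Q i)) = \sum_(i < N) U (q i) * (Z (q i.+1) - Z (q i)).
  by apply: eq_bigr => i _; rewrite !Ql// ltnW.
have e2 : \sum_(i < N') U (Q (N + i)%N) * (Z (Q (N + i).+1) - Z (Q (N + i)%N)) = \sum_(i < N') U (q' i) * (Z (q' i.+1) - Z (q' i)).
  by apply: eq_bigr => i _; rewrite -addnS !Qr.
rewrite {}e1 {}e2 in c2.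
move: c1 c2; set S1 := \sum_(i < N) _; set S2 := \sum_(i < N') _ => c1 c2.
have -> : J' - J - S2 = (J' - (S1 + S2)) - (J - S1).
  by rewrite opprB opprD !addrA [J' - S1 - S2]addrAC subrK addrAC.
apply: (le_trans (l2B_le hA htau _ _)).
have etaK : eta * K = e / 4 by rewrite /eta; field; rewrite lt0r_neq0.
have : eta * (2 + 4 * C * (1 + s)) <= eta * K.
  rewrite ler_wpM2l ?(ltW eta0)// lerD2l ler_wpM2l ?mulr_ge0// lerD2l.
  exact: ltW.
rewrite -/K in c2; rewrite etaK in c2 *.
move=> /(le_trans c1) {}c1.
by move: c1 c2; move: (l2 _) (l2 _) => u v; lra.
Qed.

End Increments.
End IntegrandEstimates.

(** * One step of the stochastic equation *)

Section ItoStep.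
Variables (R : realType) (A : algType R[i]) (star : A -> A)
  (H : completeNormedModType R[i]) (ip : {dot H for Num.conj}) (pi : A -> H -> H)
  (tau : {scalar A}).
Hypothesis hA : von_neumann_algebra star ip pi.
Hypothesis htau : faithful_normal_tracial_state star ip pi tau.
Variables X U : R -> A.
Hypothesis hU : free_unitary_brownian_motion star pi tau X U.
Let hX := fubm_driver hU.
Local Notation F := (filtration star pi X).
Local Notation FA s := (star_alg star (F s)).
Local Notation l2 := (l2sq star tau).
Local Notation n2 := (n2 star tau).

Section Increments.
Variables s s' : R.
Hypotheses (s0 : 0 < s) (ss' : s < s').
Let h := s' - s.
Let h0 : 0 < h. Proof. by rewrite subr_gt0. Qed.

Lemma integral_bound_le Z (C C' a b : R) : C <= C' ->
  integral_bound star pi tau X Z C a b -> integral_bound star pi tau X Z C' a b.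
Proof.
move=> CC hC L r D ra rb hr hD; apply: (le_trans (hC L r D ra rb hr hD)).
rewrite ler_wpM2r// sumr_ge0// => j _.
by rewrite mulr_ge0 ?(l2sq_ge0 htau)// subr_ge0 ltW// hr.
Qed.

Lemma integral_bound_brownian (a b : R) : 0 <= a -> integral_bound star pi tau X X 1 a b.
Proof.
move=> a0 L r D ra rb hr hD; rewrite mul1r.
rewrite -ra in a0; by have [_ ->] := brownian_isometry hA htau hX a0 hr hD.
Qed.

Lemma partition_ge (N : nat) (q : nat -> R) : q 0%N = s -> (forall i, (i < N)%N -> q i < q i.+1) ->
  forall i, (i <= N)%N -> s <= q i.
Proof.
move=> q0 hq; elim=> [|i IH] iN; first by rewrite q0.
exact: le_trans (IH (ltnW iN)) (ltW (hq _ iN)).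
Qed.

Lemma partition_lt (N : nat) (q : nat -> R) : q N = s' -> (forall i, (i < N)%N -> q i < q i.+1) ->
  forall i, (i < N)%N -> q i < s'.
Proof.
move=> <- hq i iN; have : forall k, (i + k.+1 <= N)%N -> q i < q (i + k.+1)%N.
  elim=> [|k IH] kN; first by rewrite addn1 hq.
  by rewrite addnS (lt_trans (IH _))// ?hq// -?addnS// ltnW// -addnS.
by move=> /(_ (N - i.+1)%N); rewrite addnS -addSn subnKC//; apply.
Qed.

Lemma telescope_sum (V : zmodType) (N : nat) (g : nat -> V) :
  \sum_(i < N) (g i.+1 - g i) = g N - g 0%N.
Proof.
elim: N => [|N IH]; first by rewrite big_ord0 subrr.
by rewrite big_ord_recr /= IH addrC addrA subrK.
Qed.

Lemma incr_dist (Z : R -> A) (C C' eta : R) (J J' : A) : 0 <= C -> 0 <= C' ->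
  integral_bound star pi tau X Z C 0 s -> integral_bound star pi tau X Z C 0 s' ->
  integral_bound star pi tau X Z C' s s' ->
  is_integral star tau F Z U s J -> is_integral star tau F Z U s' J' -> 
  (forall r, s <= r < s' -> l2 (U r - U s) <= eta) ->
  l2 (J' - J - U s * (Z s' - Z s)) <= 2 * C' * eta * h.
Proof.
move=> C0 C0' b1 b2 b3 iJ iJ' hU'; apply/ler_addgt0Pl => e e0.
have e2 : 0 < e / 2 by lra.
have [N [q [q0 qN hq le]]] := incr_approx hA htau hU s0 ss' C0 b1 b2 iJ iJ' e2.
have -> : U s * (Z s' - Z s) = \sum_(i < N) U s * (Z (q i.+1) - Z (q i)).
  by rewrite -mulr_sumr (telescope_sum N (fun i => Z (q i))) q0 qN.
set S := \sum_(i < N) _ in le *; set S' := \sum_(i < N) _.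
have -> : J' - J - S' = (J' - J - S) + (S - S') by rewrite addrA subrK.
apply: (le_trans (l2D_le hA htau _ _)).
have hS : l2 (S - S') <= C' * (eta * h).
  rewrite /S /S' -sumrB.
  under eq_bigr do rewrite -mulrBl.
  have q0s i : (i < N)%N -> s <= q i by move=> iN; apply: (partition_ge q0 hq); exact: ltnW.
  apply: (le_trans (b3 N q (fun i => U (q i) - U s) q0 qN hq _)).
    move=> i iN; apply: sa_B; apply: sa_sub.
      by apply: (fubm_adapted hU); rewrite (le_trans (ltW s0))// q0s.
    apply: (filtration_sub (s := s)); first exact: q0s.
    by apply: (fubm_adapted hU); exact: ltW.
  rewrite ler_wpM2l//.
  have -> : eta * h = \sum_(i < N) eta * (q i.+1 - q i).
    by rewrite -mulr_sumr telescope_sum q0 qN.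
  apply: ler_sum => i _; rewrite ler_wpM2r//; first by rewrite subr_ge0 ltW// hq.
  by apply: hU'; rewrite q0s//= (partition_lt qN hq).
have : 2 * l2 (S - S') <= 2 * (C' * (eta * h)) by rewrite ler_wpM2l.
move: le; move: (l2 _) (l2 _) => u v; lra.
Qed.

(** Each term of an approximating Riemann sum is an adapted element times a later increment and has
    trace exactly 0 against [y]; only the L2 error of the approximation remains, and it is
    arbitrarily small. *)
Lemma integral_martingale (J J' y : A) :
  is_integral star tau F X U s J -> is_integral star tau F X U s' J' -> FA s y ->
  tau (y * (J' - J)) = 0.
Proof.
move=> iJ iJ' hy; apply: cabs_eq0; apply/le_anti; rewrite cabs_ge0 andbT.
have key (e : R) : 0 < e -> cabs (tau (y * (J' - J))) <= n2 y * e.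
  move=> e0; have e2 : 0 < e ^+ 2 by rewrite exprn_gt0.
  have [N [q [q0 qN hq le]]] := incr_approx hA htau hU s0 ss' ler01 
    (@integral_bound_brownian 0 s (lexx _)) (@integral_bound_brownian 0 s' (lexx _)) iJ iJ' e2.
  set S := \sum_(i < N) _ in le.
  have S0 : tau (y * S) = 0.
    rewrite mulr_sumr raddf_sum big1// => i _; rewrite mulrA.
    have q0s := partition_ge q0 hq (ltnW (ltn_ord i)).
    have qp : 0 <= q i by rewrite (le_trans (ltW s0)).
    apply: (incr_free1 htau hX qp (hq _ (ltn_ord i))).
    by apply: sa_M; [exact: filtration_algS hy|apply: sa_sub; exact: (fubm_adapted hU)].
  have -> : tau (y * (J' - J)) = tau (y * (J' - J - S)).
    by rewrite [in RHS]mulrBr (tauB tau) S0 subr0.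
  apply: (le_trans (tau_cs hA htau _ _)); rewrite ler_wpM2l ?n2_ge0//.
  rewrite -(@ler_pXn2r _ 2) ?nnegrE ?n2_ge0 ?(ltW e0)//.
  by rewrite (n2_sqr htau).
apply/ler_addgt0Pl => e e0; rewrite addr0.
have y1 : 0 < n2 y + 1 by rewrite ltr_wpDl ?n2_ge0.
apply: (le_trans (key (e / (n2 y + 1)) _)); first by rewrite divr_gt0.
by rewrite mulrCA ler_piMr ?(ltW e0)// ler_pdivrMr// mul1r lerDl.
Qed.

Let x := X s' - X s.
Let d := U s' - U s.

(** Two levels of precision. Against an adapted [y] the martingale part drops out exactly and the
    error is small compared with h; in 2-norm the term 'i U x remains and the error is only small
    compared with sqrt h. The time integral has C' = h in [incr_dist], which brings its extra factor
    sqrt h. *)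
Lemma ito_step (eta : R) : 0 <= eta -> (forall r, s <= r < s' -> l2 (U r - U s) <= eta) ->
  (forall y, FA s y -> cabs (tau (y * d) + (h / 2)%:C * tau (y * U s)) <= n2 y * (h * Num.sqrt (2 * eta))) /\
  n2 (d - 'i *: (U s * x)) <= Num.sqrt (2 * eta * h) + h * n2 (U s) + h * Num.sqrt (2 * eta).
Proof.
move=> eta0 hr; have s0' : 0 <= s' by rewrite ltW// (lt_trans s0).
have [J [K [iJ iK eU]]] := fubm_sde hU (ltW s0).
have [J' [K' [iJ' iK' eU']]] := fubm_sde hU s0'.
have ed : d = 'i *: (J' - J) - 2^-1 *: (K' - K).
  have zm (a p q p' q' : A) : (a + p' - q') - (a + p - q) = (p' - p) - (q' - q).
    rewrite -[a + p' - q']addrA -[a + p - q]addrA [- (a + _)]opprD addrACA subrr add0r.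
    by rewrite !opprB [q - p]addrC addrACA [- q' + q]addrC.
  by rewrite /d eU eU' zm !scalerBr.
have bt : integral_bound star pi tau X (fun r => r%:C%:A) s' 0 s.
  apply: (@integral_bound_le _ (s - 0)); last exact: (@integral_bound_time _ _ _ _ _ _ _ hA htau X 0 s).
  by rewrite subr0 ltW.
have bt' : integral_bound star pi tau X (fun r => r%:C%:A) s' 0 s'.
  by rewrite -[X in integral_bound _ _ _ _ _ X _ _]subr0; exact: (@integral_bound_time _ _ _ _ _ _ _ hA htau X 0 s').
have dK := incr_dist s0' (ltW h0) bt bt' (@integral_bound_time _ _ _ _ _ _ _ hA htau X s s') iK iK' hr.
have dJ := incr_dist ler01 ler01 (@integral_bound_brownian 0 s (lexx _)) (@integral_bound_brownian 0 s' (lexx _)) (@integral_bound_brownian s s' (ltW s0)) iJ iJ' hr.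
have eh : U s * (s'%:C%:A - s%:C%:A) = h%:C *: U s.
  by rewrite mulrBr -!(@scalerAr _ A) mulr1 -scalerBl -rmorphB.
rewrite {}eh in dK.
have nK : n2 (K' - K - h%:C *: U s) <= h * Num.sqrt (2 * eta).
  rewrite -(@ler_pXn2r _ 2) ?nnegrE ?n2_ge0 ?mulr_ge0 ?sqrtr_ge0 ?(ltW h0)//.
  rewrite (n2_sqr htau) exprMn sqr_sqrtr ?mulr_ge0//.
  by apply: (le_trans dK); rewrite expr2; lra.
have nJ : n2 (J' - J - U s * x) <= Num.sqrt (2 * eta * h).
  by apply: ler_wsqrtr; apply: (le_trans dJ); lra.
have c2 : cabs (2^-1 : R[i]) = 2^-1.
  have -> : (2^-1 : R[i]) = (2^-1)%:C by rewrite fmorphV rmorph_nat.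
  by rewrite cabs_real ger0_norm.
split.
  move=> y hy; have -> : tau (y * d) + (h / 2)%:C * tau (y * U s) =
      - (2^-1 * tau (y * (K' - K - h%:C *: U s))).
    rewrite ed mulrBr (tauB tau) -!(@scalerAr _ A) !(tauZ tau) (integral_martingale iJ iJ' hy).
    rewrite mulr0 sub0r [in RHS]mulrBr (tauB tau) -(@scalerAr _ A) (tauZ tau).
    by rewrite rmorphM fmorphV rmorph_nat; ring.
  rewrite cabsN cabsM c2 (le_trans (y := cabs (tau (y * (K' - K - h%:C *: U s)))))//.
    by rewrite ler_piMl ?cabs_ge0//; lra.
  by apply: (le_trans (tau_cs hA htau _ _)); rewrite ler_wpM2l ?n2_ge0.
have -> : d - 'i *: (U s * x) = 'i *: (J' - J - U s * x) - 2^-1 *: (K' - K - h%:C *: U s) - (2^-1 *: (h%:C *: U s)).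
  rewrite ed (scalerBr _ (K' - K)) (scalerBr _ (J' - J)) opprB -[in RHS]addrA.
  by rewrite [X in _ = _ + X]addrAC subrr sub0r addrAC.
apply: (le_trans (n2B hA htau _ _)); rewrite -[leRHS]addrA [h * n2 _ + _]addrC [leRHS]addrA; apply: lerD.
  apply: (le_trans (n2B hA htau _ _)); apply: lerD; first by rewrite (n2Z hA htau) cabs_i mul1r.
  rewrite (n2Z hA htau) c2; apply: le_trans nK; rewrite ler_piMl ?n2_ge0//; lra.
rewrite !(n2Z hA htau) c2 cabs_real gtr0_norm//.
by rewrite ler_piMl ?mulr_ge0 ?n2_ge0 ?(ltW h0)//; lra.
Qed.

End Increments.
End ItoStep.

(** * Second order jets *)

Section Jets.
Variables (R : realType) (A : algType R[i]) (star : A -> A) (tau : {scalar A}).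
Variable I : finType.

(* A jet records the expansion to second order of an element of A when each
   u j is replaced by u j + 'i (u j) x_j - (u j) / 2, the x_j being free
   semicircular elements of variance 1: the value jv, the coefficients of the
   x_j as sums of x (.) y (pairs in jd j), and the deterministic part jq of the
   second order term, where x_j a x_j is replaced by tau a. *)
Record jet := Jet { jv : A ; jd : I -> seq (A * A) ; jq : A }.

Definition tmull (a : A) (d : seq (A * A)) := [seq (a * p.1, p.2) | p <- d].
Definition tmulr (d : seq (A * A)) (a : A) := [seq (p.1, p.2 * a) | p <- d].

(** Partial trace of the tensor listed in [d]: tau (c .) is applied to the left legs. *)
Definition slice (c : A) (d : seq (A * A)) : A := \sum_(p <- d) tau (c * p.1) *: p.2.

(** The rule of replacing x_j a x_j by tau a: p.1 x_j p.2 p'.1 x_j p'.2 becomes tau (p.2 * p'.1) p.1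
    p'.2, summed over the pairs and over j. *)
Definition contr (d d' : I -> seq (A * A)) : A :=
  \sum_j \sum_(p <- d j) p.1 * slice p.2 (d' j).

Definition jmul (a b : jet) : jet :=
  Jet (jv a * jv b) (fun j => tmulr (jd a j) (jv b) ++ tmull (jv a) (jd b j))
    (jq a * jv b + jv a * jq b + contr (jd a) (jd b)).

Definition jone : jet := Jet 1 (fun=> [::]) 0.

Lemma slice_mull c a d : slice c (tmull a d) = slice (c * a) d.
Proof. by rewrite /slice big_map; apply: eq_bigr => p _; rewrite mulrA. Qed.

Lemma slice_mulr c d a : slice c (tmulr d a) = slice c d * a.
Proof. by rewrite /slice big_map mulr_suml; apply: eq_bigr => p _; rewrite -scalerAl. Qed.

Lemma slice_cat c d d' : slice c (d ++ d') = slice c d + slice c d'.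
Proof. exact: big_cat. Qed.

Lemma slice_nil c : slice c [::] = 0.
Proof. exact: big_nil. Qed.

Lemma slice_lin (z : R[i]) a b d : slice (z *: a + b) d = z *: slice a d + slice b d.
Proof.
rewrite /slice scaler_sumr -big_split /=; apply: eq_bigr => p _.
by rewrite mulrDl -scalerAl linearP /= scalerDl scalerA.
Qed.

(** The coefficient lists keep the order of the letters, so associativity is a plain equality and a
    word can be bracketed as prefix, block and suffix. *)
Lemma jmulA : associative jmul.
Proof.
move=> a b c; rewrite /jmul /=; congr Jet; first exact: mulrA.
  apply/funext => j; rewrite /tmull /tmulr !map_cat -!map_comp -catA; congr (_ ++ _ ++ _).
  - by apply: eq_map => p /=; rewrite mulrA.
  - by apply: eq_map => p /=; rewrite mulrA.
rewrite !mulrDl !mulrDr.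
have -> : contr (jd a) (fun j => tmulr (jd b j) (jv c) ++ tmull (jv b) (jd c j)) =
    contr (jd a) (jd b) * jv c + contr (fun j => tmulr (jd a j) (jv b)) (jd c).
  rewrite /contr mulr_suml -big_split; apply: eq_bigr => j _ /=.
  rewrite mulr_suml /tmulr big_map -big_split; apply: eq_bigr => p _ /=.
  by rewrite slice_cat slice_mulr slice_mull mulrDr mulrA.
have -> : contr (fun j => tmulr (jd a j) (jv b) ++ tmull (jv a) (jd b j)) (jd c) =
    contr (fun j => tmulr (jd a j) (jv b)) (jd c) + jv a * contr (jd b) (jd c).
  rewrite /contr mulr_sumr -big_split; apply: eq_bigr => j _ /=.
  rewrite big_cat /=; congr (_ + _); rewrite mulr_sumr /tmull big_map.
  by apply: eq_bigr => p _ /=; rewrite mulrA.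
by rewrite !mulrA !addrA [LHS](ACl (1*2*5*3*6*4))%AC.
Qed.

Lemma jmul1 a : jmul jone a = a.
Proof.
case: a => v d q; rewrite /jmul /=; congr Jet; first exact: mul1r.
  apply/funext => j; rewrite /tmull /=; elim: (d j) => //= p s ->.
  by rewrite mul1r; case: p.
by rewrite mul0r mul1r add0r /contr big1 ?addr0// => j _; rewrite big_nil.
Qed.

(** The scalar counts as a constant. When it is a moment, its own variation in time is entered
    separately, by the [dc] term of [cext_deriv]. *)
Definition jsub (a : jet) (z : R[i]) := Jet (jv a - z%:A) (jd a) (jq a).

Lemma jq_mul_jsub p a z b :
  jq (jmul p (jmul (jsub a z) b)) = jq (jmul p (jmul a b)) - z *: jq (jmul p b).
Proof.
rewrite /jmul /=.
have -> : contr (jd p) (fun j => tmulr (jd a j) (jv b) ++ tmull (jv a - z%:A) (jd b j)) =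
   contr (jd p) (fun j => tmulr (jd a j) (jv b) ++ tmull (jv a) (jd b j)) - z *: contr (jd p) (jd b).
  rewrite /contr scaler_sumr -sumrB; apply: eq_bigr => j _.
  rewrite scaler_sumr -sumrB; apply: eq_bigr => q _.
  rewrite !slice_cat !slice_mull mulrBr -(@scalerAr _ A) mulr1.
  have -> : slice (q.2 * jv a - z *: q.2) (jd b j) = slice (q.2 * jv a) (jd b j) - z *: slice q.2 (jd b j).
    by rewrite addrC -scaleNr slice_lin scaleNr addrC.
  by rewrite addrA mulrBr -(@scalerAr _ A).
rewrite !mulrBl -!(@scalerAl _ A) !mul1r.
rewrite !(mulrDr, mulrN) -!(@scalerAr _ A) !scalerDr !opprD !addrA.
by rewrite [LHS](ACl (1*3*4*6*7*2*5*8))%AC.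
Qed.

Definition jletter (u : I -> A) (l : I * bool) : jet :=
  if l.2 then Jet (u l.1) (fun j => if j == l.1 then [:: ('i *: u l.1, 1)] else [::]) (- 2^-1 *: u l.1)
  else Jet (star (u l.1)) (fun j => if j == l.1 then [:: ((- 'i)%:A, star (u l.1))] else [::]) (- 2^-1 *: star (u l.1)).

Definition jword u (w : seq (I * bool)) : jet := foldr (fun l => jmul (jletter u l)) jone w.

Lemma jword_cat u w w' : jword u (w ++ w') = jmul (jword u w) (jword u w').
Proof. by elim: w => [|l w IH] /=; rewrite ?jmul1// IH jmulA. Qed.

End Jets.

(** * Uniform asymptotics *)

Section Asymptotics.
Variables (R : realType) (A : algType R[i]) (star : A -> A)
  (H : completeNormedModType R[i]) (ip : {dot H for Num.conj}) (pi : A -> H -> H)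
  (tau : {scalar A}).
Hypothesis hA : von_neumann_algebra star ip pi.
Hypothesis htau : faithful_normal_tracial_state star ip pi tau.
Variable t : R.
Local Notation n2 := (n2 star tau).

(* Pairs s < s' of positive times close to t; the expansions below are
   uniform in such pairs, so that they give two-sided derivatives. *)
Definition near2 (P : R -> R -> Prop) := exists2 d : R, 0 < d &
  forall s s', 0 < s -> s < s' -> `|s - t| < d -> `|s' - t| < d -> P s s'.

Lemma near2S (P Q : R -> R -> Prop) : (forall s s', 0 < s -> s < s' -> P s s' -> Q s s') ->
  near2 P -> near2 Q.
Proof. by move=> PQ [d d0 h]; exists d => // s s' h1 h2 h3 h4; apply: PQ => //; exact: h. Qed.

Lemma near2I (P Q : R -> R -> Prop) : near2 P -> near2 Q -> near2 (fun s s' => P s s' /\ Q s s').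
Proof.
move=> [d d0 h] [e e0 k]; exists (Num.min d e); first by rewrite lt_min d0.
by move=> s s' s0 ss'; rewrite !lt_min => /andP[h1 h2] /andP[h3 h4]; split; [apply: h|apply: k].
Qed.

(** Two scales coexist: the increments of [U] are small in operator norm, with no rate, and of size
    sqrt (s' - s) in 2-norm. A product of three of them therefore has trace o(s' - s): one factor
    gives smallness, the other two give the rate. *)
Definition op_bounded (a : R -> R -> A) := exists2 C : R, 0 < C & near2 (fun s s' => op_bound pi C (a s s')).
Definition op_small (a : R -> R -> A) := forall e : R, 0 < e -> near2 (fun s s' => op_bound pi e (a s s')).
Definition n2_O (a : R -> R -> A) := exists2 C : R, 0 < C & near2 (fun s s' => n2 (a s s') <= C * Num.sqrt (s' - s)).
Definition n2_o (a : R -> R -> A) := forall e : R, 0 < e -> near2 (fun s s' => n2 (a s s') <= e * Num.sqrt (s' - s)).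
Definition small_h (z : R -> R -> R[i]) := forall e : R, 0 < e -> near2 (fun s s' => cabs (z s s') <= e * (s' - s)).
Definition small_1 (z : R -> R -> R[i]) := forall e : R, 0 < e -> near2 (fun s s' => cabs (z s s') <= e).

Implicit Types (a b : R -> R -> A) (z w : R -> R -> R[i]).

Lemma op_boundedM a b : op_bounded a -> op_bounded b -> op_bounded (fun s s' => a s s' * b s s').
Proof.
move=> [C C0 ha] [D D0 hb]; exists (C * D); first exact: mulr_gt0.
by apply: near2S (near2I ha hb) => s s' _ _ [h1 h2]; apply: (op_boundM hA) => //; exact: ltW.
Qed.

Lemma op_bounded_const (c : A) : op_bounded (fun _ _ => c).
Proof. by have [C C0 hC] := op_bound_ex hA c; exists C => //; exists 1. Qed.

Lemma op_bounded_star a : op_bounded a -> op_bounded (fun s s' => star (a s s')).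
Proof.
move=> [C C0 ha]; exists C => //; apply: near2S ha => s s' _ _; apply: (op_bound_star hA); exact: ltW.
Qed.

Lemma op_boundedZ (c : R[i]) a : op_bounded a -> op_bounded (fun s s' => c *: a s s').
Proof.
move=> [C C0 ha]; exists (cabs c * C + 1); first by rewrite ltr_wpDl// mulr_ge0 ?cabs_ge0// ltW.
apply: near2S ha => s s' _ _ /(op_boundZ hA c); apply: op_bound_le; lra.
Qed.

Lemma op_smallD a b : op_small a -> op_small b -> op_small (fun s s' => a s s' + b s s').
Proof.
move=> ha hb e e0; have e2 : 0 < e / 2 by lra.
apply: near2S (near2I (ha _ e2) (hb _ e2)) => s s' _ _ [h1 h2].
by apply: (@op_bound_le _ _ _ _ (e / 2 + e / 2)); [lra|apply: (op_boundD hA)].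
Qed.

Lemma op_smallMl a b : op_bounded a -> op_small b -> op_small (fun s s' => a s s' * b s s').
Proof.
move=> [C C0 ha] hb e e0; have e2 : 0 < e / C by rewrite divr_gt0.
apply: near2S (near2I ha (hb _ e2)) => s s' _ _ [h1 h2].
apply: (@op_bound_le _ _ _ _ (C * (e / C))); first by rewrite mulrC divfK// lt0r_neq0.
by apply: (op_boundM hA) => //; exact: ltW.
Qed.

Lemma op_smallMr a b : op_small a -> op_bounded b -> op_small (fun s s' => a s s' * b s s').
Proof.
move=> ha [C C0 hb] e e0; have e2 : 0 < e / C by rewrite divr_gt0.
apply: near2S (near2I (ha _ e2) hb) => s s' _ _ [h1 h2].
apply: (@op_bound_le _ _ _ _ ((e / C) * C)); first by rewrite divfK// lt0r_neq0.
by apply: (op_boundM hA) => //; exact: ltW.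
Qed.

Lemma op_small_tau a : op_small a -> small_1 (fun s s' => tau (a s s')).
Proof.
move=> ha e e0; have e2 : 0 < e / 2 by lra.
apply: near2S (ha _ e2) => s s' _ _ /(n2_opl hA htau 1 e2).
rewrite mulr1 (n21 hA htau) mulr1 => h; apply: (le_trans (cabs_tau_le hA htau _)).
by apply: (le_trans h); lra.
Qed.

Lemma n2_OD a b : n2_O a -> n2_O b -> n2_O (fun s s' => a s s' + b s s').
Proof.
move=> [C C0 ha] [D D0 hb]; exists (C + D); first exact: addr_gt0.
apply: near2S (near2I ha hb) => s s' _ _ [h1 h2].
by rewrite (le_trans (n2D hA htau _ _))// mulrDl lerD.
Qed.

Lemma n2_oD a b : n2_o a -> n2_o b -> n2_o (fun s s' => a s s' + b s s').
Proof.
move=> ha hb e e0; have e2 : 0 < e / 2 by lra.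
apply: near2S (near2I (ha _ e2) (hb _ e2)) => s s' _ _ [h1 h2].
rewrite (le_trans (n2D hA htau _ _))// (le_trans (lerD h1 h2))//.
by rewrite -mulrDl; have -> : e / 2 + e / 2 = e by lra.
Qed.

Lemma n2_O_Ml a b : op_bounded a -> n2_O b -> n2_O (fun s s' => a s s' * b s s').
Proof.
move=> [C C0 ha] [D D0 hb]; exists (2 * C * D); first by rewrite !mulr_gt0.
apply: near2S (near2I ha hb) => s s' _ _ [h1 h2].
apply: (le_trans (n2_opl hA htau _ C0 h1)).
by rewrite -[leRHS]mulrA ler_wpM2l// mulr_ge0// ltW.
Qed.

Lemma n2_O_Mr a b : n2_O a -> op_bounded b -> n2_O (fun s s' => a s s' * b s s').
Proof.
move=> [D D0 hb] [C C0 ha]; exists (2 * C * D); first by rewrite !mulr_gt0.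
apply: near2S (near2I ha hb) => s s' _ _ [h1 h2].
apply: (le_trans (n2_opr hA htau _ C0 h1)).
by rewrite -[leRHS]mulrA ler_wpM2l// mulr_ge0// ltW.
Qed.

Lemma n2_o_Ml a b : op_bounded a -> n2_o b -> n2_o (fun s s' => a s s' * b s s').
Proof.
move=> [C C0 ha] hb e e0; have e2 : 0 < e / (2 * C) by rewrite divr_gt0// mulr_gt0.
apply: near2S (near2I ha (hb _ e2)) => s s' _ _ [h1 h2].
apply: (le_trans (n2_opl hA htau _ C0 h1)).
apply: (le_trans (ler_wpM2l _ h2)); first by rewrite mulr_ge0// ltW.
by rewrite mulrA mulrCA mulfV ?mulr1// lt0r_neq0// mulr_gt0.
Qed.

Lemma n2_o_Osmall a b : op_small a -> n2_O b -> n2_o (fun s s' => a s s' * b s s').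
Proof.
move=> ha [D D0 hb] e e0; have e2 : 0 < e / (2 * D) by rewrite divr_gt0// mulr_gt0.
apply: near2S (near2I (ha _ e2) hb) => s s' _ _ [h1 h2].
apply: (le_trans (n2_opl hA htau _ e2 h1)).
apply: (le_trans (ler_wpM2l _ h2)); first by rewrite mulr_ge0// ltW.
rewrite le_eqVlt; apply/orP; left; apply/eqP.
by field; rewrite lt0r_neq0.
Qed.

Let sqrtM (s s' : R) : s < s' -> Num.sqrt (s' - s) * Num.sqrt (s' - s) = s' - s.
Proof. by move=> h; rewrite -expr2 sqr_sqrtr// subr_ge0 ltW. Qed.

Lemma tau_n2_Oo a b : n2_O a -> n2_o b -> small_h (fun s s' => tau (a s s' * b s s')).
Proof.
move=> [D D0 hb] ha e e0; have e2 : 0 < e / D by rewrite divr_gt0.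
apply: near2S (near2I (ha _ e2) hb) => s s' _ ss' [h1 h2].
apply: (le_trans (tau_cs hA htau _ _)).
apply: (@le_trans _ _ ((D * Num.sqrt (s' - s)) * (e / D * Num.sqrt (s' - s)))).
  by apply: ler_pM; rewrite ?n2_ge0.
by rewrite mulrACA sqrtM// [D * _]mulrC divfK// lt0r_neq0.
Qed.

Lemma tau_n2_oO a b : n2_o a -> n2_O b -> small_h (fun s s' => tau (a s s' * b s s')).
Proof.
move=> ha hb e e0; apply: near2S (tau_n2_Oo hb ha e0) => s s' _ _.
by rewrite (tauC htau).
Qed.

Lemma small_hD z w : small_h z -> small_h w -> small_h (fun s s' => z s s' + w s s').
Proof.
move=> ha hb e e0; have e2 : 0 < e / 2 by lra.
apply: near2S (near2I (ha _ e2) (hb _ e2)) => s s' _ _ [h1 h2].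
rewrite (le_trans (cabsD _ _))// (le_trans (lerD h1 h2))//.
by rewrite -mulrDl; have -> : e / 2 + e / 2 = e by lra.
Qed.

Lemma small_h_ext z w : (forall s s', 0 < s -> s < s' -> z s s' = w s s') -> small_h z -> small_h w.
Proof. by move=> zw hz e e0; apply: near2S (hz e e0) => s s' h1 h2; rewrite zw. Qed.

Lemma small_h0 : small_h (fun _ _ => 0).
Proof.
move=> e e0; exists 1 => // s s' _ ss' _ _; rewrite cabs0 mulr_ge0 ?subr_ge0// ltW//.
Qed.

Lemma small_hM1 z : small_1 z -> small_h (fun s s' => (s' - s)%:C * z s s').
Proof.
move=> hz e e0; apply: near2S (hz e e0) => s s' _ ss' h.
rewrite cabsM cabs_real ger0_norm ?subr_ge0 ?(ltW ss')// mulrC.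
by rewrite ler_wpM2r// subr_ge0 ltW.
Qed.

(** The pair is (t, t + h) for h > 0 and (t + h, t) for h < 0; requiring |h| < t keeps the left end
    positive. *)
Lemma small_h_derivative (f : R -> R[i]) (l : R[i]) : 0 < t ->
  small_h (fun s s' => f s' - f s - (s' - s)%:C * l) -> has_derivative f t l.
Proof.
move=> t0 hf; apply/(@cvgrPdist_le _ (R[i]^o)) => e e0.
have eE : e = (complex.Re e)%:C by rewrite RRe_real// ger0_real// ltW.
rewrite eE ltcR in e0 *.
have [d d0 hd] := hf _ e0.
near=> h.
have hd' : `|h| < Num.min d t by near: h; apply: dnbhs0_lt; rewrite lt_min d0.
have h0 : h != 0 by near: h; exact: nbhs_dnbhs_neq.
move: hd'; rewrite lt_min => /andP[hd' ht].
have th : 0 < t + h by move: ht; rewrite ltr_norml => /andP[]; lra.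
have key : cabs (f (t + h) - f t - h%:C * l) <= complex.Re e * `|h|.
  have [hp|hn] := ltP 0 h.
    have := hd t (t + h) t0; rewrite ltrDl subrr normr0 [t + h]addrC addrK ger0_norm ?(ltW hp)//.
    by rewrite gtr0_norm // in hd'; apply.
  have hn' : h < 0 by rewrite lt_neqAle h0.
  have e1 : t - (t + h) = - h by rewrite opprD addrA subrr add0r.
  have e2 : t + h - t = h by rewrite addrC addKr.
  have := hd (t + h) t th; rewrite gtrDl subrr normr0 e1 e2.
  move=> /(_ hn' hd' d0); rewrite (ltr0_norm hn') -cabsN.
  have -> : - (f t - f (t + h) - (- h)%:C * l) = f (t + h) - f t - h%:C * l.
    by rewrite rmorphN /=; ring.
  by [].
rewrite /= cabsE lecR.
have hC : (h%:C : R[i]) != 0 by rewrite -(rmorph0 (real_complex R)) (inj_eq (@complexI R)).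
have -> : l - h%:C^-1 * (f (t + h) - f t) = - (h%:C^-1 * (f (t + h) - f t - h%:C * l)).
  by rewrite [in RHS]mulrBr mulrA mulVf// mul1r opprB.
rewrite cabsN cabsM -fmorphV cabs_real normrV ?unitfE// mulrC ler_pdivrMr// normr_gt0//.
Unshelve. all: by end_near.
Qed.

End Asymptotics.

(** * Moments of one process *)

Section WordDerivative.
Variables (R : realType) (A : algType R[i]) (star : A -> A)
  (H : completeNormedModType R[i]) (ip : {dot H for Num.conj}) (pi : A -> H -> H)
  (tau : {scalar A}).
Hypothesis hA : von_neumann_algebra star ip pi.
Hypothesis htau : faithful_normal_tracial_state star ip pi tau.
Variables X U : R -> A.
Hypothesis hU : free_unitary_brownian_motion star pi tau X U.
Let hX := fubm_driver hU.
Local Notation FA s := (star_alg star (filtration star pi X s)).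
Local Notation n2 := (n2 star tau).
Variable t : R.
Hypothesis t0 : 0 < t.
Local Notation near2 := (near2 t).
Local Notation op_bounded := (op_bounded pi t).
Local Notation op_small := (op_small pi t).
Local Notation n2_O := (n2_O star tau t).
Local Notation n2_o := (n2_o star tau t).
Local Notation small_h := (small_h t).
Local Notation small_1 := (small_1 t).
Implicit Types (a c y : R -> R -> A) (b : bool) (w : seq bool).

Definition adapted (a : R -> R -> A) := forall s s' : R, 0 < s -> FA s (a s s').

Definition letter b s := if b then U s else star (U s).
(** Since dU = i U dX and its adjoint is - i dX (star U), the increment stands to the right of U and
    to the left of star U; [letter_l] and [letter_r] are what surrounds it. *)
Definition letter_l b s : A := if b then 'i *: U s else (- 'i)%:A.
Definition letter_r b s : A := if b then 1 else star (U s).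
Definition letter_d b s s' := letter b s' - letter b s.
Definition letter_x b s s' := letter_l b s * (X s' - X s) * letter_r b s.

Lemma near2_sqrt (e : R) : 0 < e -> near2 (fun s s' => Num.sqrt (s' - s) <= e).
Proof.
move=> e0; exists (e ^+ 2 / 2); first by rewrite divr_gt0// exprn_gt0.
move=> s s' _ ss'; rewrite !ltr_distl => /andP[h1 h2] /andP[h3 h4].
rewrite -(@ler_pXn2r _ 2) ?nnegrE ?sqrtr_ge0 ?(ltW e0)//.
by rewrite sqr_sqrtr; lra.
Qed.

Lemma near2_op_incr (e : R) : 0 < e -> near2 (fun s s' => op_bound pi e (U s' - U s)).
Proof.
move=> e0; have [d d0 hd] := op_cont_at hA hU (ltW t0) e0.
exists d => // s s' s0 ss' h1 h2; apply: hd => //; last exact: ltW.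
by rewrite ltW// (lt_trans s0).
Qed.

Lemma near2_op_t (e : R) : 0 < e -> near2 (fun s s' => op_bound pi e (U s - U t) /\ op_bound pi e (U s' - U t)).
Proof.
move=> e0; have [d d0 hd] := op_cont_at hA hU (ltW t0) e0.
exists d => // s s' s0 ss' h1 h2; have s0' := lt_trans s0 ss'.
by split; apply: hd; rewrite ?subrr ?normr0// ltW.
Qed.

Lemma near2_osc (e : R) : 0 < e -> near2 (fun s s' => forall r, s <= r < s' -> l2sq star tau (U r - U s) <= e).
Proof.
move=> e0; have [d d0 hd] := l2_cont_at hA htau hU (ltW t0) e0.
exists d => // s s' s0 ss' h1 h2 r /andP[r1 r2]; apply: hd => //.
- by rewrite (le_trans (ltW s0)).
- exact: ltW.
- move: h1 h2; rewrite !ltr_distl => /andP[h1 h2] /andP[h3 h4]; apply/andP; split; lra.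
Qed.

Lemma letter_cont_l b : op_small (fun s s' => letter b s - letter b t).
Proof.
move=> e e0; apply: near2S (near2_op_t e0) => s s' _ _ [h1 h2]; case: b => //=.
by rewrite -(starN hA) -(starD hA); apply: (op_bound_star hA) => //; exact: ltW.
Qed.

Lemma letter_cont_r b : op_small (fun s s' => letter b s' - letter b t).
Proof.
move=> e e0; apply: near2S (near2_op_t e0) => s s' _ _ [h1 h2]; case: b => //=.
by rewrite -(starN hA) -(starD hA); apply: (op_bound_star hA) => //; exact: ltW.
Qed.

Lemma op_bounded_near (a : R -> R -> A) (a0 : A) : op_small (fun s s' => a s s' - a0) -> op_bounded a.
Proof.
move=> ha; have [C C0 hC] := op_bound_ex hA a0; exists (1 + C); first lra.
apply: near2S (ha 1 ltr01) => s s' _ _ h.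
by rewrite -[a s s'](subrK a0); apply: (op_boundD hA).
Qed.

Lemma letter_bdd b : op_bounded (fun s s' => letter b s).
Proof. exact: op_bounded_near (letter_cont_l b). Qed.

Lemma letter_bdd' b : op_bounded (fun s s' => letter b s').
Proof. exact: op_bounded_near (letter_cont_r b). Qed.

Lemma letter_l_bdd b : op_bounded (fun s s' => letter_l b s).
Proof.
case: b; first by apply: (op_boundedZ hA); exact: (letter_bdd true).
exact: (op_bounded_const hA).
Qed.

Lemma letter_r_bdd b : op_bounded (fun s s' => letter_r b s).
Proof. by case: b; [exact: (op_bounded_const hA)|exact: (letter_bdd false)]. Qed.

Lemma letter_d_small b : op_small (letter_d b).
Proof.
move=> e e0; apply: near2S (near2_op_incr e0) => s s' _ _ h; rewrite /letter_d; case: b => //=.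
by rewrite -(starN hA) -(starD hA); apply: (op_bound_star hA) => //; exact: ltW.
Qed.

Lemma letter_adapted b : adapted (fun s s' => letter b s).
Proof.
move=> s s' s0; have h : FA s (U s) by apply: sa_sub; apply: (fubm_adapted hU); exact: ltW.
by case: b => //=; exact: sa_star.
Qed.

Lemma letter_l_adapted b : adapted (fun s s' => letter_l b s).
Proof.
move=> s s' s0; case: b => /=; first by apply: sa_Z; exact: (@letter_adapted true s s').
by apply: sa_Z; exact: sa_1.
Qed.

Lemma letter_r_adapted b : adapted (fun s s' => letter_r b s).
Proof.
move=> s s' s0; case: b => /=; first exact: sa_1.
exact: (@letter_adapted false s s').
Qed.

Lemma adaptedM a c : adapted a -> adapted c -> adapted (fun s s' => a s s' * c s s').
Proof. by move=> ha hc s s' s0; apply: sa_M; [exact: ha|exact: hc]. Qed.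

Lemma incr_n2_O : n2_O (fun s s' => X s' - X s).
Proof.
exists 1 => //; exists 1 => // s s' s0 ss' _ _; rewrite mul1r.
have h1 : FA s 1 by exact: sa_1.
have := incr_l2 hA htau hX (ltW s0) ss' h1.
by rewrite mul1r /n2 => ->; rewrite /l2sq (star1 hA) mulr1 (tau1 htau) /= mul1r.
Qed.

Lemma letter_x_n2_O b : n2_O (letter_x b).
Proof.
apply: (n2_O_Mr hA htau); last exact: letter_r_bdd.
apply: (n2_O_Ml hA htau); first exact: letter_l_bdd.
exact: incr_n2_O.
Qed.

Lemma letter_dx_n2_o b : n2_o (fun s s' => letter_d b s s' - letter_x b s s').
Proof.
have ht : n2_o (fun s s' => letter_d true s s' - letter_x true s s').
  move=> e e0; have e3 : 0 < e / 3 by lra.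
  (* Chosen so that sqrt (2 eta) = e / 3. Below, [m] makes both h |U s|_2 and h e / 3 at most sqrt h
     e / 3, so the three terms of [ito_step] add up to e sqrt h. *)
  pose eta := (e / 3) ^+ 2 / 2; have eta0 : 0 < eta by rewrite divr_gt0// exprn_gt0.
  have [C C0 hC] := letter_bdd true.
  pose m := Num.min 1 (e / 3 / (2 * C)).
  have m0 : 0 < m by rewrite lt_min ltr01 divr_gt0// mulr_gt0.
  apply: near2S (near2I hC (near2I (near2_osc eta0) (near2_sqrt m0))) => s s' s0 ss' [h1 [h2 h3]].
  have [_] := ito_step hA htau hU s0 ss' (ltW eta0) h2.
  rewrite /letter_d /letter_x /= mulr1 scalerAl => /le_trans; apply.
  have hh : 0 <= s' - s by rewrite subr_ge0 ltW.
  have q0 : 0 <= Num.sqrt (s' - s) by exact: sqrtr_ge0.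
  have hE : s' - s = Num.sqrt (s' - s) * Num.sqrt (s' - s) by rewrite -expr2 sqr_sqrtr.
  have -> : Num.sqrt (2 * eta * (s' - s)) = e / 3 * Num.sqrt (s' - s).
    rewrite sqrtrM; last by rewrite mulr_ge0// ltW.
    by rewrite /eta mulrCA mulfV ?mulr1// sqrtr_sqr gtr0_norm.
  have -> : Num.sqrt (2 * eta) = e / 3.
    by rewrite /eta mulrCA mulfV ?mulr1// sqrtr_sqr gtr0_norm.
  have nU : n2 (U s) <= 2 * C by exact: (n2_op_le hA htau C0 h1).
  have a1 : (s' - s) * n2 (U s) <= Num.sqrt (s' - s) * (e / 3).
    rewrite {1}hE -mulrA ler_wpM2l//.
    apply: (@le_trans _ _ ((e / 3 / (2 * C)) * (2 * C))).
      apply: ler_pM => //; first exact: n2_ge0.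
      by apply: (le_trans h3); rewrite ge_min lexx orbT.
    by rewrite divfK// lt0r_neq0// mulr_gt0.
  have a2 : (s' - s) * (e / 3) <= Num.sqrt (s' - s) * (e / 3).
    rewrite ler_wpM2r ?(ltW e3)// {1}hE ler_piMr//.
    by apply: (le_trans h3); rewrite ge_min lexx.
  by move: a1 a2; lra.
case: b => // e e0; apply: near2S (ht e e0) => s s' s0 ss'.
have -> : letter_d false s s' - letter_x false s s' = star (letter_d true s s' - letter_x true s s').
  rewrite /letter_d /letter_x /= mulr1 !(starD hA, starN hA, starM hA) (starZ hA).
  have -> : conjc ('i : R[i]) = - 'i by apply/eqP; rewrite eq_complex /= oppr0 !eqxx.
  rewrite -!(@scalerAr _ A) -!(@scalerAl _ A) mul1r.
  have := incr_star hX (ltW s0) ss'; rewrite (starD hA) (starN hA) => ->.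
  by [].
by rewrite (n2_star hA htau).
Qed.

Lemma letter_d_n2_O b : n2_O (letter_d b).
Proof.
have hd : n2_O (fun s s' => letter_d b s s' - letter_x b s s').
  by exists 1 => //; exact: letter_dx_n2_o.
have [C C0 hC] := n2_OD hA htau hd (letter_x_n2_O b).
by exists C => //; apply: near2S hC => s s' _ _; rewrite subrK.
Qed.

Lemma first_order b y : op_bounded y -> adapted y ->
  small_h (fun s s' => tau (y s s' * letter_d b s s') + ((s' - s) / 2)%:C * tau (y s s' * letter b s)).
Proof.
have ht y' : op_bounded y' -> adapted y' -> small_h (fun s s' => tau (y' s s' * letter_d true s s') +
    ((s' - s) / 2)%:C * tau (y' s s' * letter true s)).
  move=> [C C0 hC] ad e e0.
  pose eta := (e / (2 * C)) ^+ 2 / 2.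
  have e2 : 0 < e / (2 * C) by rewrite divr_gt0// mulr_gt0.
  have eta0 : 0 < eta by rewrite divr_gt0// exprn_gt0.
  apply: near2S (near2I hC (near2_osc eta0)) => s s' s0 ss' [h1 h2].
  have [h3 _] := ito_step hA htau hU s0 ss' (ltW eta0) h2.
  apply: (le_trans (h3 _ (ad s s' s0))).
  have -> : Num.sqrt (2 * eta) = e / (2 * C).
    by rewrite /eta mulrCA mulfV ?mulr1// sqrtr_sqr gtr0_norm.
  have hh : 0 <= s' - s by rewrite subr_ge0 ltW.
  apply: (@le_trans _ _ (2 * C * ((s' - s) * (e / (2 * C))))).
    apply: ler_wpM2r; first by rewrite mulr_ge0// ltW.
    exact: (n2_op_le hA htau C0 h1).
  by rewrite mulrCA [2 * C * _]mulrC divfK ?lt0r_neq0 ?mulr_gt0// mulrC.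
case: b; first exact: ht.
move=> hy ad; have ad' : adapted (fun s s' => star (y s s')) by move=> s s' s0; apply: sa_star; exact: ad.
move=> e e0; apply: near2S (ht _ (op_bounded_star hA hy) ad' e e0) => s s' _ _ /= hh.
have cj (a' c' : A) : tau (a' * star c') = conjc (tau (star a' * c')).
  by rewrite -(tau_star hA htau) (starM hA) (starK hA) (tauC htau).
have -> : letter_d false s s' = star (letter_d true s s') by rewrite /letter_d /= (starD hA) (starN hA).
have -> : ((s' - s) / 2)%:C = conjc ((s' - s) / 2)%:C by rewrite /= oppr0.
by rewrite !cj -conjcM -conjcD cabs_conj.
Qed.

(** Replacing each increment by its martingale part costs O(sqrt h) o(sqrt h) = o(h) in trace.
    Traciality then brings the rest to the form of [incr_free3], which separates what lies between
    the two increments from what lies outside. *)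
Lemma second_order b b' a c : op_bounded a -> adapted a -> op_bounded c -> adapted c ->
  small_h (fun s s' => tau (a s s' * letter_d b s s' * c s s' * letter_d b' s s') -
    (s' - s)%:C * (tau (letter_r b s * c s s' * letter_l b' s) * tau (letter_r b' s * a s s' * letter_l b s))).
Proof.
move=> ba ada bc adc.
have h1 : small_h (fun s s' => tau ((a s s' * (letter_d b s s' - letter_x b s s')) * (c s s' * letter_d b' s s'))).
  apply: (tau_n2_oO hA htau); first exact: (n2_o_Ml hA htau ba (letter_dx_n2_o b)).
  exact: (n2_O_Ml hA htau bc (letter_d_n2_O b')).
have h2 : small_h (fun s s' => tau ((a s s' * letter_x b s s') * (c s s' * (letter_d b' s s' - letter_x b' s s')))).
  apply: (tau_n2_Oo hA htau); first exact: (n2_O_Ml hA htau ba (letter_x_n2_O b)).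
  exact: (n2_o_Ml hA htau bc (letter_dx_n2_o b')).
apply: small_h_ext (small_hD h1 h2) => s s' s0 ss'.
have e3 : tau (a s s' * letter_x b s s' * (c s s' * letter_x b' s s')) =
  (s' - s)%:C * (tau (letter_r b s * c s s' * letter_l b' s) * tau (letter_r b' s * a s s' * letter_l b s)).
  rewrite [X in _ = _ * X]mulrC [RHS]mulrA.
  rewrite -(incr_free3 htau hX (ltW s0) ss').
  - by rewrite /letter_x !mulrA (tauC htau) !mulrA.
  - apply: sa_M; last exact: (@letter_l_adapted b s s').
    by apply: sa_M; [exact: (@letter_r_adapted b' s s')|exact: ada].
  - apply: sa_M; last exact: (@letter_l_adapted b' s s').
    by apply: sa_M; [exact: (@letter_r_adapted b s s')|exact: adc].
rewrite -{}e3; move: (letter_d b s s') (letter_d b' s s') (letter_x b s s') (letter_x b' s s') => d d' x x'.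
rewrite !(mulrBr, mulrBl) !(tauB tau) !mulrA.
by rewrite addrA subrK.
Qed.

Fixpoint word_val w s : A := if w is b :: w' then letter b s * word_val w' s else 1.

(** One-process counterparts of [slice] and [contr] for the jet of a word, without the drift;
    [jword_single] makes the identification. *)
Fixpoint word_slice w s (c : A) : A :=
  if w is b :: w' then tau (c * letter_l b s) *: (letter_r b s * word_val w' s) + word_slice w' s (c * letter b s) else 0.

Fixpoint word_contr w s : A :=
  if w is b :: w' then letter b s * word_contr w' s + letter_l b s * word_slice w' s (letter_r b s) else 0.

(** Terms of degree one and two when each letter at s' is written as its value at s plus its
    increment. *)
Fixpoint lin_part w s s' : A :=
  if w is b :: w' then letter_d b s s' * word_val w' s + letter b s * lin_part w' s s' else 0.
Fixpoint quad_part w s s' : A :=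
  if w is b :: w' then letter_d b s s' * lin_part w' s s' + letter b s * quad_part w' s s' else 0.

Lemma word_val_bdd w : op_bounded (fun s s' => word_val w s).
Proof.
elim: w => [|b w IH] /=; first exact: (op_bounded_const hA).
by apply: (op_boundedM hA) => //; exact: letter_bdd.
Qed.

Lemma word_val_bdd' w : op_bounded (fun s s' => word_val w s').
Proof.
elim: w => [|b w IH] /=; first exact: (op_bounded_const hA).
by apply: (op_boundedM hA) => //; exact: letter_bdd'.
Qed.

Lemma word_val_adapted w : adapted (fun s s' => word_val w s).
Proof.
elim: w => [|b w IH] /=; first by move=> s s' _; exact: sa_1.
by apply: adaptedM => //; exact: letter_adapted.
Qed.

Lemma word_incr_n2_O w : n2_O (fun s s' => word_val w s' - word_val w s).
Proof.
elim: w => [|b w IH].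
  by exists 1 => //; exists 1 => // s s' _ _ _ _; rewrite /= subrr (n20 hA htau) mul1r sqrtr_ge0.
have h1 : n2_O (fun s s' => letter_d b s s' * word_val w s').
  by apply: (n2_O_Mr hA htau); [exact: letter_d_n2_O|exact: word_val_bdd'].
have h2 : n2_O (fun s s' => letter b s * (word_val w s' - word_val w s)).
  by apply: (n2_O_Ml hA htau) => //; exact: letter_bdd.
have [C C0 hC] := n2_OD hA htau h1 h2; exists C => //; apply: near2S hC => s s' _ _ /=.
by rewrite /letter_d mulrBl mulrBr addrA subrK.
Qed.

Lemma word_incr_n2_o w : n2_o (fun s s' => word_val w s' - word_val w s - lin_part w s s').
Proof.
elim: w => [|b w IH].
  move=> e e0; exists 1 => // s s' _ _ _ _; rewrite /= subrr subr0 (n20 hA htau).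
  by rewrite mulr_ge0 ?sqrtr_ge0// ltW.
have h1 : n2_o (fun s s' => letter_d b s s' * (word_val w s' - word_val w s)).
  by apply: (n2_o_Osmall hA htau); [exact: letter_d_small|exact: word_incr_n2_O].
have h2 : n2_o (fun s s' => letter b s * (word_val w s' - word_val w s - lin_part w s s')).
  by apply: (n2_o_Ml hA htau) => //; exact: letter_bdd.
move=> e e0; apply: near2S (n2_oD hA htau h1 h2 e0) => s s' _ _ /=.
have -> : letter b s' = letter_d b s s' + letter b s by rewrite /letter_d subrK.
suff -> : letter_d b s s' * (word_val w s' - word_val w s) + letter b s * (word_val w s' - word_val w s - lin_part w s s') =
  (letter_d b s s' + letter b s) * word_val w s' - letter b s * word_val w s - (letter_d b s s' * word_val w s + letter b s * lin_part w s s') by [].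
by move: (letter_d b s s') (letter b s) => d l; rewrite mulrDl !mulrBr opprD !addrA [LHS](ACl (1*3*4*2*5))%AC.
Qed.

(** The remainder contains at least three increments. In the induction, the increment of the first
    letter, O(sqrt h), meets the part of the tail beyond first order, which is o(sqrt h) by
    [word_incr_n2_o]. *)
Lemma word_incr_small_h w a : op_bounded a ->
  small_h (fun s s' => tau (a s s' * (word_val w s' - word_val w s - lin_part w s s' - quad_part w s s'))).
Proof.
elim: w a => [|b w IH] a ba.
  by apply: small_h_ext (small_h0 t) => s s' _ _; rewrite /= subrr !subr0 mulr0 (tau0 tau).
have h1 : small_h (fun s s' => tau ((a s s' * letter_d b s s') * (word_val w s' - word_val w s - lin_part w s s'))).
  by apply: (tau_n2_Oo hA htau); [exact: (n2_O_Ml hA htau ba (letter_d_n2_O b))|exact: word_incr_n2_o].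
have h2 := IH _ (op_boundedM hA ba (letter_bdd b)).
apply: small_h_ext (small_hD h1 h2) => s s' _ _ /=.
have -> : letter b s' = letter_d b s s' + letter b s by rewrite /letter_d subrK.
rewrite -!mulrA -(tauD tau) -mulrDr; congr (tau (_ * _)).
move: (letter_d b s s') (letter b s) => d l.
by rewrite mulrDl !mulrBr !opprD !addrA [LHS](ACl (1*4*5*2*6*3*7))%AC.
Qed.

Lemma lin_part_drift w a : op_bounded a -> adapted a ->
  small_h (fun s s' => tau (a s s' * lin_part w s s') +
    ((s' - s) / 2 * (size w)%:R)%:C * tau (a s s' * word_val w s)).
Proof.
elim: w a => [|b w IH] a ba ada.
  by apply: small_h_ext (small_h0 t) => s s' _ _; rewrite /= !mulr0 mul0r addr0 (tau0 tau).
have h1 := first_order b (op_boundedM hA (word_val_bdd w) ba) (adaptedM (word_val_adapted w) ada).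
have h2 := IH _ (op_boundedM hA ba (letter_bdd b)) (adaptedM ada (letter_adapted b)).
apply: small_h_ext (small_hD h1 h2) => s s' _ _ /=.
move: (letter_d b s s') => d; rewrite mulrDr (tauD tau) !mulrA.
have -> : tau (word_val w s * a s s' * d) = tau (a s s' * d * word_val w s).
  by rewrite -mulrA (tauC htau).
have -> : tau (word_val w s * a s s' * letter b s) = tau (a s s' * letter b s * word_val w s).
  by rewrite -mulrA (tauC htau).
rewrite -[(size w).+1%:R]natr1 mulrDr mulr1 rmorphD /=; ring.
Qed.

(** [c] collects the letters between the two increments, while those after the second one are moved
    cyclically in front of [a]; [second_order] then sees adapted elements only. *)
Lemma letter_lin_part_drift w b a c : op_bounded a -> adapted a -> op_bounded c -> adapted c ->
  small_h (fun s s' => tau (a s s' * letter_d b s s' * c s s' * lin_part w s s') -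
   (s' - s)%:C * tau (a s s' * letter_l b s * word_slice w s (letter_r b s * c s s'))).
Proof.
elim: w c => [|b' w IH] c ba ada bc adc.
  by apply: small_h_ext (small_h0 t) => s s' _ _; rewrite /= !mulr0 (tau0 tau) mulr0 subr0.
have h1 := second_order b b' (op_boundedM hA (word_val_bdd w) ba) (adaptedM (word_val_adapted w) ada) bc adc.
have h2 := IH _ ba ada (op_boundedM hA bc (letter_bdd b')) (adaptedM adc (letter_adapted b')).
apply: small_h_ext (small_hD h1 h2) => s s' _ _ /=.
move: (letter_d b s s') (letter_d b' s s') => d d'; rewrite !mulrDr !(tauD tau) -!(@scalerAr _ A) (tauZ tau) !mulrA.
have -> : tau (word_val w s * a s s' * d * c s s' * d') = tau (a s s' * d * c s s' * d' * word_val w s).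
  by rewrite -!mulrA (tauC htau) !mulrA.
have -> : tau (letter_r b' s * word_val w s * a s s' * letter_l b s) = tau (a s s' * letter_l b s * letter_r b' s * word_val w s).
  by rewrite -mulrA (tauC htau) !mulrA.
by ring.
Qed.

Lemma quad_part_drift w a : op_bounded a -> adapted a ->
  small_h (fun s s' => tau (a s s' * quad_part w s s') - (s' - s)%:C * tau (a s s' * word_contr w s)).
Proof.
elim: w a => [|b w IH] a ba ada.
  by apply: small_h_ext (small_h0 t) => s s' _ _; rewrite /= !mulr0 (tau0 tau) mulr0 subr0.
have ad1 : adapted (fun _ _ => 1) by move=> s s' _; exact: sa_1.
have h1 := letter_lin_part_drift w b ba ada (op_bounded_const hA t 1) ad1.
have h2 := IH _ (op_boundedM hA ba (letter_bdd b)) (adaptedM ada (letter_adapted b)).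
apply: small_h_ext (small_hD h1 h2) => s s' _ _ /=.
by move: (letter_d b s s') => d; rewrite !mulr1 !mulrDr !(tauD tau) !mulrA; ring.
Qed.

Lemma word_expansion w : small_h (fun s s' => tau (word_val w s') - tau (word_val w s) -
  (s' - s)%:C * (tau (word_contr w s) - ((size w)%:R / 2)%:C * tau (word_val w s))).
Proof.
have b1 := op_bounded_const hA t 1.
have ad1 : adapted (fun _ _ => 1) by move=> s s' _; exact: sa_1.
apply: small_h_ext (small_hD (small_hD (word_incr_small_h w b1) (lin_part_drift w b1 ad1)) (quad_part_drift w b1 ad1)) => s s' _ _.
rewrite !mul1r !(tauB tau).
have -> : ((s' - s) / 2 * (size w)%:R)%:C = (s' - s)%:C * ((size w)%:R / 2)%:C :> R[i].
  by rewrite -rmorphM /=; congr (_%:C); ring.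
by ring.
Qed.

(** The coefficients in [word_expansion] are taken at the left end s. Continuity moves them to t at
    the cost of s' - s times a quantity that tends to 0. *)
Definition cont_at (a : R -> A) := op_small (fun s s' => a s - a t).

Lemma cont_bdd (a : R -> A) : cont_at a -> op_bounded (fun s s' => a s).
Proof. exact: op_bounded_near. Qed.

Lemma contD (a c : R -> A) : cont_at a -> cont_at c -> cont_at (fun s => a s + c s).
Proof.
move=> ha hc e e0; apply: near2S (op_smallD hA ha hc e0) => s s' _ _.
by rewrite opprD addrACA.
Qed.

Lemma contM (a c : R -> A) : cont_at a -> cont_at c -> cont_at (fun s => a s * c s).
Proof.
move=> ha hc e e0.
have h1 := op_smallMr hA ha (cont_bdd hc).
have h2 := op_smallMl hA (op_bounded_const hA t (a t)) hc.
apply: near2S (op_smallD hA h1 h2 e0) => s s' _ _.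
by rewrite mulrBl mulrBr addrA subrK.
Qed.

Lemma cont_cst (c : A) : cont_at (fun _ => c).
Proof.
move=> e e0; exists 1 => // s s' _ _ _ _ x.
by rewrite subrr (pi0 hA) normr0 mulr_ge0// ler0c ltW.
Qed.

Lemma contZ (a c : R -> A) : cont_at a -> cont_at c -> cont_at (fun s => tau (a s) *: c s).
Proof.
move=> ha hc e e0; have [C C0 hC] := cont_bdd hc.
have e1 : 0 < e / (2 * C) by rewrite divr_gt0// mulr_gt0.
have k1 : 0 < cabs (tau (a t)) + 1 by rewrite ltr_wpDl// cabs_ge0.
have e2 : 0 < e / 2 / (cabs (tau (a t)) + 1) by rewrite divr_gt0//; lra.
apply: near2S (near2I hC (near2I (op_small_tau hA htau ha e1) (hc _ e2))) => s s' _ _ [h1 [h2 h3]].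
have -> : tau (a s) *: c s - tau (a t) *: c t = tau (a s - a t) *: c s + tau (a t) *: (c s - c t).
  by rewrite (tauB tau) scalerBl scalerBr addrA subrK.
apply: (@op_bound_le _ _ _ _ (cabs (tau (a s - a t)) * C + cabs (tau (a t)) * (e / 2 / (cabs (tau (a t)) + 1)))); last first.
  by apply: (op_boundD hA); apply: (op_boundZ hA).
have l1 : cabs (tau (a s - a t)) * C <= e / 2.
  apply: (@le_trans _ _ (e / (2 * C) * C)); first by rewrite ler_wpM2r// ltW.
  by rewrite invfM mulrA divfK// lt0r_neq0.
have l2 : cabs (tau (a t)) * (e / 2 / (cabs (tau (a t)) + 1)) <= e / 2.
  apply: (@le_trans _ _ ((cabs (tau (a t)) + 1) * (e / 2 / (cabs (tau (a t)) + 1)))).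
    by rewrite ler_wpM2r ?lerDl// ltW.
  by rewrite mulrC divfK// lt0r_neq0.
lra.
Qed.

Lemma cont_letter b : cont_at (letter b). Proof. exact: letter_cont_l. Qed.

Lemma cont_letter_l b : cont_at (letter_l b).
Proof.
case: b; last exact: cont_cst.
move=> e e0; apply: near2S (cont_letter true e0) => s s' _ _ h.
rewrite /letter_l -scalerBr -[e]mul1r -(@cabs_i R).
exact: (op_boundZ hA).
Qed.

Lemma cont_letter_r b : cont_at (letter_r b).
Proof. by case: b; [exact: cont_cst|exact: (cont_letter false)]. Qed.

Lemma cont_word_val w : cont_at (word_val w).
Proof.
elim: w => [|b w IH]; first exact: cont_cst.
exact: (contM (cont_letter b) IH).
Qed.

Lemma cont_word_slice w (c : R -> A) : cont_at c -> cont_at (fun s => word_slice w s (c s)).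
Proof.
elim: w c => [|b w IH] c hc; first exact: cont_cst.
apply: contD; last exact: (IH _ (contM hc (cont_letter b))).
exact: (contZ (contM hc (cont_letter_l b)) (contM (cont_letter_r b) (cont_word_val w))).
Qed.

Lemma cont_word_contr w : cont_at (word_contr w).
Proof.
elim: w => [|b w IH]; first exact: cont_cst.
apply: contD; first exact: (contM (cont_letter b) IH).
exact: (contM (cont_letter_l b) (cont_word_slice w (cont_letter_r b))).
Qed.

Lemma word_derivative w :
  has_derivative (fun s => tau (word_val w s)) t (tau (word_contr w t) - ((size w)%:R / 2)%:C * tau (word_val w t)).
Proof.
apply: small_h_derivative => //.
have c2 : small_1 (fun s s' => tau (word_contr w s - word_contr w t)) := op_small_tau hA htau (cont_word_contr w).
have c1 : cont_at (fun s => (- ((size w)%:R / 2)%:C)%:A * word_val w s) := contM (cont_cst _) (cont_word_val w).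
have c3 := op_small_tau hA htau (contD (cont_word_contr w) c1).
apply: small_h_ext (small_hD (word_expansion w) (small_hM1 c3)) => s s' _ _.
rewrite -!(@scalerAl _ A) !mul1r (tauB tau) !(tauD tau) !(tauZ tau); ring.
Qed.

End WordDerivative.

(** * Derivatives of complex functions *)

Section Uniqueness.
Variable R : realType.
Implicit Types (f : R -> R[i]) (g : R -> R) (t : R).

Lemma has_derivative_le f t l (e : R) : has_derivative f t l -> 0 < e ->
  \forall h \near 0^', cabs (f (t + h) - f t - h%:C * l) <= e * `|h|.
Proof.
move=> /(@cvgrPdist_le _ (R[i]^o)) hf e0; have := hf e%:C; rewrite ltcR => /(_ e0) hf'.
near=> h.
have h0 : h != 0 by near: h; exact: nbhs_dnbhs_neq.
have : `|l - h%:C^-1 * (f (t + h) - f t)| <= e%:C by near: h.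
have hC : (h%:C : R[i]) != 0 by rewrite -(rmorph0 (real_complex R)) (inj_eq (@complexI R)).
have -> : l - h%:C^-1 * (f (t + h) - f t) = - (h%:C^-1 * (f (t + h) - f t - h%:C * l)).
  by rewrite [in RHS]mulrBr mulrA mulVf// mul1r opprB.
rewrite cabsE lecR cabsN cabsM -fmorphV cabs_real normrV ?unitfE// mulrC ler_pdivrMr// normr_gt0//.
Unshelve. all: by end_near.
Qed.

Lemma is_derive_le g t (l : R) :
  (forall e : R, 0 < e -> \forall h \near 0^', `|g (t + h) - g t - h * l| <= e * `|h|) -> is_derive t 1 g l.
Proof.
move=> hg.
have lim : h^-1 *: ((g \o shift t) (h *: (1 : R)) - g t) @[h --> 0^'] --> l.
  apply/cvgrPdist_le => e e0; have hg' := hg _ e0; near=> h.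
  have h0 : h != 0 by near: h; exact: nbhs_dnbhs_neq.
  have hh : `|g (t + h) - g t - h * l| <= e * `|h| by near: h.
  rewrite /= [h *: 1]mulr1 [h + t]addrC [_ *: _]/(_ * _).
  have -> : l - h^-1 * (g (t + h) - g t) = - (h^-1 * (g (t + h) - g t - h * l)) by field.
  by rewrite normrN normrM normrV ?unitfE// mulrC ler_pdivrMr ?normr_gt0.
by split; [apply/cvg_ex; exists l|exact: (cvg_lim (@Rhausdorff R) lim)].
Unshelve. all: by end_near.
Qed.

Lemma is_derive_Re f t l : has_derivative f t l -> is_derive t 1 (@complex.Re R \o f) (complex.Re l).
Proof.
move=> hf; apply: is_derive_le => e e0; have hf' := has_derivative_le hf e0.
apply: filterS hf' => h; apply: le_trans.
have alg (z w m : R[i]) : complex.Re z - complex.Re w - h * complex.Re m = complex.Re (z - w - h%:C * m).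
  by move: z w m => [? ?] [? ?] [? ?] /=; ring.
rewrite /= alg.
exact: cabs_ge_Re.
Qed.

Lemma is_derive_Im f t l : has_derivative f t l -> is_derive t 1 (@complex.Im R \o f) (complex.Im l).
Proof.
move=> hf; apply: is_derive_le => e e0; have hf' := has_derivative_le hf e0.
apply: filterS hf' => h; apply: le_trans.
have alg (z w m : R[i]) : complex.Im z - complex.Im w - h * complex.Im m = complex.Im (z - w - h%:C * m).
  by move: z w m => [? ?] [? ?] [? ?] /=; ring.
rewrite /= alg.
move: (_ - _ - _) => z; rewrite -(@ler_pXn2r _ 2) ?nnegrE ?cabs_ge0// cabs_sqr real_normK ?num_real//.
by rewrite lerDr sqr_ge0.
Qed.

(** |f|^2 has derivative - 2 lam |f|^2 <= 0, hence decreases on ]0, +oo[, and it tends to 0 at 0.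
    The initial condition enters as a limit because derivatives are available at positive times. *)
Lemma decay_unique f (lam : R) : 0 <= lam ->
  (forall t, 0 < t -> has_derivative f t (- lam%:C * f t)) ->
  (forall e : R, 0 < e -> exists2 d : R, 0 < d & forall s : R, 0 < s -> s < d -> cabs (f s) <= e) ->
  forall t, 0 < t -> f t = 0.
Proof.
move=> lam0 df f0 t t0; apply: cabs_eq0.
pose phi (s : R) := (@complex.Re R \o f) s * (@complex.Re R \o f) s + (@complex.Im R \o f) s * (@complex.Im R \o f) s.
have phiE s : phi s = cabs (f s) ^+ 2 by rewrite cabs_sqr !expr2.
have dphi (s : R) : 0 < s -> is_derive s 1 phi (- (2 * lam) * phi s).
  move=> s0; have dR := is_derive_Re (df s s0); have dI := is_derive_Im (df s s0).
  have h : is_derive s 1 phi _ := is_deriveD (is_deriveM dR dR) (is_deriveM dI dI).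
  apply: (is_derive_eq h); rewrite /GRing.scale /=.
  rewrite /phi /=; move: (f s) => [a b] /=; ring.
have dec (a b : R) : 0 < a -> a < b -> phi b <= phi a.
  move=> a0 ab; have [||c] := @MVT R phi (fun s => - (2 * lam) * phi s) a b ab.
  - by move=> x; rewrite in_itv /= => /andP[ax _]; apply: dphi; exact: lt_trans ax.
  - apply: derivable_within_continuous => x; rewrite in_itv /= => /andP[ax _].
    by have := dphi x (lt_le_trans a0 ax) => -[].
  rewrite in_itv /= => /andP[ac cb] e; rewrite -subr_le0 e mulNr mulNr oppr_le0.
  by rewrite mulr_ge0 ?subr_ge0 ?(ltW ab)// mulr_ge0 ?mulr_ge0// phiE sqr_ge0.
apply/eqP; rewrite -(@eqrXn2 _ 2) ?cabs_ge0// expr0n /= -phiE; apply/eqP/le_anti.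
rewrite {2}phiE sqr_ge0 andbT; apply/ler_addgt0Pl => e e0; rewrite addr0.
have m0 : 0 < Num.min 1 e by rewrite lt_min ltr01.
have [d d0 hd] := f0 _ m0.
pose s := Num.min (d / 2) (t / 2).
have s0 : 0 < s by rewrite lt_min !divr_gt0.
have sd : s < d by rewrite gt_min; apply/orP; left; lra.
have st : s < t by rewrite gt_min; apply/orP; right; lra.
apply: (le_trans (dec s t s0 st)); rewrite phiE.
have h := hd s s0 sd.
apply: (@le_trans _ _ (1 * e)); last by rewrite mul1r.
rewrite expr2; apply: ler_pM; rewrite ?cabs_ge0//; apply: (le_trans h); by rewrite ge_min lexx ?orbT.
Qed.

Let quot f t h := h%:C^-1 * (f (t + h) - f t).

Lemma complex_cvgD {F : set_system R} {FF : Filter F} (f f2 : R -> R[i]) (a b : R[i]) :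
  f x @[x --> F] --> (a : R[i]^o) -> f2 x @[x --> F] --> (b : R[i]^o) ->
  (f x + f2 x) @[x --> F] --> (a + b : R[i]^o).
Proof. exact: (@cvgD R[i] (R[i]^o)). Qed.

Lemma complex_cvgM {F : set_system R} {FF : Filter F} (f f2 : R -> R[i]) (a b : R[i]) :
  f x @[x --> F] --> (a : R[i]^o) -> f2 x @[x --> F] --> (b : R[i]^o) ->
  (f x * f2 x) @[x --> F] --> (a * b : R[i]^o).
Proof. exact: (@cvgM R[i]). Qed.

Lemma complex_cvg_cst {F : set_system R} {FF : Filter F} (a : R[i]) : a @[x --> F] --> (a : R[i]^o).
Proof. exact: (@cvg_cst (R[i]^o)). Qed.

Lemma has_derivative_ext f f2 t l l' : f =1 f2 -> l = l' -> has_derivative f t l -> has_derivative f2 t l'.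
Proof. by move=> /funext -> ->. Qed.

Lemma has_derivative_cst (c : R[i]) t : has_derivative (fun _ => c) t 0.
Proof.
rewrite /has_derivative (_ : (fun h : R => _) = fun=> 0); first exact: complex_cvg_cst.
by apply/funext => h; rewrite subrr mulr0.
Qed.

Lemma has_derivativeD f f2 t l l2 : has_derivative f t l -> has_derivative f2 t l2 ->
  has_derivative (fun s => f s + f2 s) t (l + l2).
Proof.
move=> h1 h2; have := @complex_cvgD _ (dnbhs_filter (0 : R)) (quot f t) (quot f2 t) _ _ h1 h2.
apply: cvg_trans; apply: near_eq_cvg; near=> h => /=.
by rewrite /quot; ring.
Unshelve. all: by end_near.
Qed.

Lemma cvg_real0 : h%:C @[h --> (0 : R)^'] --> (0 : R[i]^o).
Proof.
apply/(@cvgrPdist_le _ (R[i]^o)) => e e0.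
have eE : e = (complex.Re e)%:C by rewrite RRe_real// ger0_real// ltW.
rewrite eE ltcR in e0 *; near=> h.
rewrite sub0r normrN cabsE lecR cabs_real.
by near: h; apply: dnbhs0_le.
Unshelve. all: by end_near.
Qed.

Lemma has_derivativeM f f2 t l l2 : has_derivative f t l -> has_derivative f2 t l2 ->
  has_derivative (fun s => f s * f2 s) t (l * f2 t + f t * l2).
Proof.
move=> h1 h2.
have c2 : f2 (t + h) @[h --> (0 : R)^'] --> (f2 t : R[i]^o).
  have := @complex_cvgD _ (dnbhs_filter (0 : R)) _ _ _ _ (@complex_cvgM _ (dnbhs_filter (0 : R)) (real_complex R) (quot f2 t) _ _ cvg_real0 h2) (@complex_cvg_cst _ (dnbhs_filter (0 : R)) (f2 t)).
  rewrite mul0r add0r; apply: cvg_trans; apply: near_eq_cvg; near=> h => /=.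
  have h0 : h != 0 by near: h; exact: nbhs_dnbhs_neq.
  have hC : (h%:C : R[i]) != 0 by rewrite -(rmorph0 (real_complex R)) (inj_eq (@complexI R)).
  by rewrite mulrA mulfV// mul1r subrK.
have := @complex_cvgD _ (dnbhs_filter (0 : R)) _ _ _ _ (@complex_cvgM _ (dnbhs_filter (0 : R)) (quot f t) (fun h => f2 (t + h)) _ _ h1 c2) (@complex_cvgM _ (dnbhs_filter (0 : R)) (fun=> f t) (quot f2 t) _ _ (@complex_cvg_cst _ (dnbhs_filter (0 : R)) (f t)) h2).
apply: cvg_trans; apply: near_eq_cvg; near=> h => /=.
by rewrite /quot; ring.
Unshelve. all: by end_near.
Qed.

Lemma has_derivativeZ f t (c l : R[i]) : has_derivative f t l ->
  has_derivative (fun s => c * f s) t (c * l).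
Proof.
move=> h; apply: has_derivative_ext (has_derivativeM (has_derivative_cst c t) h) => //.
by rewrite mul0r add0r.
Qed.

End Uniqueness.

(** * Unitarity and the one-process moments *)

Section Unitarity.
Variables (R : realType) (A : algType R[i]) (star : A -> A)
  (H : completeNormedModType R[i]) (ip : {dot H for Num.conj}) (pi : A -> H -> H)
  (tau : {scalar A}).
Hypothesis hA : von_neumann_algebra star ip pi.
Hypothesis htau : faithful_normal_tracial_state star ip pi tau.
Implicit Types (b : bool) (w : seq bool).

Lemma word_val_near0 X U w (e : R) : free_unitary_brownian_motion star pi tau X U -> 0 < e ->
  exists2 d : R, 0 < d & forall s : R, 0 < s -> s < d -> op_bound pi e (word_val star U w s - 1).
Proof.
move=> hU; elim: w e => [|b w IH] e e0.
  by exists 1 => // s _ _ x; rewrite subrr (pi0 hA) normr0 mulr_ge0// ler0c ltW.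
have e2 : 0 < Num.min 1 (e / 4) by rewrite lt_min ltr01 divr_gt0.
set m := Num.min _ _ in e2.
have m1 : m <= 1 by rewrite /m ge_min lexx.
have m4 : m <= e / 4 by rewrite /m ge_min lexx orbT.
have [d1 d10 h1] := IH _ e2.
have [d2 d20 h2] := op_cont_at hA hU (lexx 0) e2.
exists (Num.min d1 d2); first by rewrite lt_min d10.
move=> s s0; rewrite lt_min => /andP[sd1 sd2].
have hl : op_bound pi m (letter star U b s - 1).
  have hu : op_bound pi m (U s - 1).
    rewrite -(fubm_0 hU); apply: h2 => //; first exact: ltW.
      by rewrite subr0 gtr0_norm.
    by rewrite subrr normr0.
  case: b => //=; rewrite -[X in _ - X](star1 hA) -(starN hA) -(starD hA).
  by apply: (op_bound_star hA) => //; exact: ltW.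
have hv := h1 s s0 sd1.
have -> : word_val star U (b :: w) s - 1 = (letter star U b s - 1) * (word_val star U w s - 1) + (letter star U b s - 1) + (word_val star U w s - 1).
  by rewrite /= mulrBr mulr1 addrNK mulrBl mul1r addrA subrK.
apply: (@op_bound_le _ _ _ _ (m * m + m + m)).
  have : m * m <= m * 1 by rewrite ler_wpM2l// ltW.
  by move: m1 m4; lra.
apply: (op_boundD hA) => //; apply: (op_boundD hA) => //.
by apply: (op_boundM hA) => //; exact: ltW.
Qed.

Lemma tau_word_val_near0 X U w (e : R) : free_unitary_brownian_motion star pi tau X U -> 0 < e ->
  exists2 d : R, 0 < d & forall s : R, 0 < s -> s < d -> cabs (tau (word_val star U w s) - 1) <= e.
Proof.
move=> hU e0; have e2 : 0 < e / 2 by lra.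
have [d d0 hd] := word_val_near0 w hU e2; exists d => // s s0 sd.
rewrite -{1}(tau1 htau) -(tauB tau); apply: (le_trans (cabs_tau_le hA htau _)).
by apply: (le_trans (n2_op_le hA htau e2 (hd s s0 sd))); lra.
Qed.

Lemma tau_word_val_const X U w : free_unitary_brownian_motion star pi tau X U ->
  (forall s : R, tau (word_contr star tau U w s) = ((size w)%:R / 2)%:C * tau (word_val star U w s)) ->
  forall t : R, 0 < t -> tau (word_val star U w t) = 1.
Proof.
move=> hU hQ t t0; apply/eqP; rewrite -subr_eq0; apply/eqP.
apply: (@decay_unique R (fun s => tau (word_val star U w s) - 1) 0) => //; last first.
  by move=> e e0; exact: tau_word_val_near0 hU e0.
move=> s s0; have h := @word_derivative _ _ _ _ _ _ _ hA htau X U hU s s0 w.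
rewrite hQ subrr in h.
apply: has_derivative_ext (has_derivativeD h (has_derivative_cst (- 1) s)) => //.
by rewrite rmorph0 oppr0 mul0r addr0.
Qed.

Let ii : 'i * 'i = -1 :> R[i].
Proof. by rewrite -expr2 sqr_i. Qed.

Section One.
Variables X U : R -> A.
Hypothesis hU : free_unitary_brownian_motion star pi tau X U.

Lemma tau_pair (t : R) : 0 < t -> tau (U t * star (U t)) = 1.
Proof.
move=> t0; have := @tau_word_val_const X U [:: true; false] hU _ t t0; rewrite /= mulr1; apply => s.
rewrite /= !(mulr0, add0r, addr0, mul1r, mulr1) (tauZ tau) (tau1 htau) mulr1 -(@scalerAr _ A) -(@scalerAl _ A) scalerA.
by rewrite mulNr ii opprK scale1r divff ?mul1r.
Qed.

(** The two adjacent pairs inside the factors U star U each give back the word, which balances the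
    drift 4/2. The four pairs across the factors each give tau (star U * U) tau (U * star U) with
    two signs + and two signs -, and cancel. *)
Lemma tau_quad (t : R) : 0 < t -> tau (U t * star (U t) * (U t * star (U t))) = 1.
Proof.
move=> t0; have := @tau_word_val_const X U [:: true; false; true; false] hU _ t t0.
rewrite /= mulr1 !mulrA; apply => s.
rewrite [_%:C](_ : _ = 1 + 1); last by rewrite -[4%N]/(2 * 2)%N natrM mulfK// rmorph_nat.
rewrite /= !(mulr0, add0r, addr0, mul1r, mulr1).
do 6! rewrite ?(mulrDl, mulrDr, scalerDr, tauD tau, tauZ tau) -?(@scalerAr _ A) -?(@scalerAl _ A) ?mul1r ?mulr1.
rewrite (tau1 htau) !mulrA ?mulr1.
move: (tau _) (tau _) (tau _) => p q r; apply/eqP; rewrite -subr_eq0.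
rewrite [X in X == 0](_ : _ = - ('i * 'i + 1) * (r + r)); last by ring.
by rewrite ii addNr oppr0 mul0r.
Qed.

Lemma fubm_unitary (t : R) : 0 < t -> U t * star (U t) = 1 /\ star (U t) * U t = 1.
Proof.
move=> t0; have p2 := tau_pair t0; have p4 := tau_quad t0.
have key (a : A) : star a = a -> tau a = 1 -> tau (a * a) = 1 -> a = 1.
  move=> sa ta taa; apply/eqP; rewrite -subr_eq0; apply/eqP; apply: (tr_faithful htau).
  rewrite (starD hA) (starN hA) sa (star1 hA) mulrBr mulrBl mul1r mulr1 !(tauB tau).
  by rewrite taa ta (tau1 htau) !subrr.
split; apply: key.
- by rewrite (starM hA) (starK hA).
- by [].
- by [].
- by rewrite (starM hA) (starK hA).
- by rewrite (tauC htau).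
- by rewrite -mulrA (tauC htau) !mulrA in p4 *; rewrite -p4 -!mulrA (tauC htau) !mulrA.
Qed.

Lemma word_val_nseq n t : word_val star U (nseq n true) t = U t ^+ n.
Proof. by elim: n => [|n IH] /=; rewrite ?expr0// IH exprS. Qed.

End One.

Section Two.
Variables X U X' U' : R -> A.
Hypothesis hU : free_unitary_brownian_motion star pi tau X U.
Hypothesis hU' : free_unitary_brownian_motion star pi tau X' U'.

Lemma word_slice_nseq_eq N n r q t : (forall g, (g < N)%N -> tau (U t ^+ g) = tau (U' t ^+ g)) ->
  (q + n < N)%N -> (r + n <= N)%N ->
  tau (U t ^+ r * word_slice star tau U (nseq n true) t (U t ^+ q)) =
  tau (U' t ^+ r * word_slice star tau U' (nseq n true) t (U' t ^+ q)).
Proof.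
move=> heq; elim: n q => [|n IH] q qN rN /=; first by rewrite !mulr0.
rewrite !mulrDr !(tauD tau) -!exprSr IH; [|lia|lia]; congr (_ + _).
rewrite !word_val_nseq !mul1r -!(@scalerAr _ A) !(tauZ tau) -!exprSr -!exprD !heq//; lia.
Qed.

Lemma word_contr_nseq_eq N n r t : (forall g, (g < N)%N -> tau (U t ^+ g) = tau (U' t ^+ g)) ->
  (r + n <= N)%N ->
  tau (U t ^+ r * word_contr star tau U (nseq n true) t) = tau (U' t ^+ r * word_contr star tau U' (nseq n true) t).
Proof.
move=> heq; elim: n r => [|n IH] r rN /=; first by rewrite !mulr0.
rewrite !mulrDr !(tauD tau) !mulrA -!exprSr IH; [|lia]; congr (_ + _).
rewrite -!(@scalerAr _ A) -!(@scalerAl _ A) !(tauZ tau) -!exprSr.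
have k := @word_slice_nseq_eq N n r.+1 0 t heq; rewrite !expr0 in k.
by rewrite k//; lia.
Qed.

(** A contraction in U^n splits it into an inner and an outer power, both of order less than n,
    where the two processes agree by induction. The difference of the n-th moments thus solves f' =
    - (n/2) f and vanishes at 0. *)
Lemma moments_eq n t : 0 < t -> tau (U t ^+ n) = tau (U' t ^+ n).
Proof.
elim/ltn_ind: n t => n IH t t0; apply/eqP; rewrite -subr_eq0; apply/eqP.
apply: (@decay_unique R (fun s => tau (U s ^+ n) - tau (U' s ^+ n)) (n%:R / 2)) => //.
- move=> s s0.
  have h := @word_derivative _ _ _ _ _ _ _ hA htau X U hU s s0 (nseq n true).
  have h' := @word_derivative _ _ _ _ _ _ _ hA htau X' U' hU' s s0 (nseq n true).
  have h2 := @has_derivativeZ _ _ s (-1) _ h'.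
  apply: has_derivative_ext (has_derivativeD h h2).
    by move=> r; rewrite !word_val_nseq mulN1r.
  have := @word_contr_nseq_eq n n 0 s (fun g gn => IH g gn s s0) (leqnn _).
  by rewrite !expr0 !mul1r => ->; rewrite !word_val_nseq size_nseq; ring.
- move=> e e0; have e2 : 0 < e / 2 by lra.
  have [d d0 h] := tau_word_val_near0 (nseq n true) hU e2.
  have [d' d0' h'] := tau_word_val_near0 (nseq n true) hU' e2.
  exists (Num.min d d'); first by rewrite lt_min d0.
  move=> s s0; rewrite lt_min => /andP[sd sd'].
  have -> : tau (U s ^+ n) - tau (U' s ^+ n) = (tau (U s ^+ n) - 1) - (tau (U' s ^+ n) - 1).
    by ring.
  rewrite -!word_val_nseq (le_trans (cabsD _ _))// cabsN.
  have := lerD (h s s0 sd) (h' s s0 sd'); have -> // : e / 2 + e / 2 = e by lra.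
Qed.

Lemma word_moments_eq w t : 0 < t -> tau (word_val star U w t) = tau (word_val star U' w t).
Proof.
move=> t0; have [u1 u2] := fubm_unitary hU t0; have [v1 v2] := fubm_unitary hU' t0.
(* By unitarity neighbouring letters U and star U cancel, so a word reduces to a power of a single
   letter, by the same cancellations for both processes. *)
have [b [n [-> ->]]] : exists b n, word_val star U w t = letter star U b t ^+ n /\ word_val star U' w t = letter star U' b t ^+ n.
  elim: w => [|c w [b [n [IH IH']]]]; first by exists true, 0%N; rewrite !expr0.
  have [bc|bc] := eqVneq b c.
    by subst; exists c, n.+1; rewrite /= IH IH' !exprS.
  case: n IH IH' => [|n] IH IH'; first by exists c, 1%N; rewrite /= IH IH' expr0 !mulr1 !expr1.
  exists b, n; rewrite /= IH IH' !exprS !mulrA.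
  by case: b c bc {IH IH'} => [] [] //= _; rewrite ?u1 ?u2 ?v1 ?v2 !mul1r.
have starX (a : A) m : star a ^+ m = star (a ^+ m).
  elim: m => [|m IHm]; first by rewrite !expr0 (star1 hA).
  by rewrite exprSr exprS IHm (starM hA).
case: b => /=; first exact: moments_eq.
by rewrite !starX !(tau_star hA htau) (moments_eq n t0).
Qed.

End Two.
End Unitarity.

(** * Jets of free families *)

Section FreeJets.
Variables (R : realType) (A : algType R[i]) (star : A -> A)
  (H : completeNormedModType R[i]) (ip : {dot H for Num.conj}) (pi : A -> H -> H)
  (tau : {scalar A}).
Hypothesis htau : faithful_normal_tracial_state star ip pi tau.
Variables (I : finType) (S : I -> set A).
Hypothesis free : star_free star tau S.
Local Notation SA i := (star_alg star (S i)).
Local Notation ac := (alternating_centred star tau S).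
Local Notation jet := (jet A I).
Local Notation jmul := (jmul tau).
Local Notation slice := (slice tau).

Lemma ac_catl L L' : ac (L ++ L') -> ac L.
Proof.
elim: L => //= p L IH [h1 h2 h3 h4]; split => //; last exact: IH.
by case: L h3 {IH h4}.
Qed.

Lemma ac_catr L L' : ac (L ++ L') -> ac L'.
Proof. by elim: L => //= p L IH [_ _ _ h4]; exact: IH. Qed.

Lemma ac_rcons p L q : ac (p :: L) -> (last p L).1 <> q.1 -> SA q.1 q.2 -> tau q.2 = 0 ->
  ac (rcons (p :: L) q).
Proof.
elim: L p => [|p' L IH] p /= [h1 h2 h3 h4] h h5 h6; first by split.
by split => //; apply: IH.
Qed.

Lemma ac_last p P q L : ac (p :: P ++ q :: L) -> (last p P).1 <> q.1.
Proof.
elim: P p => [|p' P IH] p /=; first by case.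
by case=> _ _ _; exact: IH.
Qed.

Lemma sa_cent i a : SA i a -> SA i (a - (tau a)%:A).
Proof. by move=> ha; apply: sa_B => //; apply: sa_Z; exact: sa_1. Qed.

Lemma tau_cent a : tau (a - (tau a)%:A) = 0.
Proof. by rewrite (tauB tau) (tauZ tau) (tau1 htau) mulr1 subrr. Qed.

(** [y] and [z] are arbitrary in their algebras: writing each as its centred part plus a scalar
    gives four words, all alternating and centred. The indices j and j' may coincide. *)
Lemma free_ends j j' y z p L : ac (p :: L) -> p.1 <> j -> (last p L).1 <> j' ->
  SA j y -> SA j' z -> tau (y * vprod (p :: L) * z) = 0.
Proof.
move=> hac pj lj hy hz.
have fw := star_free_words free.
have e0 : tau (vprod (p :: L)) = 0 by exact: fw.
have er : tau (vprod (rcons (p :: L) (j', z - (tau z)%:A))) = 0.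
  apply: fw => //; apply: ac_rcons => //=; [exact: sa_cent|exact: tau_cent].
have el : tau (vprod ((j, y - (tau y)%:A) :: p :: L)) = 0.
  apply: fw => //; split => //=; [exact: sa_cent|exact: tau_cent|by move=> e; apply: pj].
have elr : tau (vprod ((j, y - (tau y)%:A) :: rcons (p :: L) (j', z - (tau z)%:A))) = 0.
  apply: fw => //; split => //=; [exact: sa_cent|exact: tau_cent|by move=> e; apply: pj|].
  by apply: (@ac_rcons p L) => //=; [exact: sa_cent|exact: tau_cent].
have vr i q : vprod (rcons (p :: L) (i, q)) = vprod (p :: L) * q.
  by rewrite -cats1 vprod_cat /= mulr1.
have vl i q K : vprod ((i, q : A) :: K) = q * vprod K by [].
rewrite vl vr in elr; rewrite vr in er; rewrite vl in el.
move: (vprod (p :: L)) e0 er el elr => v e0 er el.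
rewrite mulrBl (tauB tau) -(@scalerAl _ A) mul1r (tauZ tau) er mulr0 subr0.
rewrite mulrBr mulrBr (tauB tau) -!(@scalerAr _ A) mulr1 (tauZ tau).
have -> : tau (y * v) = 0.
  by move: el; rewrite mulrBl (tauB tau) -(@scalerAl _ A) mul1r (tauZ tau) e0 mulr0 subr0.
by rewrite mulr0 subr0 mulrA.
Qed.

Definition jet_in (i : I) (J : jet) :=
  [/\ SA i (jv J), SA i (jq J), forall j, j != i -> jd J j = [::] &
      forall p, p \in jd J i -> SA i p.1 /\ SA i p.2].

Definition jprod (L : seq (I * jet)) : jet := foldr (fun p => jmul p.2) (jone A I) L.

Definition values (L : seq (I * jet)) := [seq (p.1, jv p.2) | p <- L].

Lemma jv_jprod L : jv (jprod L) = vprod (values L).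
Proof. by elim: L => //= p L ->. Qed.

Fixpoint all_in (L : seq (I * jet)) : Prop :=
  if L is p :: L' then jet_in p.1 p.2 /\ all_in L' else True.

Lemma slice_zero c d : (forall p, p \in d -> tau (c * p.1) = 0) -> slice c d = 0.
Proof. by move=> h; rewrite /slice big_seq big1// => p pd; rewrite h// scale0r. Qed.

(** [p :: P] stands between the two contracted letters. As blocks of equal index are never
    neighbours, it is a nonempty alternating centred product, and [free_ends] makes the inner trace
    0. *)
Lemma slice_later j y p P L : ac (p :: P ++ values L) -> all_in L -> p.1 <> j -> SA j y ->
  slice (y * vprod (p :: P)) (jd (jprod L) j) = 0.
Proof.
elim: L P => [|a L IH] P /= hac; first by move=> _ _ _; exact: slice_nil.
move=> [[a1 a2 a3 a4] hL] pj hy.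
rewrite slice_cat slice_mulr slice_mull.
have -> : y * (p.2 * foldr (fun p a => p.2 * a) 1 P) * jv a.2 = y * vprod (p :: rcons P (a.1, jv a.2)).
  by rewrite -[p :: rcons _ _]/(rcons (p :: P) _) -cats1 vprod_cat /= mulr1 !mulrA.
rewrite IH //; last by rewrite -[p :: _]/(p :: (rcons P _ ++ _)) cat_rcons.
rewrite addr0 slice_zero ?mul0r // => q qa.
have [aj|aj] := eqVneq j a.1; last by rewrite a3 in qa.
subst j; have [q1 q2] := a4 _ qa.
have hac' : ac (p :: P) by apply: (@ac_catl (p :: P) ((a.1, jv a.2) :: values L)).
apply: (@free_ends a.1 a.1) => //.
exact: (@ac_last p P (a.1, jv a.2) (values L)).
Qed.

(** What is left when only letters of the same block contract: freeness replaces the second order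
    term of that block by its trace, times the trace of the product with the block removed. *)
Fixpoint diag_sum (a : A) (L : seq (I * jet)) : R[i] :=
  if L is p :: L' then tau (jq p.2) * tau (a * jv (jprod L')) + diag_sum (a * jv p.2) L' else 0.

Lemma ac_insert P i q L : (forall a, SA i a -> tau a = 0 -> ac (P ++ (i, a) :: L)) -> SA i q ->
  tau (vprod P * q * vprod L) = tau q * tau (vprod P * vprod L).
Proof.
move=> h hq; have := star_free_words free (L := P ++ (i, q - (tau q)%:A) :: L).
rewrite vprod_cat /= => /(_ _ _) h0.
have e : tau (vprod P * ((q - (tau q)%:A) * vprod L)) = 0.
  apply: h0; first by case: P {h}.
  by apply: h; [exact: sa_cent|exact: tau_cent].
move: e; rewrite mulrBl -(@scalerAl _ A) mul1r mulrBr -(@scalerAr _ A) (tauB tau) (tauZ tau) => /eqP.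
by rewrite subr_eq0 mulrA => /eqP.
Qed.

Lemma ac_subst P i a b L : ac (P ++ (i, a) :: L) -> SA i b -> tau b = 0 -> ac (P ++ (i, b) :: L).
Proof.
elim: P => [|p P IH] /=; first by case=> _ _ h3 h4 hb tb; split.
case=> h1 h2 h3 h4 hb tb; split => //; last exact: IH.
by case: P h3 {IH h4}.
Qed.

(* Freeness kills the contractions between different blocks. *)
Lemma tau_jq_jprod P L : ac (P ++ values L) -> all_in L ->
  tau (vprod P * jq (jprod L)) = diag_sum (vprod P) L.
Proof.
elim: L P => [|a L IH] P hac /=; first by rewrite mulr0 (tau0 tau).
move=> [ha hL]; have [a1 a2 a3 a4] := ha.
rewrite !mulrDr !(tauD tau).
have -> : tau (vprod P * (jq a.2 * jv (jprod L))) = tau (jq a.2) * tau (vprod P * jv (jprod L)).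
  rewrite jv_jprod mulrA; apply: (@ac_insert _ a.1) => // b hb tb.
  exact: (ac_subst hac).
have -> : contr tau (jd a.2) (jd (jprod L)) = 0.
  rewrite /contr big1// => j _; rewrite big_seq big1// => p pa.
  have [ja|ja] := eqVneq j a.1; last by rewrite a3 in pa.
  subst j; have [_ p2] := a4 _ pa.
  case: L {IH} hac hL => [|a' L] hac hL /=; first by rewrite slice_nil mulr0.
  have [[b1 b2 b3 b4] hL'] := hL.
  have aa' : a.1 <> a'.1.
    by move: (ac_catr hac) => /= [].
  rewrite slice_cat slice_mulr slice_mull b3; last by apply/eqP.
  rewrite slice_nil mul0r add0r.
  have -> : p.2 * jv a'.2 = p.2 * vprod [:: (a'.1, jv a'.2)] by rewrite /= mulr1.
  rewrite slice_later ?mulr0 //.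
    by move: (ac_catr hac) => /= [].
  by move=> e; apply: aa'.
rewrite mulr0 (tau0 tau) addr0; congr (_ + _).
have -> : vprod P * (jv a.2 * jq (jprod L)) = vprod (rcons P (a.1, jv a.2)) * jq (jprod L).
  by rewrite -cats1 vprod_cat /= mulr1 !mulrA.
rewrite IH ?cat_rcons//; congr diag_sum.
by rewrite -cats1 vprod_cat /= mulr1.
Qed.

End FreeJets.

(** * Blocks of a word and the recursion given by centring *)

Section Blocks.
Variables (R : realType) (I : finType).
Local Notation word := (seq (I * bool)).

Fixpoint block_decomp (B : seq (I * word)) : Prop :=
  if B is p :: B' then
    [/\ p.2 <> [::], all (fun l => l.1 == p.1) p.2,
        (if B' is p' :: _ then p.1 <> p'.1 else True) & block_decomp B']
  else True.

Lemma block_decomp_ex (w : word) : exists2 B, block_decomp B & flatten (map snd B) = w.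
Proof.
elim: w => [|l w [B hB eB]]; first by exists [::].
case: B hB eB => [|[i b] B] hB eB.
  by exists [:: (l.1, [:: l])]; rewrite /= -?eB //= eqxx.
have [il|il] := eqVneq i l.1.
  exists ((i, l :: b) :: B); last by rewrite -eB.
  by case: hB => h1 h2 h3 h4; split => //=; rewrite il eqxx -il.
exists ((l.1, [:: l]) :: (i, b) :: B); last by rewrite -eB.
by split => //=; [rewrite eqxx|move=> e; move/eqP: il; apply].
Qed.

(* cext extends a functional on words to the products of the b - c b, b in L,
   preceded by the word pre; cext_deriv is its derivative when the functional
   and c vary with derivatives dG and dc. *)
Fixpoint cext (G c : word -> R[i]) (pre : word) (L : seq word) : R[i] :=
  if L is b :: L' then cext G c (pre ++ b) L' - c b * cext G c pre L' else G pre.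

Fixpoint cext_deriv (G dG c dc : word -> R[i]) (pre : word) (L : seq word) : R[i] :=
  if L is b :: L' then cext_deriv G dG c dc (pre ++ b) L' -
    (dc b * cext G c pre L' + c b * cext_deriv G dG c dc pre L')
  else dG pre.

(** The product of the centred blocks is the full word plus terms in strictly shorter words;
    subtracting the full word leaves data known by induction on the length. *)
Lemma cext_agree n G G' pre L : (forall w, (size w < n)%N -> G w = G' w) ->
  all (fun b => (0 < size b < n)%N) L -> (size pre + size (flatten L) <= n)%N ->
  cext G G pre L - G (pre ++ flatten L) = cext G' G' pre L - G' (pre ++ flatten L).
Proof.
move=> GG; elim: L pre => [|b L IH] pre /=; first by rewrite cats0 !subrr.
move=> /andP[/andP[b0 bn] hL]; rewrite size_cat => hn.
have small : cext G G pre L = cext G' G' pre L.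
  have := IH pre hL _; rewrite GG; last by rewrite size_cat; lia.
  by move=> /(_ ltac:(lia)) /(addIr _).
have := IH (pre ++ b) hL; rewrite size_cat -addnA => /(_ hn); rewrite -!catA => e.
by rewrite small (GG _ bn) addrAC [RHS]addrAC e.
Qed.

(** The first conclusion, for total length below n, feeds the subtracted factors of the induction;
    the second, for length n, removes the top word, whose differentiability is not yet known. *)
Lemma cext_has_derivative n (G : R -> word -> R[i]) (dG : word -> R[i]) (t : R) :
  (forall w, (size w < n)%N -> has_derivative (fun s => G s w) t (dG w)) ->
  forall L pre, all (fun b => (0 < size b < n)%N) L -> 
  ((size pre + size (flatten L) < n)%N ->
    has_derivative (fun s => cext (G s) (G s) pre L) t (cext_deriv (G t) dG (G t) dG pre L)) /\
  ((size pre + size (flatten L) <= n)%N ->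
    has_derivative (fun s => cext (G s) (G s) pre L - G s (pre ++ flatten L)) t
      (cext_deriv (G t) dG (G t) dG pre L - dG (pre ++ flatten L))).
Proof.
move=> hG; elim=> [|b L IH] pre /=.
  move=> _; rewrite !cats0 addn0; split; first exact: hG.
  move=> _; apply: has_derivative_ext (has_derivative_cst 0 t) => [s|]; by rewrite subrr.
move=> /andP[/andP[b0 bn] hL]; rewrite size_cat.
have [IH1 IH2] := IH pre hL; have [IH3 IH4] := IH (pre ++ b) hL.
rewrite size_cat -!addnA -!catA in IH3 IH4.
have prod : (size pre + size (flatten L) < n)%N -> has_derivative (fun s => (-1) * (G s b * cext (G s) (G s) pre L)) t
    ((-1) * (dG b * cext (G t) (G t) pre L + G t b * cext_deriv (G t) dG (G t) dG pre L)).
  by move=> h; apply: has_derivativeZ; apply: has_derivativeM; [exact: hG|exact: IH1].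
split=> hn.
  have hlt : (size pre + size (flatten L) < n)%N by lia.
  apply: has_derivative_ext (has_derivativeD (IH3 hn) (prod hlt)) => [s|]; by rewrite mulN1r.
have hlt : (size pre + size (flatten L) < n)%N by lia.
apply: has_derivative_ext (has_derivativeD (IH4 hn) (prod hlt)) => [s|]; by rewrite mulN1r addrAC.
Qed.

End Blocks.

(** * Joint moments and their candidate derivatives *)

Section Joint.
Variables (R : realType) (A : algType R[i]) (star : A -> A)
  (H : completeNormedModType R[i]) (ip : {dot H for Num.conj}) (pi : A -> H -> H)
  (tau : {scalar A}).
Hypothesis htau : faithful_normal_tracial_state star ip pi tau.
Variable I : finType.
Local Notation word := (seq (I * bool)).
Local Notation jmul := (jmul tau).
Local Notation jword := (jword star tau).

Definition moment (u : I -> A) (w : word) : R[i] := tau (jv (jword u w)).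
Definition moment_deriv (u : I -> A) (w : word) : R[i] := tau (jq (jword u w)).

Section Fixed.
Variables (S : I -> set A) (u : I -> A).
Hypothesis free : star_free star tau S.
Hypothesis uS : forall i, S i (u i).

Definition item (i : I) (b : word) : I * jet A I := (i, jsub (jword u b) (moment u b)).

Lemma jword_in i (b : word) : all (fun l => l.1 == i) b -> jet_in star S i (jword u b).
Proof.
have ui : star_alg star (S i) (u i) by exact: sa_sub.
elim: b => [|l b IH] /=.
  move=> _; split => //; [exact: sa_1|exact: sa_0].
move=> /andP[/eqP li hb]; have [h1 h2 h3 h4] := IH hb.
have lv : star_alg star (S i) (jv (jletter star u l)).
  by rewrite /jletter; case: ifP => _ /=; rewrite li => //; exact: sa_star.
have lq : star_alg star (S i) (jq (jletter star u l)).
  by rewrite /jletter; case: ifP => _ /=; rewrite li; apply: sa_Z => //; exact: sa_star.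
have ld p : p \in jd (jletter star u l) i -> star_alg star (S i) p.1 /\ star_alg star (S i) p.2.
  rewrite /jletter; case: ifP => _ /=; rewrite li eqxx inE => /eqP -> /=.
    by split; [exact: sa_Z|exact: sa_1].
  by split; [apply: sa_Z; exact: sa_1|exact: sa_star].
split => /=.
- exact: sa_M.
- apply: sa_D; first by apply: sa_D; exact: sa_M.
  apply: sa_sum => j; rewrite /slice.
  have [->|ji] := eqVneq j i; last first.
    rewrite (_ : jd (jletter star u l) j = [::]) ?big_nil; first exact: sa_0.
    by rewrite /jletter; case: ifP => _ /=; rewrite li (negPf ji).
  rewrite big_seq; apply: big_ind => [|x y|p pl]; [exact: sa_0|exact: sa_D|].
  apply: sa_M; first by have [] := ld p pl.
  rewrite big_seq; apply: big_ind => [|x y|q ql]; [exact: sa_0|exact: sa_D|].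
  by apply: sa_Z; have [] := h4 q ql.
- move=> j ji; rewrite (h3 j ji) /= cats0.
  rewrite (_ : jd (jletter star u l) j = [::]) //.
  by rewrite /jletter; case: ifP => _ /=; rewrite li (negPf ji).
- move=> p; rewrite mem_cat => /orP[] /mapP[q qi ->] /=.
    by have [q1 q2] := ld q qi; split => //; exact: sa_M.
  by have [q1 q2] := h4 q qi; split => //; exact: sa_M.
Qed.

Lemma items_ok B : block_decomp B ->
  alternating_centred star tau S (values [seq item p.1 p.2 | p <- B]) /\
  all_in star S [seq item p.1 p.2 | p <- B].
Proof.
elim: B => //= p B IH [h1 h2 h3 h4]; have [i1 i2] := IH h4.
have [j1 j2 j3 j4] := jword_in h2; split; split => //.
- by apply: sa_B => //; apply: sa_Z; exact: sa_1.
- by rewrite /= (tauB tau) (tauZ tau) (tau1 htau) mulr1 subrr.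
- by case: B h3 {IH h4 i1 i2}.
- by split => //=; apply: sa_B => //; apply: sa_Z; exact: sa_1.
Qed.

Lemma cext_moment pre B : cext (moment u) (moment u) pre (map snd B) =
  tau (jv (jword u pre) * jv (jprod tau [seq item p.1 p.2 | p <- B])).
Proof.
elim: B pre => [|[i b] B IH] pre /=; first by rewrite mulr1.
rewrite !IH jword_cat /= mulrBl -(@scalerAl _ A) mul1r mulrBr -(@scalerAr _ A) (tauB tau) (tauZ tau).
by rewrite !mulrA.
Qed.

Lemma diag_sumB (z : R[i]) (a c : A) (L : seq (I * jet A I)) : diag_sum tau (a - z *: c) L = diag_sum tau a L - z * diag_sum tau c L.
Proof.
elim: L a c => [|p L IH] a c /=; first by rewrite mulr0 subr0.
rewrite !mulrBl -!(@scalerAl _ A) IH (tauB tau) (tauZ tau); ring.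
Qed.

(** The jets of [item] hold the centring constants fixed; [diag_sum] is exactly the contribution of
    their derivatives. *)
Lemma cext_deriv_moment pre B :
  cext_deriv (moment u) (moment_deriv u) (moment u) (moment_deriv u) pre (map snd B) =
  tau (jq (jmul (jword u pre) (jprod tau [seq item p.1 p.2 | p <- B]))) -
  diag_sum tau (jv (jword u pre)) [seq item p.1 p.2 | p <- B].
Proof.
elim: B pre => [|[i b] B IH] pre.
  rewrite [map _ _]/= [jprod _ _]/= [diag_sum _ _ _]/= subr0 /moment_deriv.
  by rewrite -[jone A I]/(jword u [::]) -jword_cat cats0.
set JL := jprod tau [seq item p.1 p.2 | p <- B] in IH *.
have eJ : jprod tau [seq item p.1 p.2 | p <- (i, b) :: B] = jmul (jsub (jword u b) (moment u b)) JL by [].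
have eD a : diag_sum tau a [seq item p.1 p.2 | p <- (i, b) :: B] =
    moment_deriv u b * tau (a * jv JL) +
    diag_sum tau (a * (jv (jword u b) - (moment u b)%:A)) [seq item p.1 p.2 | p <- B] by [].
have eE (a v : A) (z : R[i]) (L : seq (I * jet A I)) : diag_sum tau (a * (v - z%:A)) L = diag_sum tau (a * v) L - z * diag_sum tau a L.
  by rewrite mulrBr -(@scalerAr _ A) mulr1 diag_sumB.
have -> : [seq p.2 | p <- (i, b) :: B] = b :: [seq p.2 | p <- B] by [].
have eC G dG c dc q L : cext_deriv G dG c dc q (b :: L) = cext_deriv G dG c dc (q ++ b) L -
    (dc b * cext G c q L + c b * cext_deriv G dG c dc q L) by [].
rewrite eC !IH cext_moment -/JL eJ eD jq_mul_jsub (tauB tau) (tauZ tau) jword_cat -jmulA.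
rewrite eE.
have -> : jv (jmul (jword u pre) (jword u b)) = jv (jword u pre) * jv (jword u b) by [].
ring.
Qed.

Lemma cext_moment_eq0 B : block_decomp B -> B <> [::] -> cext (moment u) (moment u) [::] (map snd B) = 0.
Proof.
move=> hB B0; have [h1 h2] := items_ok hB.
rewrite cext_moment mul1r jv_jprod; apply: (star_free_words free) => //.
by case: B {hB h1 h2} B0.
Qed.

(** The differentiated freeness relation: by [tau_jq_jprod] the two terms of [cext_deriv_moment]
    coincide. The candidate [moment_deriv] thus obeys the same recursion as a true derivative. *)
Lemma cext_deriv_moment_eq0 B : block_decomp B ->
  cext_deriv (moment u) (moment_deriv u) (moment u) (moment_deriv u) [::] (map snd B) = 0.
Proof.
move=> hB; have [h1 h2] := items_ok hB.
rewrite cext_deriv_moment [jword _ _]/= jmul1.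
have := @tau_jq_jprod _ _ star _ _ _ tau htau I S free [::] _ h1 h2.
by rewrite [vprod _]/= mul1r => ->; rewrite subrr.
Qed.

End Fixed.

Lemma blocks_small (B : seq (I * word)) : block_decomp B -> (1 < size B)%N ->
  all (fun b => (0 < size b < size (flatten (map snd B)))%N) (map snd B).
Proof.
move=> hB B1.
have pos C : block_decomp C -> all (fun b : word => (0 < size b)%N) (map snd C).
  elim: C => //= p C IH [h1 _ _ h4]; rewrite IH // andbT.
  by case: (p.2) h1.
have bound (L : seq word) : all (fun b : word => (0 < size b)%N) L -> (1 < size L)%N ->
    all (fun b => (0 < size b < size (flatten L))%N) L.
  move=> hL L1; apply/allP => b bL; have /allP/(_ b bL) -> := hL; rewrite /=.
  have [i iL <-] := nthP [::] bL.
  rewrite size_flatten /shape sumnE big_map (big_nth [::]) big_mkord.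
  rewrite (bigD1 (Ordinal iL)) //= -[X in (X < _)%N]addn0 ltn_add2l.
  have : exists j : 'I_(size L), j != Ordinal iL.
    case: i iL => [|i] iL; first by exists (Ordinal L1).
    by exists (Ordinal (ltnW L1)).
  move=> [j ji]; rewrite (bigD1 j) //=.
  by have /allP/(_ _ (mem_nth [::] (ltn_ord j))) := hL; rewrite addn_gt0 => ->.
by apply: bound; [exact: pos|rewrite size_map].
Qed.

(** With at least two blocks, the vanishing of the centred product expresses the moment of a word
    through shorter words; words with a single block are the hypothesis. *)
Lemma moment_eq (S S' : I -> set A) (u u' : I -> A) : star_free star tau S -> star_free star tau S' ->
  (forall i, S i (u i)) -> (forall i, S' i (u' i)) ->
  (forall i w, all (fun l => l.1 == i) w -> moment u w = moment u' w) ->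
  forall w, moment u w = moment u' w.
Proof.
move=> fS fS' uS uS' h w; have [n] := ubnP (size w); elim: n w => // n IH w; rewrite ltnS => wn.
have [B hB eB] := block_decomp_ex w.
case: B hB eB => [|p [|q B]] hB eB.
- by rewrite -eB /moment.
- by case: hB => _ hp _ _; rewrite -eB /= cats0; exact: (h p.1).
have hs := blocks_small hB isT; rewrite eB in hs.
have agree w' : (size w' < size w)%N -> moment u w' = moment u' w'.
  by move=> hw; apply: IH; exact: leq_trans hw wn.
have := cext_agree (pre := [::]) agree hs; rewrite add0n eB => /(_ (leqnn _)).
rewrite (cext_moment_eq0 fS uS hB) // (cext_moment_eq0 fS' uS' hB) // !sub0r.
by move/oppr_inj.
Qed.

End Joint.

Section JointProcess.
Variables (R : realType) (A : algType R[i]) (star : A -> A)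
  (H : completeNormedModType R[i]) (ip : {dot H for Num.conj}) (pi : A -> H -> H)
  (tau : {scalar A}).
Hypothesis hA : von_neumann_algebra star ip pi.
Hypothesis htau : faithful_normal_tracial_state star ip pi tau.
Variable I : finType.
Local Notation word := (seq (I * bool)).
Local Notation jmul := (jmul tau).
Local Notation jword := (jword star tau).
Local Notation moment := (moment star tau).
Local Notation moment_deriv := (moment_deriv star tau).
Variables X U : I -> R -> A.
Hypothesis hU : forall i, free_unitary_brownian_motion star pi tau (X i) (U i).
Let S i : set A := [set U i t | t in [set t : R | 0 <= t]].
Hypothesis free : star_free star tau S.

Lemma jword_single i (w : word) t : all (fun l => l.1 == i) w ->
  [/\ jv (jword (U^~ t) w) = word_val star (U i) (map snd w) t,
      forall c, slice tau c (jd (jword (U^~ t) w) i) = word_slice star tau (U i) (map snd w) t c &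
      jq (jword (U^~ t) w) = word_contr star tau (U i) (map snd w) t -
        ((size w)%:R / 2)%:C *: word_val star (U i) (map snd w) t].
Proof.
elim: w => [|[j b] w IH] /=.
  move=> _; split => //; first by move=> c; exact: slice_nil.
  by rewrite mul0r scale0r subr0.
move=> /andP[/eqP ji hw]; rewrite {}ji; have [h1 h2 h3] := IH hw.
have lv : jv (jletter star (U^~ t) (i, b)) = letter star (U i) b t by case: b.
have ld : jd (jletter star (U^~ t) (i, b)) i = [:: (letter_l (U i) b t, letter_r star (U i) b t)].
  by rewrite /jletter /letter_l /letter_r; case: (b); rewrite /= eqxx.
have ld' j' : j' != i -> jd (jletter star (U^~ t) (i, b)) j' = [::].
  by move=> ne; rewrite /jletter /= fun_if; case: (b); rewrite /= (negPf ne).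
have lq : jq (jletter star (U^~ t) (i, b)) = - 2^-1 *: letter star (U i) b t.
  by rewrite /jletter /letter; case: (b).
split.
- by rewrite lv h1.
- move=> c; rewrite slice_cat slice_mulr slice_mull lv h2 ld h1 /slice big_seq1.
  by rewrite -scalerAl.
rewrite lv lq h1 h3 /contr (bigD1 i) //= [X in _ + (_ + X)]big1; last first.
  by move=> j' ne; rewrite ld' // big_nil.
rewrite addr0 ld big_seq1 /= h2 mulrBr -!(@scalerAr _ A) -!(@scalerAl _ A).
have -> : ((size w).+1%:R / 2)%:C = ((size w)%:R / 2)%:C + 2^-1 :> R[i].
  by rewrite -natr1 mulrDl mul1r rmorphD fmorphV rmorph_nat.
by rewrite scalerDl opprD !scaleNr !addrA [LHS](ACl (2*4*3*1))%AC.
Qed.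

Lemma has_derivative_pos (f g : R -> R[i]) t l : (forall s, 0 < s -> f s = g s) -> 0 < t ->
  has_derivative f t l -> has_derivative g t l.
Proof.
move=> fg t0; apply: cvg_trans; apply: near_eq_cvg; near=> h.
rewrite !fg //; have : `|h| < t by near: h; exact: dnbhs0_lt.
by rewrite ltr_norml => /andP[]; lra.
Unshelve. all: by end_near.
Qed.

Lemma proc_mem t i : 0 < t -> S i (U i t).
Proof. by move=> t0; exists t => //=; exact: ltW. Qed.

(** Induction on the length. For at least two blocks, [cext] vanishes at all s > 0, so the moment of
    the top word equals an expression in shorter words, whose derivative is known;
    [cext_deriv_moment_eq0] identifies the result with [moment_deriv]. *)
Lemma joint_derivative w t : 0 < t ->
  has_derivative (fun s => moment (U^~ s) w) t (moment_deriv (U^~ t) w).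
Proof.
move=> t0; have [n] := ubnP (size w); elim: n w => // n IH w; rewrite ltnS => wn.
have [B hB eB] := block_decomp_ex w.
have single i w' : all (fun l => l.1 == i) w' ->
    has_derivative (fun s => moment (U^~ s) w') t (moment_deriv (U^~ t) w').
  move=> hw; have h := @word_derivative _ _ _ _ _ _ _ hA htau _ _ (hU i) t t0 (map snd w').
  apply: has_derivative_ext h.
    by move=> s; rewrite /moment; have [-> _ _] := jword_single s hw.
  rewrite /moment_deriv; have [_ _ ->] := jword_single t hw.
  by rewrite (tauB tau) (tauZ tau) size_map.
case: B hB eB => [|p [|q B]] hB eB.
- rewrite -eB; apply: has_derivative_ext (has_derivative_cst 1 t) => [s|].
    by rewrite /moment /= (tau1 htau).
  by rewrite /moment_deriv /= (tau0 tau).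
- by case: hB => _ hp _ _; rewrite -eB /= cats0; exact: single hp.
have hs := blocks_small hB isT; rewrite eB in hs.
have small w' : (size w' < size w)%N -> has_derivative (fun s => moment (U^~ s) w') t (moment_deriv (U^~ t) w').
  by move=> hw; apply: IH; exact: leq_trans hw wn.
have [_] := @cext_has_derivative R I (size w) (fun s => moment (U^~ s)) _ t small _ [::] hs.
rewrite add0n eB => /(_ (leqnn _)).
rewrite (cext_deriv_moment_eq0 htau free (fun i => proc_mem i t0) hB) sub0r => h.
have h' := @has_derivativeZ _ _ t (-1) _ h.
rewrite mulN1r opprK in h'; apply: has_derivative_pos h' => // s s0.
by rewrite (cext_moment_eq0 htau free (fun i => proc_mem i s0) hB) // sub0r mulN1r opprK.
Qed.

Lemma exchangeable (f : I -> I) t w : injective f -> 0 < t ->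
  moment (fun i => U (f i) t) w = moment (U^~ t) w.
Proof.
move=> injf t0.
have free' : star_free star tau (fun i => S (f i)).
  move=> m i a h1 h2; apply: (free h1) => l lm e; apply: (h2 l lm); exact: injf e.
apply: (moment_eq htau free' free) => [i|i|i w' hw]; [exact: proc_mem|exact: proc_mem|].
have [e _ _] := jword_single t hw.
have -> : moment (fun i => U (f i) t) w' = tau (word_val star (U (f i)) (map snd w') t).
  congr (tau _); elim: w' hw {e} => [|[j b] w' IH] //= /andP[/eqP -> hw].
  by rewrite -IH //; case: b.
by rewrite /moment e; apply: (word_moments_eq hA htau (hU (f i)) (hU i)).
Qed.

End JointProcess.

(** * Moments of the sum *)

Section SumJets.
Variables (R : realType) (A : algType R[i]) (star : A -> A) (tau : {scalar A}).
Variable I : finType.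
Local Notation jmul := (jmul tau).
Local Notation jword := (jword star tau).
Local Notation jletter := (jletter star).
Implicit Types (u : I -> A) (b : bool).

(** Jet of the sum of the letters: only the letter of index j has a coefficient of x_j, so [jd]
    takes that one and no lists need to be merged. *)
Definition jsum u b : jet A I :=
  Jet (\sum_i jv (jletter u (i, b))) (fun j => jd (jletter u (j, b)) j)
    (\sum_i jq (jletter u (i, b))).

Definition jsums u (bs : seq bool) : jet A I := foldr (fun b => jmul (jsum u b)) (jone A I) bs.

Lemma jd_jletter_neq u b i j : j != i -> jd (jletter u (i, b)) j = [::].
Proof. by move=> ne; rewrite /jletter; case: (b); rewrite /= (negPf ne). Qed.

Lemma slice_sum (F : I -> A) d : slice tau (\sum_i F i) d = \sum_i slice tau (F i) d.
Proof.
rewrite /slice exchange_big /=; apply: eq_bigr => p _.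
by rewrite mulr_suml raddf_sum scaler_suml.
Qed.

Lemma jv_mul_jsum u p b c : jv (jmul p (jmul (jsum u b) c)) =
  \sum_i jv (jmul p (jmul (jletter u (i, b)) c)).
Proof. by rewrite /= mulr_suml mulr_sumr. Qed.

Lemma jq_mul_jsum u p b c : jq (jmul p (jmul (jsum u b) c)) =
  \sum_i jq (jmul p (jmul (jletter u (i, b)) c)).
Proof.
rewrite /= !big_split /=; congr (_ + _ + _).
- by rewrite mulr_suml mulr_sumr.
- rewrite -mulr_sumr; congr (_ * _); rewrite !big_split /=; congr (_ + _ + _).
  + by rewrite mulr_suml.
  + by rewrite mulr_suml.
  + rewrite /contr; apply: eq_bigr => i _ /=.
    rewrite [RHS](bigD1 i) //= [X in _ = _ + X]big1 ?addr0 // => j ji.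
    by rewrite jd_jletter_neq // big_nil.
rewrite /contr exchange_big /=; apply: eq_bigr => j _.
rewrite exchange_big /=; apply: eq_bigr => q _.
rewrite -mulr_sumr; congr (_ * _); rewrite slice_cat slice_mulr slice_mull.
rewrite mulr_sumr slice_sum.
under [RHS]eq_bigr do rewrite slice_cat slice_mulr slice_mull.
rewrite big_split /=; congr (_ + _).
rewrite (bigD1 j) //= big1 ?addr0 // => i ij.
by rewrite jd_jletter_neq 1?eq_sym // slice_nil mul0r.
Qed.

Lemma jword_rcons_mul u pre l c :
  jmul (jword u pre) (jmul (jletter u l) c) = jmul (jword u (rcons pre l)) c.
Proof. by rewrite -cats1 jword_cat -jmulA /= -jmulA jmul1. Qed.

End SumJets.

Section SumProcess.
Variables (R : realType) (A : algType R[i]) (star : A -> A)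
  (H : completeNormedModType R[i]) (ip : {dot H for Num.conj}) (pi : A -> H -> H)
  (tau : {scalar A}).
Hypothesis hA : von_neumann_algebra star ip pi.
Hypothesis htau : faithful_normal_tracial_state star ip pi tau.
Variable I : finType.
Local Notation jmul := (jmul tau).
Local Notation jword := (jword star tau).
Local Notation jletter := (jletter star).
Local Notation jsums := (jsums star tau).
Variables X U : I -> R -> A.
Hypothesis hU : forall i, free_unitary_brownian_motion star pi tau (X i) (U i).
Hypothesis free : star_free star tau (fun i => [set U i t | t in [set t : R | 0 <= t]]).

Lemma has_derivative_sum (F : I -> R -> R[i]) (l : I -> R[i]) t :
  (forall i, has_derivative (F i) t (l i)) ->
  has_derivative (fun s => \sum_i F i s) t (\sum_i l i).
Proof.
move=> h; elim: (index_enum I) => [|i r IH].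
  apply: (@has_derivative_ext _ (fun=> 0) _ t 0 _ _ _ (@has_derivative_cst _ 0 t)) => [s|].
    by rewrite big_nil.
  by rewrite big_nil.
apply: (@has_derivative_ext _ _ _ t _ _ _ _ (@has_derivativeD _ _ _ t _ _ (h i) IH)) => [s|].
  by rewrite big_cons.
by rewrite big_cons.
Qed.

(** The prefix is general because each step expands one sum and moves the chosen letter into it,
    until [joint_derivative] applies to a plain word. *)
Lemma jsums_derivative bs pre t : 0 < t ->
  has_derivative (fun s => tau (jv (jmul (jword (U^~ s) pre) (jsums (U^~ s) bs)))) t
    (tau (jq (jmul (jword (U^~ t) pre) (jsums (U^~ t) bs)))).
Proof.
move=> t0; elim: bs pre => [|b bs IH] pre.
  have h := @joint_derivative _ _ _ _ _ _ _ hA htau I X U hU free pre t t0.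
  apply: has_derivative_ext h => [s|].
    by rewrite /moment -[jsums _ _]/(jword (U^~ s) [::]) -jword_cat cats0.
  by rewrite /moment_deriv -[jsums _ _]/(jword (U^~ t) [::]) -jword_cat cats0.
have h := @has_derivative_sum _ _ t (fun i => IH (rcons pre (i, b))).
apply: has_derivative_ext h => [s|].
  rewrite [jsums _ (b :: bs)]/= jv_mul_jsum raddf_sum; apply: eq_bigr => i _.
  by rewrite jword_rcons_mul.
rewrite [jsums _ (b :: bs)]/= jq_mul_jsum raddf_sum; apply: eq_bigr => i _.
by rewrite jword_rcons_mul.
Qed.

(** Sums over all indices are invariant under [f], so the whole product may be relabelled and then
    expanded into words, to which [exchangeable] applies. *)
Lemma jsums_exchangeable (f : {perm I}) bs pre t : 0 < t ->
  tau (jv (jword (fun i => U (f i) t) pre) * jv (jsums (U^~ t) bs)) =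
  tau (jv (jword (U^~ t) pre) * jv (jsums (U^~ t) bs)).
Proof.
move=> t0.
have e : jv (jsums (fun i => U (f i) t) bs) = jv (jsums (U^~ t) bs).
  elim: bs => //= b bs ->; congr (_ * _).
  by rewrite [RHS](reindex_inj (@perm_inj _ f)) /=; apply: eq_bigr => i _; case: b.
rewrite -[in LHS]e; elim: bs pre {e} => [|b bs IH] pre.
  by rewrite !mulr1; exact: (exchangeable hA htau hU free pre (@perm_inj _ f) t0).
have jvE u p c : jv p * jv (jsums u (b :: c)) = jv (jmul p (jmul (jsum star u b) (jsums u c))) by [].
rewrite !jvE !jv_mul_jsum !raddf_sum; apply: eq_bigr => i _.
by rewrite !jword_rcons_mul; exact: IH.
Qed.

End SumProcess.

(** * Evaluation of the second order term of the powers of W *)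

Section Final.
Variables (R : realType) (A : algType R[i]) (star : A -> A)
  (H : completeNormedModType R[i]) (ip : {dot H for Num.conj}) (pi : A -> H -> H)
  (tau : {scalar A}).
Hypothesis hA : von_neumann_algebra star ip pi.
Hypothesis htau : faithful_normal_tracial_state star ip pi tau.
Variable k : nat.
Hypothesis k0 : (0 < k)%N.
Local Notation jmul := (jmul tau).
Local Notation jsum := (jsum star).
Local Notation jsums := (jsums star tau).
Local Notation slice := (slice tau).
Variables X U : 'I_k -> R -> A.
Hypothesis hU : forall i, free_unitary_brownian_motion star pi tau (X i) (U i).
Hypothesis free : star_free star tau (fun i => [set U i t | t in [set t : R | 0 <= t]]).
Variable t : R.
Hypothesis t0 : 0 < t.
Let u : 'I_k -> A := U^~ t.
Let G := \sum_i u i.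
Let G' := \sum_i star (u i).
Let W := G * G'.
Let m n := tau (W ^+ n).

Fixpoint alt_word n : seq bool := if n is n'.+1 then true :: false :: alt_word n' else [::].

Lemma jsums_cat (v : 'I_k -> A) bs bs' : jsums v (bs ++ bs') = jmul (jsums v bs) (jsums v bs').
Proof. by elim: bs => [|b bs IH] /=; rewrite ?jmul1 // IH jmulA. Qed.

Lemma jv_alt n : jv (jsums u (alt_word n)) = W ^+ n.
Proof. by elim: n => [|n IH] /=; rewrite ?expr0 // IH exprS mulrA. Qed.

Lemma tau_jletter_jsums bs b (j : 'I_k) :
  tau (jv (jletter star u (j, b)) * jv (jsums u bs)) = tau (jv (jsums u (b :: bs))) / k%:R.
Proof.
have kn : (k%:R : R[i]) != 0 by rewrite pnatr_eq0 -lt0n.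
have all i : tau (jv (jletter star u (i, b)) * jv (jsums u bs)) = tau (jv (jletter star u (j, b)) * jv (jsums u bs)).
  have h := jsums_exchangeable hA htau hU free (tperm i j) bs [:: (j, b)] t0.
  move: h; rewrite /= !mulr1 => <-; congr (tau (_ * _)).
  by rewrite /jletter /=; case: (b); rewrite /= tpermR.
rewrite /= mulr_suml raddf_sum /= (eq_bigr _ (fun i _ => all i)) sumr_const card_ord.
by rewrite -[X in _ = X / _]mulr_natr mulfK.
Qed.

Lemma tau_uG j p : tau (u j * G' * W ^+ p) = m p.+1 / k%:R.
Proof.
have := tau_jletter_jsums (false :: alt_word p) true j; rewrite [jv (jletter _ _ _)]/=.
have -> : jv (jsums u (false :: alt_word p)) = G' * W ^+ p by rewrite -jv_alt.
by rewrite mulrA => ->; congr (tau _ / _); rewrite -jv_alt.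
Qed.

Lemma tau_uG' j p : tau (star (u j) * W ^+ p * G) = m p.+1 / k%:R.
Proof.
have := tau_jletter_jsums (alt_word p ++ [:: true]) false j; rewrite [jv (jletter _ _ _)]/=.
have e : jv (jsums u (alt_word p ++ [:: true])) = W ^+ p * G by rewrite jsums_cat /= jv_alt mulr1.
rewrite e mulrA => ->; congr (_ / _).
have -> : jv (jsums u (false :: alt_word p ++ [:: true])) = G' * (W ^+ p * G) by rewrite -e.
by rewrite (tauC htau) -mulrA -exprSr.
Qed.

Lemma proc_unitary j : u j * star (u j) = 1.
Proof. by have [] := fubm_unitary hA htau (hU j) t0. Qed.

Definition jW := jmul (jsum u true) (jsum u false).

Lemma jsums_altS n : jsums u (alt_word n.+1) = jmul jW (jsums u (alt_word n)).
Proof. by rewrite /jW -jmulA. Qed.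

Lemma jdW j : jd jW j = [:: ('i *: u j, G'); (- 'i *: G, star (u j))].
Proof.
rewrite /jW /= /tmulr /tmull /jletter /= eqxx /= mul1r -(@scalerAr _ A) mulr1.
by [].
Qed.

Lemma sliceW c j : slice c (jd jW j) = ('i * tau (c * u j)) *: G' - ('i * tau (c * G)) *: star (u j).
Proof.
rewrite jdW /slice !big_cons big_nil addr0 -!(@scalerAr _ A) !(tauZ tau) mulNr scaleNr.
by [].
Qed.

Lemma mul_ii : 'i * 'i = -1 :> R[i].
Proof. by rewrite -expr2 sqr_i. Qed.

(** The two drifts - 1/2 add up to - W, and each of the k contractions of u_j with its own adjoint
    gives u_j star u_j = 1. *)
Lemma jqW : jq jW = k%:R%:A - W.
Proof.
have jq1 b : jq (jsum u b) = - 2^-1 *: jv (jsum u b).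
  rewrite /= scaler_sumr; apply: eq_bigr => i _.
  by rewrite /jletter; case: ifP.
have -> : jq jW = jq (jsum u true) * jv (jsum u false) + jv (jsum u true) * jq (jsum u false)
   + contr tau (jd (jsum u true)) (jd (jsum u false)) by [].
rewrite !jq1 -(@scalerAl _ A) -(@scalerAr _ A) -scalerDl.
have -> : - 2^-1 + - 2^-1 = -1 :> R[i] by field.
rewrite scaleN1r addrC; congr (_ - _).
rewrite /contr.
have term j : \sum_(p <- jd (jsum u true) j) p.1 * slice p.2 (jd (jsum u false) j) = 1.
  rewrite /= /jletter /= eqxx big_seq1 /= /slice big_seq1 /= mul1r (tauZ tau) (tau1 htau) mulr1.
  by rewrite -(@scalerAr _ A) -(@scalerAl _ A) scalerA mulNr mul_ii opprK scale1r proc_unitary.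
rewrite (eq_bigr _ (fun j _ => term j)) sumr_const card_ord.
by rewrite scaler_nat.
Qed.

Lemma slice_alt c n j : slice c (jd (jsums u (alt_word n)) j) =
  \sum_(p < n) slice (c * W ^+ p) (jd jW j) * W ^+ (n - p.+1).
Proof.
elim: n c => [|n IH] c; first by rewrite big_ord0 slice_nil.
rewrite jsums_altS [jd _ j]/= slice_cat slice_mulr slice_mull jv_alt IH big_ord_recl /= subSS subn0 expr0 mulr1.
congr (_ + _); apply: eq_bigr => p _; rewrite subSS /bump /= add1n exprS.
by rewrite /W /G /G' !mulrA.
Qed.

(** Contribution of two of N factors W with p factors between them, summed over j. The first two
    terms come from the choices (u_j, star u_j) and (star u_j, u_j) of the contracted letters; the
    equal choices have sign 'i * 'i = -1, and each gives k times (m / k)(m / k). *)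
Definition pair_coeff N p : R[i] := k%:R * m p.+1 * m (N - p.+2)%N + k%:R * m p * m (N - p.+1)%N
  - 2 / k%:R * m p.+1 * m (N - p.+1)%N.

Lemma tau_contr r n : tau (W ^+ r * contr tau (jd jW) (jd (jsums u (alt_word n)))) =
  \sum_(p < n) pair_coeff (r + n).+1 p.
Proof.
have kn : (k%:R : R[i]) != 0 by rewrite pnatr_eq0 -lt0n.
have term j (p : 'I_n) : tau (W ^+ r * ('i *: u j * (slice (G' * W ^+ p) (jd jW j) * W ^+ (n - p.+1)))) +
    tau (W ^+ r * (- 'i *: G * (slice (star (u j) * W ^+ p) (jd jW j) * W ^+ (n - p.+1)))) =
    pair_coeff (r + n).+1 p / k%:R.
  rewrite !sliceW; set q := (n - p.+1)%N.
  have eq1 : ((r + n).+1 - p.+2 = q + r)%N by rewrite /q; have := ltn_ord p; lia.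
  have eq2 : ((r + n).+1 - p.+1 = (q + r).+1)%N by rewrite /q; have := ltn_ord p; lia.
  have a1 : tau (G' * W ^+ p * u j) = m p.+1 / k%:R by rewrite (tauC htau) mulrA tau_uG.
  have a2 : tau (G' * W ^+ p * G) = m p.+1 by rewrite (tauC htau) mulrA -exprS.
  have a3 : tau (star (u j) * W ^+ p * u j) = m p by rewrite (tauC htau) mulrA proc_unitary mul1r.
  have a4 := tau_uG' j p.
  have b1 : tau (W ^+ r * (u j * (G' * W ^+ q))) = m (q + r).+1 / k%:R.
    by rewrite (tauC htau) -(tau_uG j) exprD !mulrA.
  have b2 : tau (W ^+ r * (u j * (star (u j) * W ^+ q))) = m (q + r)%N.
    by rewrite [u j * _]mulrA proc_unitary mul1r (tauC htau) -exprD.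
  have b3 : tau (W ^+ r * (G * (G' * W ^+ q))) = m (q + r).+1.
    by rewrite [G * _]mulrA -exprS (tauC htau) -exprD addSn.
  have b4 : tau (W ^+ r * (G * (star (u j) * W ^+ q))) = m (q + r).+1 / k%:R.
    by rewrite mulrA (tauC htau) -mulrA [W ^+ q * _]mulrA -exprD mulrA tau_uG'.
  rewrite /pair_coeff eq1 eq2 a1 a2 a3 a4.
  have alg (a b z : R[i]) (g x y w v : A) : tau (w * (z *: g * ((a *: x - b *: y) * v))) =
      z * a * tau (w * (g * (x * v))) - z * b * tau (w * (g * (y * v))).
    rewrite mulrBl -!(@scalerAl _ A) mulrBr -!(@scalerAr _ A) (tauZ tau) mulrBr (tauB tau).
    by rewrite -!(@scalerAr _ A) !(tauZ tau); ring.
  rewrite !alg b1 b2 b3 b4.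
  apply/eqP; rewrite -subr_eq0 (_ : _ - _ = ('i * 'i + 1) *
    (2 * (m p.+1 * m (q + r).+1) / (k%:R * k%:R) - m p.+1 * m (q + r)%N - m p * m (q + r).+1)).
    by rewrite mul_ii addNr mul0r.
  by field.
transitivity (\sum_(j < k) \sum_(p < n) pair_coeff (r + n).+1 p / k%:R); last first.
  rewrite sumr_const card_ord -mulr_suml -[X in X = _]mulr_natr divfK //.
rewrite /contr mulr_sumr raddf_sum; apply: eq_bigr => j _.
have e2 (a y : A) : tau (W ^+ r * (y * slice a (jd (jsums u (alt_word n)) j))) =
    \sum_(p < n) tau (W ^+ r * (y * (slice (a * W ^+ p) (jd jW j) * W ^+ (n - p.+1)))).
  by rewrite slice_alt !mulr_sumr raddf_sum.
rewrite {1}jdW !big_cons big_nil addr0 mulrDr [LHS]raddfD [X in X + _]e2 [X in _ + X]e2 -big_split.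
by apply: eq_bigr => p _; exact: (term j p).
Qed.

Lemma tau_jq_alt r n : tau (W ^+ r * jq (jsums u (alt_word n))) =
  \sum_(q < n) (k%:R * m (r + n).-1 - m (r + n)%N + \sum_(p < q) pair_coeff (r + n) p).
Proof.
elim: n r => [|n IH] r; first by rewrite big_ord0 mulr0 (tau0 tau).
have -> : jq (jsums u (alt_word n.+1)) = jq jW * W ^+ n + W * jq (jsums u (alt_word n)) +
    contr tau (jd jW) (jd (jsums u (alt_word n))).
  by rewrite jsums_altS -jv_alt.
rewrite !mulrDr !(tauD tau) tau_contr mulrA mulrA -exprSr IH big_ord_recr addnS addSn.
rewrite [in LHS]addrAC addrC; congr (_ + _); congr (_ + _); rewrite -[_.+1.-1]/(r + n)%N.
rewrite jqW mulrBr -(@scalerAr _ A) mulr1 mulrBl -(@scalerAl _ A) (tauB tau) (tauZ tau).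
by rewrite -exprSr -!exprD addSn.
Qed.

(** Contractions are indexed by pairs of positions in a linear word, whereas the trace is cyclic:
    exchanging the gap p with the complementary gap turns the triangular sum into half of a full
    rectangle. *)
Lemma triangle_sum N (c : nat -> R[i]) : (forall p, (p < N)%N -> c p = c (N - p.+1)%N) ->
  2 * \sum_(q < N.+1) \sum_(p < q) c p = N.+1%:R * \sum_(p < N) c p.
Proof.
move=> sym; pose S q := \sum_(p < q) c p.
have key q : (q <= N)%N -> S q + S (N - q)%N = S N.
  move=> qN; rewrite /S -[in RHS](subnKC qN) big_split_ord /=; congr (_ + _).
  rewrite (reindex_inj rev_ord_inj) /=; apply: eq_bigr => p _.
  rewrite sym; last by have := ltn_ord p; lia.
  by congr c; have := ltn_ord p; lia.
have rev : \sum_(q < N.+1) S q = \sum_(q < N.+1) S (N - q)%N.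
  by rewrite (reindex_inj rev_ord_inj) /=; apply: eq_bigr => q _; rewrite subSS.
rewrite mulr2n mulrDl mul1r {2}rev -big_split /=.
rewrite (eq_bigr (fun=> S N)); last by move=> q _; apply: key; rewrite -ltnS.
by rewrite sumr_const card_ord mulr_natl.
Qed.

Lemma tau_jq_final n : (0 < n)%N -> tau (jq (jsums u (alt_word n))) =
  - (n%:R * m n) + n%:R * k%:R * m n.-1
     + n%:R * k%:R * (\sum_(0 <= j < n.-1) m (n - j - 1)%N * m j)
     - n%:R / k%:R * (\sum_(0 <= j < n.-1) m (n - j - 1)%N * m j.+1).
Proof.
case: n => // N _; have := tau_jq_alt 0 N.+1; rewrite expr0 mul1r add0n => ->.
have kn : (k%:R : R[i]) != 0 by rewrite pnatr_eq0 -lt0n.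
rewrite big_split /= sumr_const card_ord.
have sym p : (p < N)%N -> pair_coeff N.+1 p = pair_coeff N.+1 (N - p.+1)%N.
  move=> pN; rewrite /pair_coeff.
  have -> : (N.+1 - p.+2 = N - p.+1)%N by lia.
  have -> : (N.+1 - (N - p.+1).+2 = p)%N by lia.
  have -> : (N.+1 - (N - p.+1).+1 = p.+1)%N by lia.
  have -> : (N.+1 - p.+1 = (N - p.+1).+1)%N by lia.
  ring.
have h := triangle_sum sym.
have -> : \sum_(q < N.+1) \sum_(p < q) pair_coeff N.+1 p = N.+1%:R / 2 * \sum_(p < N) pair_coeff N.+1 p.
  by rewrite mulrAC -h mulrC mulrA mulVf ?mul1r// pnatr_eq0.
have -> : \sum_(p < N) pair_coeff N.+1 p = 2 * k%:R * \sum_(0 <= j < N) m (N.+1 - j - 1)%N * m j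
   - 2 / k%:R * \sum_(0 <= j < N) m (N.+1 - j - 1)%N * m j.+1.
  rewrite !big_mkord /pair_coeff sumrB big_split /=; congr (_ - _); last first.
    rewrite mulr_sumr; apply: eq_bigr => p _; rewrite -!mulrA; congr (_ * (_ * _)).
    by rewrite mulrC -subnDA addn1.
  have s2 : \sum_(p < N) k%:R * m p * m (N.+1 - p.+1)%N = k%:R * \sum_(p < N) m (N.+1 - p - 1)%N * m p.
    rewrite mulr_sumr; apply: eq_bigr => p _; rewrite -subnDA addn1; ring.
  (* Reversing the index identifies the first sum of [pair_coeff] with the second; the resulting 2 k
     cancels the 1/2 of the triangular sum. *)
  rewrite {}s2 (reindex_inj rev_ord_inj) /=.
  have -> : \sum_(p < N) k%:R * m (N - p.+1).+1 * m (N.+1 - (N - p.+1).+2)%N = k%:R * \sum_(p < N) m (N.+1 - p - 1)%N * m p.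
    rewrite mulr_sumr; apply: eq_bigr => p _.
    have -> : (N.+1 - (N - p.+1).+2 = p)%N by have := ltn_ord p; lia.
    have -> : ((N - p.+1).+1 = N.+1 - p - 1)%N by have := ltn_ord p; lia.
    ring.
  ring.
rewrite -mulr_natl; field.
by [].
Qed.

End Final.

Theorem theorem1 (R : realType) (A : algType R[i]) (star : A -> A)
  (H : completeNormedModType R[i]) (ip : {dot H for Num.conj})
  (pi : A -> H -> H) (tau : {scalar A}) (k : nat) (X U : 'I_k -> R -> A)
  (hA : von_neumann_algebra star ip pi)
  (htau : faithful_normal_tracial_state star ip pi tau)
  (hk : (2 <= k)%N)
  (hXfree : star_free star tau (fun j => [set X j t | t in [set t : R | 0 <= t]]))
  (hU : forall j, free_unitary_brownian_motion star pi tau (X j) (U j))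
  (hUfree : star_free star tau (fun j => [set U j t | t in [set t : R | 0 <= t]]))
  (n : nat) (hn : (1 <= n)%N) (t : R) (ht : 0 < t) :
  let s := s_moment star tau U in
  has_derivative (s n) t
    (- (n%:R * s n t) + n%:R * k%:R * s n.-1 t
     + n%:R * k%:R * (\sum_(0 <= j < n.-1) s (n - j - 1)%N t * s j t)
     - n%:R / k%:R * (\sum_(0 <= j < n.-1) s (n - j - 1)%N t * s j.+1 t)).
Proof.
have k0 : (0 < k)%N by exact: ltn_trans hk.
have sE : s_moment star tau U =
    fun m r => tau (((\sum_i U i r) * (\sum_i star (U i r))) ^+ m).
  apply/funext => m; apply/funext => r.
  by rewrite /s_moment /W_prod /G_sum (star_sum hA).
have h := @jsums_derivative _ _ _ _ _ _ _ hA htau _ X U hU hUfree (alt_word n) [::] t ht.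
rewrite sE; apply: has_derivative_ext h => [r|].
  by rewrite -(jv_alt star tau) -[jv (jsums _ _ _ _)]mul1r.
rewrite -[jword _ _ _ _]/(jone A 'I_k) jmul1.
exact: (tau_jq_final hA htau k0 hU hUfree ht hn).
Qed.
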